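(* Let $n$ be sufficiently large, let $M\in\mathbb C^{n\times n}$, and let $m$ be an integer with $0\le m<n$. Let $R\ge4$, $\rho$, $\varepsilon$ be such that $$\frac{(\log R)^3(\log n)^3}{n}\le\rho\le\frac{n^{1/2}}{n},\qquad K=\left\lceil\frac{3\log(n)}{2\log(n\rho)}\right\rceil,\qquad \frac{1}{n^{10(K+1)}R^{10(K+1)}}\le\varepsilon\le\frac{1}{4n^{K+1}R^{K}}.$$ Let $N_g$ be the random $n\times n$ matrix whose entries are i.i.d. copies of $\delta\cdot g$, where $\delta\sim\mathrm{Bernoulli}(\rho)$ and $g$ is an independent standard complex Gaussian. Then $$\Pr\left(\sigma_{n-m}(M+N_g)\le\varepsilon\right)\le\left[8n^{2K+3}R^{2K}\varepsilon^2\right]^{m+1}+n^2\exp\left(-\frac34\rho n\right)+\Pr\left(\|M+N_g\|_\infty\ge R\right).$$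
   Context: $\sigma_1\ge\dots\ge\sigma_n$ denote singular values in decreasing order. $\|\cdot\|_\infty$ for a matrix is the $\ell_\infty\to\ell_\infty$ operator norm (maximum absolute row sum). $\log$ is the natural logarithm. A standard complex Gaussian has density $\pi^{-1}e^{-|z|^2}$ on $\mathbb C$. ''$n$ sufficiently large'' means $n\ge n_0$ for an absolute constant $n_0$ (uniform in $M,m,R,\rho,\varepsilon$). *)

(* Defs.v *)
From HB Require Import structures.
From mathcomp Require Import all_boot all_order all_algebra spectral.
From mathcomp Require Import complex.
From mathcomp Require Import all_classical all_reals all_analysis.

Set Implicit Arguments.
Unset Strict Implicit.
Unset Printing Implicit Defensive.

Import Order.TTheory GRing.Theory Num.Theory.
Import numFieldNormedType.Exports.
Import ComplexField.Normc.

Local Open Scope classical_set_scope.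
Local Open Scope ring_scope.
Local Open Scope complex_scope.
Local Open Scope sesquilinear_scope.

Definition complex_pair (F : Type) (z : F[i]) : F * F :=
  (complex.Re z, complex.Im z).

HB.instance Definition _ (F : realType) := isPointed.Build F[i] 0.

(* [F[i]] carries the Borel sigma-algebra of the plane: A is measurable iff it
   corresponds to a measurable set of F * F via z |-> (Re z, Im z). *)
Definition complex_measurable (F : realType) : set (set F[i]) :=
  g_sigma_algebra_preimage (@complex_pair F).

Section complex_measurable.
Variable F : realType.
Local Notation mC := (g_sigma_algebra_preimageType (@complex_pair F)).

Lemma complex_measurable0 : @complex_measurable F set0.
Proof. exact: (@measurable0 _ mC). Qed.

Lemma complex_measurableC A :
  @complex_measurable F A -> @complex_measurable F (~` A).
Proof. exact: (@measurableC _ mC). Qed.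

Lemma complex_measurable_bigcup (A : (set F[i])^nat) :
  (forall k, @complex_measurable F (A k)) ->
  @complex_measurable F (\bigcup_k A k).
Proof. by move=> mA; apply: (@bigcup_measurable _ mC) => k _; exact: mA. Qed.

HB.instance Definition _ := @isMeasurable.Build
  (preimage_display (@complex_pair F)) F[i] (@complex_measurable F)
  complex_measurable0 complex_measurableC complex_measurable_bigcup.

End complex_measurable.

(* [spectral_diag] lists the eigenvalues, with multiplicity, of the normal
   matrix A^* A; they are real and nonnegative. *)
Definition singular_values (F : realType) (n : nat) (A : 'M[F[i]]_n) : seq F :=
  sort (fun x y : F => y <= x)
    [seq Num.sqrt (complex.Re (spectral_diag (A ^t* *m A) ord0 j))
       | j <- enum 'I_n].

(* sigma_1 >= ... >= sigma_n: the index k is 1-based. *)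
Definition sigma (F : realType) (n : nat) (k : nat) (A : 'M[F[i]]_n) : F :=
  nth 0 (singular_values A) k.-1.

Definition norm_infty (F : realType) (n : nat) (A : 'M[F[i]]_n) : F :=
  \big[Num.max/0]_(i < n) \sum_(j < n) normc (A i j).

Definition gaussian_density (F : realType) (z : F[i]) : F :=
  pi^-1 * expR (- normc z ^+ 2).

Definition standard_complex_gaussian d (T : measurableType d) (F : realType)
    (P : probability T F) (g : {RV P >-> F[i]}) : Prop :=
  forall A : set F[i], measurable A ->
    P (g @^-1` A) =
    (\int[lebesgue_measure \x lebesgue_measure]_(p in [set p | A (p.1 +i* p.2)])
       (gaussian_density (p.1 +i* p.2))%:E)%E.

Definition bernoulli_rv d (T : measurableType d) (F : realType)
    (P : probability T F) (rho : F) (delta : {RV P >-> bool}) : Prop :=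
  forall A : set bool, distribution P delta A = bernoulli_prob rho A.

Definition independent2 d d1 d2 (T : measurableType d) (T1 : measurableType d1)
    (T2 : measurableType d2) (F : realType) (P : probability T F)
    (X : {RV P >-> T1}) (Y : {RV P >-> T2}) : Prop :=
  forall (A : set T1) (B : set T2), measurable A -> measurable B ->
    P (X @^-1` A `&` Y @^-1` B) = (P (X @^-1` A) * P (Y @^-1` B))%E.

Definition mutually_independent d d' (T : measurableType d)
    (T' : measurableType d') (F : realType) (P : probability T F)
    (I : finType) (X : I -> {RV P >-> T'}) : Prop :=
  forall (J : {set I}) (B : I -> set T'), (forall i, measurable (B i)) ->
    P (\bigcap_(i in [set` J]) (X i @^-1` B i)) =
    (\prod_(i in J) P (X i @^-1` B i))%E.

Definition identically_distributed d1 d2 d' (T1 : measurableType d1)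
    (T2 : measurableType d2) (T' : measurableType d') (F : realType)
    (P1 : probability T1 F) (P2 : probability T2 F)
    (X : T1 -> T') (Y : T2 -> T') : Prop :=
  forall A : set T', measurable A -> P1 (X @^-1` A) = P2 (Y @^-1` A).

(* The entries X ij are i.i.d. copies of delta * g, where delta and g are
   independent and live on a probability space (T', P') of their own. *)
Definition iid_copies_sparse_gaussian d d' (T : measurableType d)
    (T' : measurableType d') (F : realType) (P : probability T F)
    (P' : probability T' F) (n : nat) (rho : F)
    (X : 'I_n * 'I_n -> {RV P >-> F[i]})
    (delta : {RV P' >-> bool}) (g : {RV P' >-> F[i]}) : Prop :=
  [/\ bernoulli_rv rho delta, standard_complex_gaussian g,
      independent2 delta g, mutually_independent X &
      forall ij, identically_distributed P P' (X ij)
                   (fun w => (delta w)%:R * g w : F[i])].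

Definition random_matrix (T : Type) (F : realType) (n : nat)
    (X : 'I_n * 'I_n -> T -> F[i]) (w : T) : 'M[F[i]]_n :=
  \matrix_(i, j) X (i, j) w.

(* Main.v *)
(** Write A = M + N_g.  The heart of the matter is that, outside an event of
    probability about exp (- 3/4 rho n), a vector x with |x|_oo = 1 and
    |A x|_oo <= n eps has at least 3n/4 coordinates of modulus >= (n R)^-K.
    Indeed, let T be a set of coordinates above one scale, and suppose that
    the set V of coordinates above the next scale (smaller by a factor about
    n R) is only slightly larger.  Round x_T on a grid to a fixed vector z, and
    pick by maximal determinant at most |V| rows of A_V of which all other rows
    are combinations with coefficients of modulus <= 1.  Then every other row
    having a nonzero Bernoulli variable in T confines the Gaussian sum
    (A_T z)_r, which is independent of A_V, to a small disc.  The number of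
    large coordinates thus grows by (n rho)^(2/3) from one scale to the next,
    whence K scales.

    If sigma_{n-m} A <= eps, there is an (m+1)-dimensional space of row vectors
    u with |u A| <= eps |u|.  On m+1 rows chosen by maximal determinant in it,
    A nearly annihilates a vector that depends only on the other rows and is
    therefore spread out; each chosen row then costs a factor
    exp (- 3/4 rho n) + 4 n^2 eps^2 (n R)^(2K).

    No conditional expectation is needed: conditioning is replaced by rounding
    to a countable grid and taking the first admissible grid point. *)
From HB Require Import structures.
Require Import Defs.
From mathcomp Require Import all_boot all_order all_algebra complex spectral.
From mathcomp Require Import all_classical all_reals all_analysis.
From mathcomp Require Import measurable_realfun zify ring lra.

Set Implicit Arguments.
Unset Strict Implicit.
Unset Printing Implicit Defensive.

Import Order.TTheory GRing.Theory Num.Theory.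
Import ComplexField.Normc.

Local Open Scope classical_set_scope.
Local Open Scope ring_scope.

(** * Outer bounds by independent events *)

Section events.
Context d d' (T : measurableType d) (S : measurableType d') (F : realType)
  (P : probability T F) (I : finType) (X : I -> {RV P >-> S}).

(** The obstacle is the block [V] of intermediate coordinates. It is far larger than [T], and a net
    on its values would cost more than the small-ball estimate gains. Hence [V] is eliminated
    linearly: the combination that expresses one row of A_V through the chosen rows, applied to the
    relations A x ~ 0, removes x_V altogether. Only [V] and the set of chosen rows need enumeration,
    about |V| log n each in the exponent; the coefficients are governed by A_V alone and are
    selected rather than enumerated, at no cost. Their modulus at most 1 inflates errors only by a
    factor |V|; against the drop n R between scales this leaves a small-ball probability of order
    (|V|/n)^2, up to constants.

    The balance of exponents: while |T| is below 1/rho, about n rho |T| rows are hit. With b = (n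
    rho)^(1/3) and |V| about b^2 |T|, naming [V] costs b^2 |T| log n, which is affordable because b
    >= log n. [K] is the least integer with b^(2K) >= n.

    Events of the form: there is a vector x such that ..., are not visibly measurable; this is why
    bounds are stated for outer probability. *)

Definition block_gen (J : {set I}) : set (set T) :=
  [set E | exists i (B : set S), [/\ i \in J, measurable B & E = X i @^-1` B]].

Definition event (J : {set I}) : set (set T) := <<s block_gen J >>.

Implicit Types (J : {set I}).

Lemma event_sigma J : sigma_algebra setT (event J).
Proof. exact: smallest_sigma_algebra. Qed.

Lemma event0 J : event J set0. Proof. by have [] := event_sigma J. Qed.

Lemma eventC J A : event J A -> event J (~` A).
Proof. by have [_ h _] := event_sigma J; move/h; rewrite setTD. Qed.

Lemma event_bigcup J (A : (set T)^nat) :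
  (forall k, event J (A k)) -> event J (\bigcup_k A k).
Proof. by have [_ _] := event_sigma J; exact. Qed.

Lemma eventT J : event J setT.
Proof. by rewrite -setC0; apply: eventC; exact: event0. Qed.

Lemma eventU J A B : event J A -> event J B -> event J (A `|` B).
Proof.
move=> mA mB; rewrite -bigcup2E; apply: event_bigcup => -[|[|k]] //=.
exact: event0.
Qed.

Lemma eventI J A B : event J A -> event J B -> event J (A `&` B).
Proof.
move=> mA mB; rewrite -[A]setCK -[B]setCK -setCU.
exact: eventC (eventU (eventC mA) (eventC mB)).
Qed.

Lemma event_bigsetU (K : Type) J (r : seq K) (p : pred K) (A : K -> set T) :
  (forall k, p k -> event J (A k)) -> event J (\big[setU/set0]_(k <- r | p k) A k).
Proof. by move=> h; elim/big_ind: _ => //; [exact: event0|exact: eventU]. Qed.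

Lemma event_bigsetI (K : Type) J (r : seq K) (p : pred K) (A : K -> set T) :
  (forall k, p k -> event J (A k)) -> event J (\big[setI/setT]_(k <- r | p k) A k).
Proof. by move=> h; elim/big_ind: _ => //; [exact: eventT|exact: eventI]. Qed.

Lemma event_gen (J : {set I}) i (B : set S) : i \in J -> measurable B -> event J (X i @^-1` B).
Proof. by move=> iJ mB; apply: sub_gen_smallest; exists i, B. Qed.

Lemma sub_event (J J' : {set I}) : J \subset J' -> event J `<=` event J'.
Proof.
move=> JJ'; apply: sub_smallest2r; first exact: smallest_sigma_algebra.
move=> _ [i [B [iJ mB ->]]]; by exists i, B; split => //; exact: (fintype.subsetP JJ').
Qed.

Lemma event_measurable J E : event J E -> measurable E.
Proof.
apply: smallest_sub; first exact: sigma_algebra_measurable.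
move=> _ [i [B [_ mB ->]]]; rewrite -[_ @^-1` _]setTI.
exact: measurable_funPT.
Qed.

Hypothesis indep : mutually_independent X.

Definition rect (J : {set I}) : set (set T) :=
  [set E | exists2 B : I -> set S, (forall i, measurable (B i)) &
    E = \bigcap_(i in [set` J]) (X i @^-1` B i)].

Lemma rectI J : setI_closed (rect J).
Proof.
move=> _ _ [B mB ->] [C mC ->]; exists (fun i => B i `&` C i).
  by move=> i; exact: measurableI.
rewrite -bigcapI; by apply: eq_bigcapr => i _; rewrite preimage_setI.
Qed.

(** Rectangles generate the same sigma-algebra as single preimages but are closed under
    intersection, which Dynkin's argument requires. *)
Lemma event_rect J : event J = <<s rect J >>.
Proof.
rewrite eqEsubset; split.
  apply: sub_smallest2r; first exact: smallest_sigma_algebra.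
  move=> _ [i [B [iJ mB ->]]].
  exists (fun j => if j == i then B else setT).
    by move=> j; case: ifP.
  rewrite eqEsubset; split=> w /=.
    by move=> Bw j /=; case: eqP => [->|//].
  by move=> /(_ i iJ) /=; rewrite eqxx.
apply: smallest_sub; first exact: event_sigma.
move=> _ [B mB ->].
suff -> : \bigcap_(i in [set` J]) X i @^-1` B i = \big[setI/setT]_(i in J) X i @^-1` B i.
  by apply: event_bigsetI => i iJ; exact: event_gen.
rewrite (_ : [set` J] = [set` enum J]); last by apply/seteqP; split => i /=; rewrite mem_enum.
by rewrite bigcap_seq big_enum.
Qed.

(** Dynkin's theorem: for fixed [E], the measurable sets obeying the product rule form a
    lambda-system. *)
Lemma prob_indep_ext (G : set (set T)) (E : set T) :
  setI_closed G -> G `<=` measurable -> measurable E ->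
  (forall A, G A -> P (E `&` A) = P E * P A)%E ->
  forall A, <<s G >> A -> (P (E `&` A) = P E * P A)%E.
Proof.
move=> GI Gm mE GP A sGA.
suff: <<s G >> `<=` [set A | measurable A /\ (P (E `&` A) = P E * P A)%E].
  by move=> /(_ _ sGA)[].
apply: lambda_system_subset; [by []| | |by []]; last first.
  by move=> B GB; split; [exact: Gm|exact: GP].
apply/dynkin_lambda_system; split.
- by split => //; rewrite setIT probability_setT mule1.
- move=> B [mB PB]; split; first exact: measurableC.
  transitivity (P E - P (E `&` B))%E.
    by rewrite -setDE measureD// ltey_eq fin_num_measure.
  by rewrite PB probability_setC// muleBr ?mule1// fin_num_measure.
- move=> B tB h; split; first by apply: bigcup_measurable => k _; exact: (h k).1.
  rewrite setI_bigcupr.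
  have mB k : measurable (B k) by exact: (h k).1.
  rewrite !measure_bigcup//; last 2 first.
  + by move=> k _; exact: measurableI.
  + exact: trivIset_setIl.
  have PE : P E \is a fin_num by rewrite fin_num_measure.
  transitivity (\sum_(0 <= k <oo | k \in [set: nat]) (fine (P E))%:E * P (B k))%E.
    apply: eq_eseriesr => k _; rewrite fineK//; exact: (h k).2.
  by rewrite nneseriesZl ?fineK.
Qed.

Lemma rect_measurable J : rect J `<=` measurable.
Proof.
move=> A rA; apply: (@event_measurable J); rewrite event_rect.
exact: sub_gen_smallest.
Qed.

Lemma prob_rect_indep J J' E E' : [disjoint J & J']%B -> rect J E -> rect J' E' ->
  (P (E `&` E') = P E * P E')%E.
Proof.
move=> JJ' [B mB ->] [B' mB' ->].
pose C i := if i \in J then B i else B' i.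
have mC i : measurable (C i) by rewrite /C; case: ifP.
have e1 : \bigcap_(i in [set` J]) X i @^-1` B i = \bigcap_(i in [set` J]) X i @^-1` C i.
  by apply: eq_bigcapr => i /= iJ; rewrite /C iJ.
have e2 : \bigcap_(i in [set` J']) X i @^-1` B' i = \bigcap_(i in [set` J']) X i @^-1` C i.
  by apply: eq_bigcapr => i /= iJ'; rewrite /C (disjointFl JJ' iJ').
rewrite e1 e2 -bigcap_setU.
rewrite (_ : [set` J] `|` [set` J'] = [set` J :|: J']); last first.
  by apply/seteqP; split => i /=; rewrite inE => /orP.
rewrite !indep// -bigU//; apply: eq_bigl => i; by rewrite !inE.
Qed.

(** Dynkin extension used twice: the first pass frees one factor from being a rectangle, the second
    the other. *)
Lemma event_indep J J' E E' : [disjoint J & J']%B -> event J E -> event J' E' ->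
  (P (E `&` E') = P E * P E')%E.
Proof.
move=> JJ' mE; rewrite event_rect; apply: prob_indep_ext.
- exact: rectI.
- exact: rect_measurable.
- exact: event_measurable mE.
- move=> A rA; rewrite setIC muleC; move: E mE; rewrite event_rect.
  apply: prob_indep_ext.
  + exact: rectI.
  + exact: rect_measurable.
  + exact: rect_measurable rA.
  + by move=> B rB; apply: (@prob_rect_indep J' J) => //; rewrite disjoint_sym.
Qed.

(* [ob J E b]: the set [E], not necessarily measurable, has outer probability at
   most [b], witnessed by an event depending only on the variables in [J]. *)
Definition ob (J : {set I}) (E : set T) (b : F) : Prop :=
  exists E', [/\ event J E', E `<=` E' & (P E' <= b%:E)%E].

Lemma ob_sub (J J' : {set I}) (E E' : set T) (b b' : F) :
  J \subset J' -> E `<=` E' -> b <= b' -> ob J E' b -> ob J' E b'.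
Proof.
move=> JJ' EE' bb' [G [mG E'G PG]]; exists G; split.
- exact: sub_event JJ' _ mG.
- exact: subset_trans E'G.
- by rewrite (le_trans PG)// lee_fin.
Qed.

Lemma ob_set0 J : ob J set0 0.
Proof. by exists set0; split => //; [exact: event0|rewrite measure0]. Qed.

Lemma ob1 J E : ob J E 1.
Proof. by exists setT; split => //; [exact: eventT|rewrite probability_setT]. Qed.

Lemma obU J E E' b b' : ob J E b -> ob J E' b' -> ob J (E `|` E') (b + b').
Proof.
move=> [G [mG EG PG]] [G' [mG' EG' PG']]; exists (G `|` G'); split.
- exact: eventU mG mG'.
- exact: setUSS.
- rewrite EFinD (le_trans (measureU2 _ _ _))//; try exact: event_measurable.
  + exact: event_measurable mG.
  + exact: event_measurable mG'.
  + exact: leeD.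
Qed.

Lemma ob_bigcup (K : Type) J (r : seq K) (p : pred K) (E : K -> set T) (b : K -> F) :
  (forall k, p k -> ob J (E k) (b k)) ->
  ob J (\big[setU/set0]_(k <- r | p k) E k) (\sum_(k <- r | p k) b k).
Proof.
move=> h; elim/big_ind2: _ => //; first exact: ob_set0.
by move=> *; exact: obU.
Qed.

Lemma ob_exists (K : finType) (p : pred K) J (E : K -> set T) (b : K -> F) :
  (forall k, p k -> ob J (E k) (b k)) ->
  ob J [set w | exists2 k, p k & E k w] (\sum_(k | p k) b k).
Proof.
move=> /(@ob_bigcup _ _ (index_enum K)); apply: ob_sub => // w [k pk Ekw].
by rewrite -bigcup_seq_cond; exists k => //=; rewrite mem_index_enum.
Qed.

Lemma obI J J' E E' b b' : [disjoint J & J']%B -> ob J E b -> ob J' E' b' ->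
  ob (J :|: J') (E `&` E') (b * b').
Proof.
move=> JJ' [G [mG EG PG]] [G' [mG' EG' PG']]; exists (G `&` G'); split.
- apply: eventI.
    exact: (sub_event (finset.subsetUl _ _) mG).
  exact: (sub_event (finset.subsetUr _ _) mG').
- exact: setISS.
- by rewrite (event_indep JJ' mG mG') EFinM lee_pmul.
Qed.

Lemma disjoint_bigcup (K : finType) (r : seq K) (J0 : {set I}) (J : K -> {set I}) :
  (forall k, k \in r -> [disjoint J0 & J k]%B) ->
  [disjoint J0 & \bigcup_(k <- r) J k]%B.
Proof.
move=> h; rewrite big_seq; elim/big_ind: _ => //.
- by rewrite -finset.setI_eq0 finset.setI0.
- by move=> A B; rewrite -!finset.setI_eq0 finset.setIUr finset.setU_eq0 => -> ->.
Qed.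

Lemma ob_forall (K : finType) (A : {set K}) (J : K -> {set I}) (E : K -> set T) (b : K -> F) :
  (forall k k', k != k' -> [disjoint J k & J k']%B) ->
  (forall k, k \in A -> ob (J k) (E k) (b k)) ->
  ob (\bigcup_(k in A) J k)%SET [set w | forall k, k \in A -> E k w] (\prod_(k in A) b k).
Proof.
move=> dJ h.
suff H r : uniq r -> {subset r <= A} ->
    ob (\bigcup_(k <- r) J k)%SET [set w | forall k, k \in r -> E k w] (\prod_(k <- r) b k).
  have sA : {subset enum A <= A} by move=> k; rewrite mem_enum.
  have := H _ (enum_uniq A) sA; rewrite !big_enum; apply: ob_sub => //.
  by move=> w hw k; rewrite mem_enum; exact: hw.
elim: r => [|k r IH] /=; first by move=> _ _; rewrite !big_nil; exact: ob1.
move=> /andP[kr ur] sA.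
have h1 : ob (J k) (E k) (b k) by apply: h; apply: sA; rewrite mem_head.
have sA' : {subset r <= A} by move=> x xr; apply: sA; rewrite inE xr orbT.
have {IH} h2 := IH ur sA'.
have dr : [disjoint J k & \bigcup_(k' <- r) J k']%B.
  by apply: disjoint_bigcup => k' k'r; apply: dJ; apply: contraNneq kr => ->.
rewrite !big_cons; apply: ob_sub (obI dr h1 h2) => // w hw; split.
  by apply: hw; rewrite mem_head.
by move=> k' k'r; apply: hw; rewrite inE k'r orbT.
Qed.

(* Conditioning on a discrete quantity: the events [Phi q] depend on [J], and once
   [q] is fixed the bound uses only the variables in [J']. *)
Lemma ob_select (Q : countType) J J' (Phi B : Q -> set T) (b : F) :
  0 <= b ->
  [disjoint J & J']%B -> (forall q, event J (Phi q)) ->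
  (forall q, ob J' (B q) b) ->
  ob (J :|: J') [set w | (exists q, Phi q w) /\ forall q, Phi q w -> B q w] b.
Proof.
move=> b0 JJ' mPhi hB.
have [B' hB'] := choice hB.
pose Psi k := if unpickle k is Some q then Phi q else set0.
pose C k := if unpickle k is Some q then B' q else set0.
have mPsi k : event J (Psi k) by rewrite /Psi; case: unpickle => // *; exact: event0.
have mC k : event J' (C k).
  by rewrite /C; case: unpickle => [a|]; [case: (hB' a)|exact: event0].
(* [seqDU] retains only the first index whose event occurs. The pieces are disjoint and depend on
   [J] alone, so the bounds [b] are averaged with weights of total at most 1 instead of being
   added. *)
pose G := \bigcup_k (seqDU Psi k `&` C k).
have mD k : event J (seqDU Psi k).
  rewrite /seqDU setDE; apply: eventI => //; apply: eventC.
  by apply: event_bigsetU.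
exists G; split.
- apply: event_bigcup => k; apply: eventI.
    by apply: sub_event (mD k); exact: finset.subsetUl.
  by apply: sub_event (mC k); exact: finset.subsetUr.
- move=> w [[q Phiqw] h].
  have : (\bigcup_k Psi k) w by exists (pickle q) => //; rewrite /Psi pickleK.
  rewrite seqDU_bigcup_eq => -[k _ Dk]; exists k => //; split => //.
  have : Psi k w by case: Dk.
  by rewrite /Psi /C; case: unpickle => // a /h; case: (hB' a) => _ + _; apply.
- have mDk k : measurable (seqDU Psi k) by exact: event_measurable (mD k).
  rewrite measure_bigcup//=; last 2 first.
  + by move=> k _; apply: measurableI => //; exact: event_measurable (mC k).
  + by apply: trivIset_setIr; exact: trivIset_seqDU.
  apply: (@le_trans _ _ (\sum_(0 <= k <oo | k \in [set: nat]) (P (seqDU Psi k) * b%:E))%E).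
    apply: lee_nneseries => // k _.
    rewrite (event_indep JJ' (mD k) (mC k)) lee_pmul//.
    rewrite /C; case: unpickle => [a|]; first by case: (hB' a).
    by rewrite measure0 lee_fin.
  under eq_eseriesr do rewrite muleC.
  rewrite nneseriesZl; last by move=> ? _; exact: measure_ge0.
  rewrite -[leRHS]mule1 lee_pmul//; first exact: nneseries_ge0.
  have <- : P (\bigcup_k seqDU Psi k) = (\sum_(0 <= k <oo | k \in [set: nat]) (P (seqDU Psi k)))%E.
    by rewrite measure_bigcup//; exact: trivIset_seqDU.
  by apply: probability_le1; exact: bigcup_measurable.
Qed.

End events.

(** * The law of one entry *)

Section square.
Variable F : realType.
Implicit Types (a z : F[i]) (h : F).

(** Squares stand in for discs: products of intervals are measurable with known area, and the loss
    is a constant factor. *)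
Definition square a h : set F[i] :=
  [set z | `|complex.Re z - complex.Re a| <= h /\ `|complex.Im z - complex.Im a| <= h].

Lemma complex_measurable_preimage (B : set (F * F)) :
  measurable B -> measurable ((@complex_pair F) @^-1` B : set F[i]).
Proof. by move=> mB; exists B => //; rewrite setTI. Qed.

Lemma measurable_Re : measurable_fun setT (@complex.Re F).
Proof.
move=> _ B mB; rewrite setTI.
have := complex_measurable_preimage (measurableX mB measurableT).
by congr (measurable _); apply/seteqP; split => z /=; [case|].
Qed.

Lemma measurable_Im : measurable_fun setT (@complex.Im F).
Proof.
move=> _ B mB; rewrite setTI.
have := complex_measurable_preimage (measurableX measurableT mB).
by congr (measurable _); apply/seteqP; split => z /=; [case|].
Qed.

Lemma square_coord a h :
  [set p : F * F | square a h (p.1 +i* p.2)%C] =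
  `[complex.Re a - h, complex.Re a + h] `*` `[complex.Im a - h, complex.Im a + h].
Proof.
apply/seteqP; split => -[x y] /=; rewrite /square /= !in_itv/= !ler_distl.
  by move=> [].
by move=> [].
Qed.

Lemma measurable_square a h : measurable (square a h).
Proof.
have := complex_measurable_preimage
  (measurableX (measurable_itv `[complex.Re a - h, complex.Re a + h])
    (measurable_itv `[complex.Im a - h, complex.Im a + h])).
by rewrite -square_coord.
Qed.

Lemma square00 a : square a 0 = [set a].
Proof.
apply/seteqP; split => [z [/=]|z ->]; last by rewrite /square /= !subrr normr0.
rewrite !normr_le0 !subr_eq0 => /eqP h1 /eqP h2.
by apply/eqP; rewrite eq_complex h1 h2 !eqxx.
Qed.

Lemma measurable_set0C : measurable ([set 0] : set F[i]).
Proof. by rewrite -square00; exact: measurable_square. Qed.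

Lemma gaussian_densityE (p : F * F) :
  gaussian_density (p.1 +i* p.2)%C = pi^-1 * expR (- (p.1 ^+ 2 + p.2 ^+ 2)).
Proof. by rewrite /gaussian_density /normc sqr_sqrtr// addr_ge0// sqr_ge0. Qed.

(** The density is at most 1/pi and the square has area (2h)^2. *)
Lemma gaussian_square d (T : measurableType d) (P : probability T F)
  (g : {RV P >-> F[i]}) a h : 0 <= h -> standard_complex_gaussian g ->
  (P (g @^-1` (square a h)) <= (4 * h ^+ 2 / pi)%:E)%E.
Proof.
move=> h0 hg; rewrite hg; last exact: measurable_square.
rewrite square_coord.
set D := _ `*` _; pose mu := ((@lebesgue_measure F) \x (@lebesgue_measure F))%E.
have mD : measurable D by apply: measurableX; exact: measurable_itv.
have -> : (\int[mu]_(p in D) (gaussian_density (p.1 +i* p.2)%C)%:E =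
    \int[mu]_(p in D) (pi^-1 * expR (- (p.1 ^+ 2 + p.2 ^+ 2)))%:E)%E.
  by apply: eq_integral => p _; rewrite gaussian_densityE.
apply: (@le_trans _ _ (\int[mu]_(p in D) (pi^-1)%:E)%E).
  apply: ge0_le_integral => //.
  - by move=> p _; rewrite lee_fin mulr_ge0// ?invr_ge0 ?pi_ge0 ?expR_ge0.
  - apply/measurable_EFinP; apply: measurable_funTS.
    apply: measurable_funM => //.
    apply: measurableT_comp => //.
    apply: measurableT_comp => //.
    by apply: measurable_funD; apply: measurable_funX.
  - move=> p _; rewrite lee_fin ger_pMr ?invr_gt0 ?pi_gt0//.
    by rewrite -expR0 ler_expR oppr_le0 addr_ge0// sqr_ge0.
pose J (c : F) : set F := [set` `[c - h, c + h]].
have muD : mu D = (lebesgue_measure (J (complex.Re a)) *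
                   lebesgue_measure (J (complex.Im a)))%E.
  by rewrite /mu /D product_measure1E//; exact: measurable_itv.
rewrite integral_cst// [X in (_ * X)%E]muD /J.
rewrite !lebesgue_measure_itv/= !lte_fin.
have e (x : F) : ((x + h)%:E - (x - h)%:E)%E = (2 * h)%:E by rewrite -EFinB; congr (_%:E); ring.
have [->|hn0] := eqVneq h 0.
  by rewrite !addr0 !subr0 !ltxx mule0 mule0 expr0n/= mulr0 mul0r.
have hp : 0 < h by rewrite lt_def hn0.
rewrite !ifT; [|lra..].
by rewrite !e -!EFinM lee_fin le_eqVlt; apply/orP; left; apply/eqP; ring.
Qed.

End square.

Section law.
Context d d' (T : measurableType d) (T' : measurableType d') (F : realType)
  (P : probability T F) (P' : probability T' F) (n : nat) (rho : F)
  (X : 'I_n * 'I_n -> {RV P >-> F[i]})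
  (delta : {RV P' >-> bool}) (g : {RV P' >-> F[i]}).
Hypothesis rho01 : 0 <= rho <= 1.
Hypothesis iid : iid_copies_sparse_gaussian rho X delta g.

Lemma prob_delta b : P' (delta @^-1` [set b]) = (if b then rho else 1 - rho)%:E.
Proof.
have [hd _ _ _ _] := iid.
have := hd [set b]; rewrite /distribution /pushforward => ->.
rewrite bernoulli_probE// !diracE/=.
by case: b; rewrite !in_set1 /= ?mule1 ?mule0 ?adde0 ?add0e.
Qed.

Lemma entry_prob ij (A : set F[i]) : measurable A -> ~ A 0 ->
  P (X ij @^-1` A) = (rho%:E * P' (g @^-1` A))%E.
Proof.
have [_ _ hi _ hX] := iid => mA A0; rewrite hX//.
have -> : (fun w => (delta w)%:R * g w : F[i]) @^-1` A =
    delta @^-1` [set true] `&` g @^-1` A.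
  apply/seteqP; split => w /=; case: (delta w) => /=; rewrite ?mul1r ?mul0r//;
    by move=> [].
transitivity (P' (delta @^-1` [set true]) * P' (g @^-1` A))%E; first exact: hi.
by rewrite (prob_delta true).
Qed.

Lemma gaussian_eq0 : P' (g @^-1` [set 0]) = 0.
Proof.
have [_ hg _ _ _] := iid.
have := gaussian_square 0 (lexx 0) hg.
rewrite square00 expr0n/= mulr0 mul0r => h0.
by apply/eqP; rewrite eq_le h0 measure_ge0.
Qed.

(** Since [g] has no atom at 0, an entry vanishes with the probability that its Bernoulli factor
    does. From here on [X ij w != 0] replaces the Bernoulli variable, which lives on another
    probability space. *)
Lemma entry_eq0 ij : P (X ij @^-1` [set 0]) = (1 - rho)%:E.
Proof.
have m0 := measurable_set0C F.
have mg0 : measurable (g @^-1` [set 0]).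
  by rewrite -[_ @^-1` _]setTI; exact: measurable_funPT.
have mX0 : measurable (X ij @^-1` [set 0]).
  by rewrite -[_ @^-1` _]setTI; exact: measurable_funPT.
rewrite -[[set 0] in LHS]setCK -preimage_setC probability_setC//; last first.
  by rewrite -preimage_setC; exact: measurableC.
rewrite entry_prob//; [|exact: measurableC|by apply].
rewrite -preimage_setC probability_setC// gaussian_eq0 sube0 mule1.
by rewrite -EFinB.
Qed.

Lemma entry_square ij a h : 0 <= h ->
  (P (X ij @^-1` (~` [set 0%R] `&` square a h)) <= (rho * (4 * h ^+ 2 / pi))%:E)%E.
Proof.
move=> h0; have [_ hg _ _ _] := iid.
have m0 := measurableC (measurable_set0C F).
have ms := measurable_square a h.
have mg A : measurable A -> measurable (g @^-1` A).
  by move=> mA; rewrite -[_ @^-1` _]setTI; exact: measurable_funPT.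
rewrite entry_prob; [|exact: measurableI|by move=> [/(_ erefl)]].
rewrite EFinM lee_pmul//; first by rewrite lee_fin; case/andP: rho01.
apply: le_trans (gaussian_square a h0 hg).
apply: le_measure; rewrite ?inE; [by apply: mg; exact: measurableI|by apply: mg|].
by move=> w [].
Qed.
End law.

(** * Complex modulus and rounding to a grid *)

Section normc_facts.
Variable F : realType.
Implicit Types (z : F[i]).

Lemma normc_ge0 z : 0 <= normc z.
Proof. by rewrite /normc; case: z => a b; exact: sqrtr_ge0. Qed.

Lemma normc_eq0 z : (normc z == 0) = (z == 0).
Proof.
by apply/eqP/eqP => [/eq0_normc//|->]; rewrite normc0.
Qed.

Lemma normcB z z' : normc (z - z') = normc (z' - z).
Proof. by rewrite -opprB normcN. Qed.

Lemma le_normc_sum (I : Type) (r : seq I) (p : pred I) (f : I -> F[i]) :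
  normc (\sum_(i <- r | p i) f i) <= \sum_(i <- r | p i) normc (f i).
Proof.
elim/big_ind2: _ => //; first by rewrite normc0.
by move=> x x' y y' h h'; apply: le_trans (le_normcD _ _) _; exact: lerD.
Qed.

Lemma le_normcB z z' : normc (z - z') <= normc z + normc z'.
Proof. by rewrite -(normcN z'); exact: le_normcD. Qed.

Lemma ler_distnormc z z' : normc z <= normc z' + normc (z - z').
Proof. by rewrite -{1}(subrK z' z) addrC; exact: le_normcD. Qed.

Lemma normc_square z z' h : normc (z - z') <= h -> square z' h z.
Proof.
case: z z' => [a b] [a' b'] /=; rewrite /normc /square /= => H; split;
  apply: le_trans H; rewrite -sqrtr_sqr ler_wsqrtr// ?lerDl ?lerDr ?sqr_ge0//.
Qed.

Lemma square_normc z z' h : square z' h z -> normc (z - z') <= 2 * h.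
Proof.
case: z z' => [a b] [a' b'] /=; rewrite /normc /square /= => -[h1 h2].
have h0 : 0 <= h := le_trans (normr_ge0 _) h1.
rewrite -(ger0_norm (mulr_ge0 (ler0n _ 2) h0)) -sqrtr_sqr ler_wsqrtr//.
have e1 : (a - a') ^+ 2 <= h ^+ 2 by rewrite -real_normK ?num_real// lerXn2r ?nnegrE.
have e2 : (b - b') ^+ 2 <= h ^+ 2 by rewrite -real_normK ?num_real// lerXn2r ?nnegrE.
nra.
Qed.

Definition grid (eta : F) (q : int * int) : F[i] :=
  ((eta * q.1%:~R) +i* (eta * q.2%:~R))%C.

Lemma grid_near eta z : 0 < eta -> exists q, square (grid eta q) eta z.
Proof.
move=> e0.
have H (x : F) : `|x - eta * (Num.floor (x / eta))%:~R| <= eta.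
  have /andP[h1 h2] := floor_itv (x / eta).
  have h1' : eta * (Num.floor (x / eta))%:~R <= x by rewrite mulrC -ler_pdivlMr.
  rewrite ger0_norm ?subr_ge0// lerBlDl.
  move: h2; rewrite ltr_pdivrMr// intrD mulrDl mul1r mulrC; exact: ltW.
by exists (Num.floor (complex.Re z / eta), Num.floor (complex.Im z / eta)); split; exact: H.
Qed.

End normc_facts.

Section cmeas.
Context d (T : measurableType d) (F : realType) (P : probability T F)
  (I : finType) (X : I -> {RV P >-> F[i]}).
Implicit Types (J : {set I}) (f g : T -> F[i]).

(** Phrased through real and imaginary parts, so that sums and products reduce to real measurable
    functions for the sigma-algebra generated by the block [J]. *)
Definition cmeas J f : Prop :=
  measurable_fun (T := g_sigma_algebraType (block_gen X J)) setT (fun w => complex.Re (f w)) /\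
  measurable_fun (T := g_sigma_algebraType (block_gen X J)) setT (fun w => complex.Im (f w)).

Lemma cmeas_cst J z : cmeas J (fun=> z).
Proof. by split; exact: measurable_cst. Qed.

Lemma cmeas_var J i : i \in J -> cmeas J (X i).
Proof.
move=> iJ; split => _ B mB; rewrite setTI.
  have := event_gen (X := X) iJ (measurable_Re measurableT mB); rewrite setTI; exact.
have := event_gen (X := X) iJ (measurable_Im measurableT mB); rewrite setTI; exact.
Qed.

Lemma cmeasD J f g : cmeas J f -> cmeas J g -> cmeas J (fun w => f w + g w).
Proof.
move=> [f1 f2] [g1 g2]; split.
  apply: eq_measurable_fun (measurable_funD f1 g1) => w _ /=.
  by case: (f w) (g w) => ? ? [].
apply: eq_measurable_fun (measurable_funD f2 g2) => w _ /=.
by case: (f w) (g w) => ? ? [].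
Qed.

Lemma cmeasM J f g : cmeas J f -> cmeas J g -> cmeas J (fun w => f w * g w).
Proof.
move=> [f1 f2] [g1 g2]; split.
  apply: eq_measurable_fun (measurable_funB (measurable_funM f1 g1) (measurable_funM f2 g2)) => w _ /=.
  by case: (f w) (g w) => ? ? [].
apply: eq_measurable_fun (measurable_funD (measurable_funM f1 g2) (measurable_funM f2 g1)) => w _ /=.
by case: (f w) (g w) => ? ? [].
Qed.

Lemma cmeas_sum (K : Type) (r : seq K) (p : pred K) J (f : K -> T -> F[i]) :
  (forall k, p k -> cmeas J (f k)) ->
  cmeas J (fun w => \sum_(k <- r | p k) f k w).
Proof.
move=> h; elim: r => [|k r IH].
  have -> : (fun w => \sum_(k <- [::] | p k) f k w) = (fun=> 0) :> (T -> F[i]).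
    by apply: funext => w; rewrite big_nil.
  exact: cmeas_cst.
have -> : (fun w => \sum_(j <- k :: r | p j) f j w) =
    (fun w => if p k then f k w + \sum_(j <- r | p j) f j w else \sum_(j <- r | p j) f j w).
  by apply: funext => w; rewrite big_cons.
by case: (boolP (p k)) => // pk; apply: cmeasD => //; exact: h.
Qed.

Lemma event_square J f a h : cmeas J f -> event X J [set w | square a h (f w)].
Proof.
move=> [f1 f2].
have mi (x : F) := measurable_itv `[x - h, x + h].
have := eventI (f1 measurableT _ (mi (complex.Re a))) (f2 measurableT _ (mi (complex.Im a))).
congr (event X J _); rewrite !setTI; apply/seteqP; split => w /=; rewrite !in_itv /= -!ler_distl.
  by move=> [].
by move=> [].
Qed.

End cmeas.

(** * Small-ball estimate for sums of sparse Gaussian entries *)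

Section small_ball.
Context d (T : measurableType d) (F : realType) (P : probability T F)
  (I : finType) (X : I -> {RV P >-> F[i]}) (rho : F).
Hypothesis indep : mutually_independent X.
Hypothesis rho01 : 0 <= rho <= 1.
Hypothesis X0 : forall i, P (X i @^-1` [set 0%R]) = (1 - rho)%:E.
Hypothesis Xsq : forall i a h, 0 <= h ->
  (P (X i @^-1` (~` [set 0%R] `&` square a h)) <= (rho * (4 * h ^+ 2 / pi))%:E)%E.

Let rho0 : 0 <= rho. Proof. by case/andP: rho01. Qed.
Let rho1 : rho <= 1. Proof. by case/andP: rho01. Qed.

Lemma ob_entry0 i : ob X [set i] [set w | X i w = 0] (1 - rho).
Proof.
exists (X i @^-1` [set 0]); split => //; last by rewrite X0.
by apply: (event_gen (X := X)); [rewrite inE|exact: measurable_set0C].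
Qed.

Lemma disjoint1 (i j : I) : i != j -> [disjoint [set i]%SET & [set j]%SET]%B.
Proof. by move=> ij; rewrite disjoints1 inE. Qed.

Lemma ob_entries0 (J : {set I}) :
  ob X J [set w | forall i, i \in J -> X i w = 0] ((1 - rho) ^+ #|J|).
Proof.
have := ob_forall indep (A := J) disjoint1 (fun i _ => ob_entry0 i).
rewrite prodr_const; apply: ob_sub => //.
apply/fintype.subsetP => i /finset.bigcupP[j jJ]; by rewrite inE => /eqP ->.
Qed.

Lemma ob_entry_small i z c tau h : 0 < tau -> tau <= normc z -> 0 <= h ->
  ob X [set i] [set w | X i w <> 0 /\ normc (c + X i w * z) <= h]
    (rho * (4 * (h / tau) ^+ 2 / pi)).
Proof.
move=> t0 tz h0.
have z0 : z != 0 by rewrite -normc_eq0; apply: lt0r_neq0; exact: lt_le_trans tz.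
have ht : 0 <= h / tau by rewrite divr_ge0// ltW.
exists (X i @^-1` (~` [set 0] `&` square (- (c / z)) (h / tau))); split.
- apply: (event_gen (X := X)); first by rewrite inE.
  apply: measurableI; last exact: measurable_square.
  by apply: measurableC; exact: measurable_set0C.
- move=> w [/= Xn0 H]; split => //.
  apply: normc_square; rewrite opprK.
  have -> : X i w + c / z = (c + X i w * z) / z by rewrite mulrDl mulfK// addrC.
  rewrite normcM normcV; apply: ler_pM => //; rewrite ?invr_ge0 ?normc_ge0//.
  by rewrite lef_pV2// posrE; exact: lt_le_trans tz.
- exact: Xsq.
Qed.

(** Peel off one variable [X i]. If it is nonzero, freeze the rest of the sum and use [X i] alone,
    at cost rho p; if it is zero, recurse. The prefactor follows from rho + (1 - rho) (1 - (1 -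
    rho)^k) = 1 - (1 - rho)^(k+1). *)
Lemma ob_sum_small (J : {set I}) (z : I -> F[i]) c tau h eta :
  0 < tau -> (forall i, i \in J -> tau <= normc (z i)) -> 0 <= h -> 0 < eta ->
  ob X J [set w | (exists2 i, i \in J & X i w <> 0) /\
                  normc (c + \sum_(i in J) X i w * z i) <= h]
    ((1 - (1 - rho) ^+ #|J|) * (4 * ((h + eta) / tau) ^+ 2 / pi)).
Proof.
move=> t0 + h0 e0; have [k] := ubnP #|J|; elim: k J => // k IH J.
have [->|[i iJ]] := set_0Vmem J.
  move=> _ _; rewrite cards0 expr0 subrr mul0r.
  by apply: ob_sub (ob_set0 X finset.set0) => // w [[i iJ _] _]; move: iJ; rewrite inE.
rewrite (cardsD1 i) iJ /= add1n ltnS => Jk tz.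
set J' := (J :\ i)%SET in Jk *.
have sJ' : J' \subset J by exact: subsetDl.
have {IH} := IH _ Jk (fun j jJ' => tz _ (fintype.subsetP sJ' _ jJ')).
set p := 4 * _ / _ => IH.
have dij : [disjoint [set i]%SET & J']%B by rewrite disjoints1 !inE eqxx.
have sumE w : \sum_(j in J) X j w * z j = X i w * z i + \sum_(j in J') X j w * z j.
  by rewrite (big_setD1 i).
pose S w := \sum_(j in J') X j w * z j.
have mS : cmeas X J' S.
  apply: cmeas_sum => j jJ'; apply: cmeasM; last exact: cmeas_cst.
  exact: cmeas_var.
have e20 : 0 < eta / 2 by rewrite divr_gt0.
have p0 : 0 <= p by rewrite divr_ge0 ?pi_ge0// mulr_ge0// sqr_ge0.
(* A square of half-side [eta / 2] lies within [eta] of its centre. The branch [X i w = 0] rounds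
   nothing at this level, so the total loss stays [eta] throughout the induction. *)
have h1 := ob_select (J := J') (J' := [set i]) (b := rho * p) indep
  (Phi := fun q => [set w | square (grid (eta / 2) q) (eta / 2) (S w)])
  (B := fun q => [set w | X i w <> 0 /\ normc ((c + grid (eta / 2) q) + X i w * z i) <= h + eta]).
have {}h1 := h1 (mulr_ge0 rho0 p0).
rewrite disjoint_sym in h1.
have {}h1 := h1 dij (fun q => event_square _ _ mS).
have {}h1 := h1 (fun q => ob_entry_small _ _ t0 (tz _ iJ) (addr_ge0 h0 (ltW e0))).
have h2 := obI indep dij (ob_entry0 i) IH.
rewrite finset.setUC in h1.
apply: ob_sub (obU h1 h2).
- by rewrite finset.setD1K.
- move=> w [[j jJ Xj] H].
  have [Xi0|/eqP Xi0] := eqVneq (X i w) 0.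
    right; split => //=; split; last by move: H; rewrite sumE Xi0 mul0r add0r.
    by exists j => //; rewrite !inE jJ andbT; apply: contra_notN Xj => /eqP ->.
  left; split; first exact: grid_near.
  move=> q /= /square_normc Hq; split => //.
  have -> : c + grid (eta / 2) q + X i w * z i =
     (c + \sum_(i0 in J) X i0 w * z i0) - (S w - grid (eta / 2) q).
    rewrite sumE -/(S w); ring.
  apply: le_trans (le_normcB _ _) _; apply: lerD => //.
  by apply: le_trans Hq _; rewrite mulrC divfK.
- rewrite exprS le_eqVlt; apply/orP; left; apply/eqP.
  by rewrite -/J'; ring.
Qed.

End small_ball.

(** * Maximal determinants and small singular values *)

Section linear_algebra.
Local Open Scope complex_scope.
Local Open Scope sesquilinear_scope.

Section maxvol.
Variable F : realType.

Lemma det_replace_row r (M : 'M[F[i]]_r) (k : 'I_r) :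
  (forall j, j != k -> row j M = row j 1%:M) -> \det M = M k k.
Proof.
move=> h.
have hM j l : j != k -> M j l = (j == l)%:R.
  by move=> /h/matrixP/(_ ord0 l); rewrite !mxE.
rewrite (expand_det_col _ k) (bigD1 k)//= big1 ?addr0 => [|j jk]; last first.
  by rewrite hM// (negPf jk) mul0r.
rewrite /cofactor (_ : row' k (col' k M) = 1%:M) ?det1 ?mulr1.
  by rewrite -signr_odd oddD addbb expr0 mulr1.
apply/matrixP => a b; rewrite !mxE hM ?neq_lift 1?eq_sym ?neq_lift//.
by rewrite (inj_eq lift_inj) // eq_sym.
Qed.

(* A choice of rows maximizing the modulus of the determinant: by Cramer's rule the
   other rows are combinations of these with coefficients of modulus at most 1. *)
Lemma bounded_row_coefs n D (W : 'M[F[i]]_(n, D)) :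
  exists (f : 'I_(\rank W) -> 'I_n) (C : 'M[F[i]]_(n, \rank W)),
    [/\ injective f, W = C *m rowsub f W, rowsub f C = 1%:M &
        forall i k, normc (C i k) <= 1].
Proof.
set r := \rank W; pose L := col_base W.
have WL : W = L *m row_base W by rewrite mulmx_base.
have fullL : row_full L := col_base_full W.
pose vol (f : {ffun 'I_r -> 'I_n}) := normc (\det (rowsub f L)).
pose f0 : {ffun 'I_r -> 'I_n} := fullrankfun fullL.
case: (@arg_maxP _ _ _ f0 xpredT vol isT) => f _ fmax.
have Lf : rowsub f L \in unitmx.
  rewrite unitmxE unitfE -normc_eq0; apply: lt0r_neq0.
  apply: lt_le_trans (fmax f0 isT); rewrite lt_def normc_ge0 andbT /vol normc_eq0.
  by have := fullrowsub_unit fullL; rewrite unitmxE unitfE.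
pose C := L *m invmx (rowsub f L).
have fC : rowsub f C = 1%:M by rewrite -mul_rowsub_mx mulmxV.
exists f, C; split => //.
- move=> k k' fk.
  have := congr1 (fun M : 'M[F[i]]_r => M k k) fC.
  have := congr1 (fun M : 'M[F[i]]_r => M k' k) fC.
  rewrite !mxE -fk => ->; rewrite eqxx; case: (eqVneq k' k) => [->//|_] /eqP.
  by rewrite eq_sym oner_eq0.
- have -> : rowsub f W = rowsub f L *m row_base W by rewrite mul_rowsub_mx -WL.
  by rewrite mulmxA mulmxKV.
- move=> i k; pose g := [ffun j => if j == k then i else f j].
  have : vol g <= vol f := fmax g isT; rewrite /vol.
  have -> : rowsub g L = rowsub g C *m rowsub f L.
    by rewrite mul_rowsub_mx mulmxKV.
  rewrite det_mulmx normcM ger_pMl; last first.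
    by rewrite lt_def normc_ge0 andbT normc_eq0 -unitfE -unitmxE.
  rewrite (@det_replace_row _ _ k); first by rewrite mxE ffunE eqxx.
  move=> j jk; rewrite row_rowsub ffunE (negPf jk) -fC row_rowsub //.
Qed.

End maxvol.

Section norm2.
Variables (F : realType).
Local Notation C := F[i].

(** The square of the Euclidean norm. *)
Definition norm2 n (u : 'rV[C]_n) : F := \sum_j normc (u 0 j) ^+ 2.

Lemma norm2_ge0 n (u : 'rV[C]_n) : 0 <= norm2 u.
Proof. by apply: sumr_ge0 => j _; exact: sqr_ge0. Qed.

Lemma norm2_eq0 n (u : 'rV[C]_n) : norm2 u = 0 -> u = 0.
Proof.
move=> h; apply/rowP => j; rewrite mxE; apply/eqP; rewrite -normc_eq0 -sqrf_eq0.
apply/eqP; move: h j isT; apply: psumr_eq0P => j _; exact: sqr_ge0.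
Qed.

Lemma normc_conj (z : C) : normc (z^*)%R = normc z.
Proof. by case: z => a b; rewrite /normc /= sqrrN. Qed.

Lemma normcsq (z : C) : z * (z^*)%R = ((normc z) ^+ 2)%:C.
Proof. by rewrite -normCK rmorphXn; case: z. Qed.

Lemma norm2E n (u : 'rV[C]_n) : (u *m u^t*) 0 0 = (norm2 u)%:C.
Proof.
rewrite mxE rmorph_sum; apply: eq_bigr => j _.
by rewrite !mxE normcsq.
Qed.

(** Cauchy-Schwarz in weighted arithmetic-geometric form; the free weight [s] avoids square roots
    and is tuned at each use. *)
Lemma norm2_inner n (u v : 'rV[C]_n) (s : F) : 0 < s ->
  normc ((u *m v^t*) 0 0) <= (s^-1 * norm2 u + s * norm2 v) / 2.
Proof.
move=> s0; rewrite mxE; apply: le_trans (le_normc_sum _ _ _) _.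
rewrite /norm2 !mulr_sumr -big_split /= mulr_suml; apply: ler_sum => j _.
rewrite !mxE normcM normc_conj.
set x := normc _; set y := normc _.
rewrite ler_pdivlMr// -subr_ge0.
have -> : s^-1 * x ^+ 2 + s * y ^+ 2 - x * y * 2 = s^-1 * (x - s * y) ^+ 2.
  by field; exact: lt0r_neq0.
by rewrite mulr_ge0 ?sqr_ge0// invr_ge0 ltW.
Qed.

Lemma norm2D n (u v : 'rV[C]_n) (t : F) : 0 < t ->
  norm2 (u + v) <= (1 + t) * norm2 u + (1 + t^-1) * norm2 v.
Proof.
move=> t0; rewrite /norm2 !mulr_sumr -big_split /=; apply: ler_sum => j _.
rewrite mxE; set x := u 0 j; set y := v 0 j.
apply: (@le_trans _ _ ((normc x + normc y) ^+ 2)).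
  by rewrite lerXn2r ?nnegrE ?addr_ge0 ?normc_ge0//; exact: le_normcD.
rewrite -subr_ge0.
have -> : (1 + t) * normc x ^+ 2 + (1 + t^-1) * normc y ^+ 2 - (normc x + normc y) ^+ 2
   = t^-1 * (t * normc x - normc y) ^+ 2.
  by field; exact: lt0r_neq0.
by rewrite mulr_ge0 ?sqr_ge0// invr_ge0 ltW.
Qed.

Lemma norm2_le_max n (u : 'rV[C]_n) (b : F) :
  (forall j, normc (u 0 j) <= b) -> norm2 u <= n%:R * b ^+ 2.
Proof.
move=> h; rewrite /norm2.
apply: (@le_trans _ _ (\sum_(j < n) b ^+ 2)).
  apply: ler_sum => j _; rewrite lerXn2r ?nnegrE ?normc_ge0//.
  exact: le_trans (normc_ge0 _) (h j).
by rewrite sumr_const card_ord mulr_natl.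
Qed.

Lemma normc_le_norm2 n (u : 'rV[C]_n) j : normc (u 0 j) <= Num.sqrt (norm2 u).
Proof.
rewrite -[normc _]ger0_norm ?normc_ge0// -sqrtr_sqr ler_wsqrtr//.
by rewrite /norm2 (bigD1 j)//= lerDl sumr_ge0// => k _; exact: sqr_ge0.
Qed.

Lemma norm2_mulmx_le n (u : 'rV[C]_n) (E : 'M[C]_n) (dl : F) :
  (forall i j, normc (E i j) <= dl) ->
  norm2 (u *m E^t*) <= n%:R ^+ 3 * dl ^+ 2 * norm2 u.
Proof.
move=> hE; set b := Num.sqrt (norm2 u).
have -> : n%:R ^+ 3 * dl ^+ 2 * norm2 u = n%:R * (n%:R * (b * dl)) ^+ 2.
  rewrite !exprMn sqr_sqrtr ?norm2_ge0//; ring.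
apply: norm2_le_max => j; rewrite mxE; apply: le_trans (le_normc_sum _ _ _) _.
apply: (@le_trans _ _ (\sum_(k < n) b * dl)).
  apply: ler_sum => k _; rewrite !mxE normcM normc_conj.
  by apply: ler_pM; rewrite ?normc_ge0 ?normc_le_norm2.
by rewrite sumr_const card_ord mulr_natl.
Qed.

End norm2.

(** * Singular values through the spectral decomposition of A^* A *)

Section gram.
Variables (F : realType) (n : nat).
Local Notation C := F[i].
Implicit Types (A : 'M[C]_n).

Definition gram_eigen A (j : 'I_n) : F := complex.Re (spectral_diag (A ^t* *m A) ord0 j).

Definition gram_basis A : 'M[C]_n := spectralmx (A ^t* *m A).

Lemma gram_basisK A : gram_basis A *m (gram_basis A)^t* = 1%:M.
Proof. by apply/unitarymxP; exact: spectral_unitarymx. Qed.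

Lemma gram_basisVK A : (gram_basis A)^t* *m gram_basis A = 1%:M.
Proof. exact: mulmx1C (gram_basisK A). Qed.

Lemma norm2_gram_basis A (c : 'rV[C]_n) : norm2 (c *m gram_basis A) = norm2 c.
Proof.
apply: (@complexI F); rewrite -!norm2E trmx_mul map_mxM mulmxA.
by rewrite -(mulmxA c) gram_basisK mulmx1.
Qed.

Lemma gram_spectral A (c : 'rV[C]_n) :
  norm2 (c *m gram_basis A *m A ^t*) = \sum_j gram_eigen A j * normc (c 0 j) ^+ 2.
Proof.
have G : A ^t* *m A \is normalmx.
  apply: hermitian_normalmx; apply/is_hermitianmxP.
  by rewrite expr0 scale1r trmx_mul map_mxM trmxCK.
have /orthomx_spectralP eG := G.
set D := spectral_diag _ in eG; set Q := gram_basis A.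
have H (v : 'rV[C]_n) : (norm2 (v *m Q *m A ^t*))%:C = \sum_j D 0 j * ((normc (v 0 j)) ^+ 2)%:C.
  rewrite -norm2E !trmx_mul !map_mxM trmxCK !mulmxA -(mulmxA (v *m Q)) eG.
  rewrite -/(gram_basis A) -/Q.
  rewrite invmx_unitary ?spectral_unitarymx// -/Q -/(gram_basis A) -/Q.
  rewrite !mulmxA -(mulmxA v) gram_basisK mulmx1.
  rewrite -!mulmxA (mulmxA Q) gram_basisK mul1mx.
  rewrite mulmxA mul_mx_diag mxE; apply: eq_bigr => j _.
  by rewrite !mxE mulrAC mulrC -normcsq.
(* Evaluated at a basis vector, the quadratic form is a squared norm equal to one eigenvalue, which
   is therefore real. *)
have D_real j : D 0 j = (gram_eigen A j)%:C.
  have := H (delta_mx 0 j); rewrite (bigD1 j)//= big1 ?addr0 => [|k kj]; last first.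
    by rewrite mxE eqxx (negPf kj) normc0 expr0n/= mulr0.
  rewrite mxE !eqxx normc1 expr1n mulr1 /gram_eigen -/D => <-.
  by [].
apply: (@complexI F); rewrite H rmorph_sum; apply: eq_bigr => j _.
by rewrite D_real; exact: esym (rmorphM (real_complex F) _ _).
Qed.

Lemma gram_eigen_ge0 A j : 0 <= gram_eigen A j.
Proof.
have := norm2_ge0 (delta_mx 0 j *m gram_basis A *m A ^t*).
rewrite gram_spectral (bigD1 j)//= big1 ?addr0 => [|k kj]; last first.
  by rewrite mxE eqxx (negPf kj) normc0 expr0n/= mulr0.
by rewrite mxE !eqxx normc1 expr1n mulr1.
Qed.

Lemma count_gt_sorted (s : seq F) (k : nat) (e : F) : (k < size s)%N ->
  sorted (fun x y : F => y <= x) s ->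
  (nth 0 s k <= e) = (count (fun x => (e < x)%R) s <= k)%N.
Proof.
move=> ks ss.
have tr : transitive (fun x y : F => y <= x) by move=> x y z h1 h2; exact: le_trans h1.
have H i j : (i <= j < size s)%N -> nth 0 s j <= nth 0 s i.
  case/andP=> ij js; apply: (sorted_leq_nth tr _ 0 ss) => //.
    by rewrite inE; exact: leq_ltn_trans js.
rewrite -{2}(cat_take_drop k s) count_cat.
case: leP => he; symmetry.
  rewrite -[leqRHS]addn0; apply: leq_add.
    by apply: leq_trans (count_size _ _) _; rewrite size_takel// ltnW.
  rewrite leqn0 -leqn0 -ltnS ltnNge -has_count; apply/hasPn => x /(nthP 0) [j].
  rewrite size_drop nth_drop ltn_subRL => ik <-; rewrite -leNgt.
  by apply: le_trans he; apply: H; rewrite leq_addr.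
apply/negbTE; rewrite -ltnNge.
have -> : count (fun x => e < x) (take k s) = k.
  rewrite -[RHS](size_takel (ltnW ks)); apply/eqP; rewrite -all_count.
  apply/allP => x /(nthP 0) [j]; rewrite size_takel ?(ltnW ks)// => ik.
  rewrite nth_take// => <-; apply: lt_le_trans he _; apply: H.
  by rewrite (ltnW ik).
rewrite -addn1 leq_add2l -has_count; apply/(has_nthP 0); exists 0%N.
  by rewrite size_drop subn_gt0.
by rewrite nth_drop addn0.
Qed.

(** Replaces a position in a sorted list by a count of eigenvalues, the form in which singular
    values are handled afterwards. *)
Lemma sigma_le_card A k e : (k < n)%N ->
  (sigma k.+1 A <= e) = (#|[set j | (e < Num.sqrt (gram_eigen A j))%R]%SET| <= k)%N.
Proof.
move=> kn; rewrite /sigma /= count_gt_sorted; last 2 first.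
- by rewrite size_sort size_map -cardE card_ord.
- by apply: sort_sorted => x y; exact: le_total.
rewrite count_sort count_map cardE size_filter.
congr (_ <= _)%N; rewrite enumT; apply: eq_count => j /=; by rewrite inE.
Qed.
End gram.

Section sigma_rows.
Variables (F : realType) (n : nat).
Local Notation C := F[i].
Implicit Types (A B : 'M[C]_n).

Definition big_set A (e : F) : {set 'I_n} :=
  [set j | e < Num.sqrt (gram_eigen A j)]%SET.

Lemma notin_big A e j : 0 <= e -> j \notin big_set A e -> gram_eigen A j <= e ^+ 2.
Proof.
move=> e0; rewrite inE -leNgt => h.
by rewrite -(sqr_sqrtr (gram_eigen_ge0 A j)) lerXn2r ?nnegrE ?sqrtr_ge0.
Qed.

Lemma in_big A e j : 0 <= e -> j \in big_set A e -> e ^+ 2 < gram_eigen A j.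
Proof.
move=> e0; rewrite inE => h.
by rewrite -(sqr_sqrtr (gram_eigen_ge0 A j)) ltrXn2r ?nnegrE ?sqrtr_ge0.
Qed.

Lemma norm2_small_coords A e (c : 'rV[C]_n) : 0 <= e ->
  (forall j, j \in big_set A e -> c 0 j = 0) ->
  norm2 (c *m gram_basis A *m A ^t*) <= e ^+ 2 * norm2 (c *m gram_basis A).
Proof.
move=> e0 h; rewrite gram_spectral norm2_gram_basis /norm2 mulr_sumr.
apply: ler_sum => j _; have [jb|jb] := boolP (j \in big_set A e).
  by rewrite h// normc0 expr0n/= !mulr0.
by rewrite ler_wpM2r ?sqr_ge0//; exact: notin_big.
Qed.

(** The eigenbasis is that of A^* A, whereas left vectors are wanted. Require u A to be orthogonal
    to the eigenvectors with eigenvalue above e^2, at most n - m - 1 linear conditions. Then |u A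
    A^*| <= e |u A|, and |u A|^2 = (u A A^*, u) yields |u A| <= e |u|. *)
Lemma sigma_le_leftspace A (m : nat) e : (m < n)%N -> 0 < e ->
  sigma (n - m) A <= e ->
  exists W : 'M[C]_n, (m.+1 <= \rank W)%N /\
    forall u : 'rV_n, (u <= W)%MS -> norm2 (u *m A) <= e ^+ 2 * norm2 u.
Proof.
move=> mn e0 hs.
have hb : (#|big_set A e| <= (n - m).-1)%N.
  rewrite -sigma_le_card ?prednK ?subn_gt0//.
  by rewrite (leq_trans (leq_subr m n))// || rewrite ltn_predL subn_gt0.
pose V : 'M[C]_(#|big_set A e|, n) := rowsub enum_val (gram_basis A).
exists (kermx (A *m V ^t*)); split.
  rewrite mxrank_ker.
  have : (\rank (A *m V ^t*) <= (n - m).-1)%N.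
    by apply: leq_trans hb; exact: rank_leq_col.
  lia.
move=> u /sub_kermxP; rewrite mulmxA => uAV.
pose c := u *m A *m (gram_basis A)^t*.
have uA : u *m A = c *m gram_basis A by rewrite -mulmxA gram_basisVK mulmx1.
have c0 j : j \in big_set A e -> c 0 j = 0.
  move=> jb; have := congr1 (fun M : 'rV[C]__ => M 0 (enum_rank_in jb j)) uAV.
  rewrite [in RHS]mxE => <-; rewrite !mxE; apply: eq_bigr => k _.
  by rewrite !mxE enum_rankK_in.
have h1 := norm2_small_coords (ltW e0) c0; rewrite -uA in h1.
have h2 : norm2 (u *m A) = normc ((u *m A *m A ^t* *m u ^t*) 0 0).
  have := norm2E (u *m A); rewrite trmx_mul map_mxM mulmxA => ->.
  by rewrite /normc /= expr0n /= addr0 sqrtr_sqr ger0_norm// norm2_ge0.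
have e20 : 0 < e ^+ 2 by rewrite exprn_gt0.
(* The weight [e ^+ 2] turns the first term into at most half of [norm2 (u *m A)], which is absorbed
   on the left. *)
have := norm2_inner (u *m A *m A ^t*) u e20; rewrite -h2.
have h3 : (e ^+ 2)^-1 * norm2 (u *m A *m A ^t*) <= norm2 (u *m A).
  by rewrite mulrC ler_pdivrMr// mulrC.
lra.
Qed.

(* The rows [u k] are dual to the coordinates [f] : this is what lets one row of
   [A] be isolated. *)
Lemma small_sigma_rows A (m : nat) e : (m < n)%N -> 0 < e ->
  sigma (n - m) A <= e ->
  exists (f : 'I_m.+1 -> 'I_n) (u : 'I_m.+1 -> 'rV[C]_n),
   [/\ injective f,
    forall k j, normc (u k 0 j) <= 1,
    forall k j, u k 0 (f j) = (j == k)%:R &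
    forall k, norm2 (u k *m A) <= n%:R * e ^+ 2].
Proof.
move=> mn e0 /(sigma_le_leftspace mn e0)[W [rW hW]].
have [f [Co [injf eW fC C1]]] := bounded_row_coefs W^T.
move: f Co injf eW fC C1; rewrite mxrank_tr => f Co injf eW fC C1.
pose w : 'I_m.+1 -> 'I_(\rank W) := widen_ord rW.
have injw : injective w by move=> a b /(congr1 val) h; exact: val_inj.
exists (f \o w), (fun k => (col (w k) Co)^T); split.
- exact: inj_comp.
- by move=> k j; rewrite !mxE.
- move=> k j; rewrite !mxE.
  have := congr1 (fun M : 'M[C]__ => M (w j) (w k)) fC; rewrite !mxE => ->.
  by rewrite (inj_eq injw).
- move=> k; apply: le_trans (hW _ _) _.
    (* The coefficient columns span the row space of [W], because the chosen coordinates have full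
       rank on it; hence each of them inherits the smallness bound. *)
    have eW' : W = (rowsub f W^T)^T *m Co^T by rewrite -trmx_mul -eW trmxK.
    have full : row_full (rowsub f W^T)^T.
      rewrite /row_full eqn_leq rank_leq_col /= mxrank_tr.
      rewrite -{1}(mxrank_tr W) {1}eW; exact: mxrankM_maxr.
    by rewrite [X in (_ <= X)%MS]eW' (eqmxMfull _ full) tr_col row_sub.
  rewrite mulrC ler_wpM2r ?sqr_ge0//.
  have := @norm2_le_max _ _ (col (w k) Co)^T 1; rewrite expr1n mulr1; apply.
  by move=> j; rewrite !mxE.
Qed.

(** Courant-Fischer by counting dimensions: if [B] had at most [k] singular values above [e], the
    span of its other eigenvectors would meet that of the at least k + 1 large ones of [A] in some v
    != 0. There |v A^*| exceeds |v B^*| by a definite margin, impossible for [B] close to [A]. *)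
Lemma sigma_gt_open A k e : (k < n)%N -> 0 < e -> e < sigma k.+1 A ->
  exists2 dl, 0 < dl & forall B, (forall i j, normc (A i j - B i j) <= dl) ->
    e < sigma k.+1 B.
Proof.
move=> kn e0; rewrite ltNge sigma_le_card// -ltnNge => kA.
set S := big_set A e; change (is_true (k < #|S|)%N) in kA.
have [e' e'e he'] : exists2 e', e ^+ 2 < e' & forall j, j \in S -> e' <= gram_eigen A j.
  have [j0 j0S] : exists j0, j0 \in S by apply/card_gt0P; exact: leq_ltn_trans kA.
  case: (arg_minP (gram_eigen A) j0S) => j jS jmin.
  by exists (gram_eigen A j); [apply: in_big => //; exact: ltW|exact: jmin].
(* [t] puts (1 + t) e^2 halfway between e^2 and e'. [dl] then makes the perturbation term a quarter
   of the gap, so that the sum stays below e'. *)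
pose t := (e' - e ^+ 2) / (2 * e ^+ 2).
have e20 : 0 < e ^+ 2 by rewrite exprn_gt0.
have t0 : 0 < t by rewrite divr_gt0 ?subr_gt0// mulr_gt0.
have ht : (1 + t) * e ^+ 2 = (e' + e ^+ 2) / 2 by rewrite /t; field; exact: lt0r_neq0.
pose D := (1 + t^-1) * n%:R ^+ 3.
have D0 : 0 < D.
  rewrite mulr_gt0 ?exprn_gt0 ?ltr0n ?(leq_ltn_trans _ kn)//.
  by rewrite addr_gt0 ?invr_gt0.
pose dl := Num.sqrt ((e' - e ^+ 2) / (4 * D)).
have dl0 : 0 < dl by rewrite sqrtr_gt0 divr_gt0 ?subr_gt0// mulr_gt0.
exists dl => // B hB; rewrite ltNge; apply/negP; rewrite sigma_le_card// => kB.
set S' := big_set B e; change (is_true (#|S'| <= k)%N) in kB.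
pose V : 'M[C]_(#|S|, n) := rowsub enum_val (gram_basis A).
pose W : 'M[C]_(#|~: S'|, n) := rowsub enum_val (gram_basis B).
have free_rows (A0 : 'M[C]_n) (S0 : {set 'I_n}) :
    \rank (rowsub (enum_val : 'I_#|S0| -> 'I_n) (gram_basis A0)) = #|S0|.
  apply/eqP; rewrite -/(row_free _); apply/row_freeP.
  exists ((rowsub enum_val (gram_basis A0))^t*).
  apply/matrixP => a b; have := congr1 (fun M : 'M[C]_n => M (enum_val a) (enum_val b)) (gram_basisK A0).
  rewrite !mxE (inj_eq enum_val_inj) => <-.
  by apply: eq_bigr => l _; rewrite !mxE.
have cap : (V :&: W)%MS != 0.
  rewrite -mxrank_eq0 -lt0n.
  have := mxrank_sum_cap V W.
  have -> : \rank V = #|S| by exact: free_rows.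
  have -> : \rank W = #|~: S'| by exact: free_rows.
  have := rank_leq_col (V + W)%MS.
  have := cardsC S'; rewrite card_ord.
  move: kA kB; lia.
have [v vcap v0] : exists2 v : 'rV[C]_n, (v <= V :&: W)%MS & v != 0.
  by have /rowV0Pn[v] := cap; exists v.
move: vcap; rewrite sub_capmx => /andP[/submxP[a va] /submxP[b vb]].
pose ca : 'rV[C]_n := v *m (gram_basis A)^t*.
pose cb : 'rV[C]_n := v *m (gram_basis B)^t*.
have eca : ca *m gram_basis A = v by rewrite -mulmxA gram_basisVK mulmx1.
have ecb : cb *m gram_basis B = v by rewrite -mulmxA gram_basisVK mulmx1.
have orth (A0 : 'M[C]_n) (S0 : {set 'I_n}) (x : 'rV[C]_#|S0|) j : j \notin S0 ->
    (x *m rowsub enum_val (gram_basis A0) *m (gram_basis A0)^t*) 0 j = 0.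
  move=> jS; rewrite -mulmxA mul_rowsub_mx gram_basisK mxE big1// => l _.
  rewrite !mxE; case: eqP => [ej|_]; last by rewrite mulr0.
  by move: jS; rewrite -ej enum_valP.
have hA : e' * norm2 v <= norm2 (v *m A ^t*).
  rewrite -eca gram_spectral norm2_gram_basis /norm2 mulr_sumr; apply: ler_sum => j _.
  have [jS|jS] := boolP (j \in S); first by rewrite ler_wpM2r ?sqr_ge0// he'.
  by rewrite /ca va orth// normc0 expr0n/= !mulr0.
have hB' : norm2 (v *m B ^t*) <= e ^+ 2 * norm2 v.
  rewrite -ecb; apply: norm2_small_coords; first exact: ltW.
  by move=> j jb; rewrite /cb vb orth// inE negbK.
have hv : 0 < norm2 v.
  rewrite lt_def norm2_ge0 andbT; apply: contra_neq v0; exact: norm2_eq0.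
have hAB := @norm2_mulmx_le _ _ v (A - B) dl.
have {}hAB : norm2 (v *m (A - B)^t*) <= n%:R ^+ 3 * dl ^+ 2 * norm2 v.
  by apply: hAB => i j; rewrite !mxE.
have := norm2D (v *m B ^t*) (v *m (A - B)^t*) t0.
have -> : v *m B ^t* + v *m (A - B)^t* = v *m A ^t*.
  by rewrite -mulmxDr linearB /= map_mxB addrC subrK.
have h4 : (1 + t) * norm2 (v *m B ^t*) <= (e' + e ^+ 2) / 2 * norm2 v.
  by rewrite -ht -mulrA ler_wpM2l// addr_ge0// ltW.
have h5 : (1 + t^-1) * norm2 (v *m (A - B)^t*) <= (e' - e ^+ 2) / 4 * norm2 v.
  apply: (@le_trans _ _ ((1 + t^-1) * (n%:R ^+ 3 * dl ^+ 2 * norm2 v))).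
    by rewrite ler_wpM2l// addr_ge0// invr_ge0 ltW.
  have -> : (1 + t^-1) * (n%:R ^+ 3 * dl ^+ 2 * norm2 v) = D * dl ^+ 2 * norm2 v.
    by rewrite /D; ring.
  rewrite ler_wpM2r ?norm2_ge0// /dl sqr_sqrtr; last first.
    by rewrite divr_ge0 ?subr_ge0 ?(ltW e'e)// mulr_ge0// ltW.
  by rewrite le_eqVlt; apply/orP; left; apply/eqP; field; exact: lt0r_neq0.
nra.
Qed.
End sigma_rows.

End linear_algebra.

(** * Measurability of singular values *)

Section measurability.
Context d (T : measurableType d) (F : realType) (P : probability T F) (n : nat)
  (X : 'I_n * 'I_n -> {RV P >-> F[i]}) (M : 'M[F[i]]_n).

Lemma event_exists (Q : countType) (J : {set 'I_n * 'I_n}) (E : Q -> set T) :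
  (forall q, event X J (E q)) -> event X J [set w | exists q, E q w].
Proof.
move=> h.
have := @event_bigcup _ _ _ _ _ _ _ X J
  (fun k => if unpickle k is Some q then E q else set0).
have -> : \bigcup_k (if unpickle k is Some q then E q else set0) = [set w | exists q, E q w].
  apply/seteqP; split => w.
    by move=> [k _]; case: unpickle => // q Eq; exists q.
  by move=> [q Eq]; exists (pickle q) => //; rewrite pickleK.
apply=> k; case: unpickle => //; exact: event0.
Qed.

Lemma event_forall_fin (K : finType) (J : {set 'I_n * 'I_n}) (E : K -> set T) :
  (forall q, event X J (E q)) -> event X J [set w | forall q, E q w].
Proof.
move=> h; have := @event_bigsetI _ _ _ _ _ _ _ X K J (index_enum K) xpredT E (fun q _ => h q).
congr (event X J _); rewrite -bigcap_seq; apply/seteqP; split => w.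
  by move=> hw q; apply: hw; rewrite /= mem_index_enum.
by move=> hw q _; exact: hw.
Qed.

Lemma cmeas_entry (J : {set 'I_n * 'I_n}) i j : (i, j) \in J ->
  cmeas X J (fun w => (M + random_matrix X w) i j).
Proof.
move=> ij.
have -> : (fun w => (M + random_matrix X w) i j) = (fun w => M i j + X (i, j) w).
  by apply: funext => w; rewrite !mxE.
by apply: cmeasD; [exact: cmeas_cst|exact: cmeas_var].
Qed.

(** The condition sigma > e is open, hence a union of countably many grid boxes on which it holds
    throughout; the event is the complement. *)
Lemma event_sigma_le k e : (k < n)%N -> 0 < e ->
  event X [set: 'I_n * 'I_n]%SET [set w | sigma k.+1 (M + random_matrix X w) <= e].
Proof.
move=> kn e0.
pose eta (N : nat) : F := (N.+1%:R)^-1.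
pose box (q : nat * {ffun 'I_n * 'I_n -> int * int}) : set 'M[F[i]]_n :=
  [set B | forall ij : 'I_n * 'I_n, square (grid (eta q.1) (q.2 ij)) (eta q.1) (B ij.1 ij.2)].
pose E q : set T := [set w | box q `<=` [set B | e < sigma k.+1 B] /\
  box q (M + random_matrix X w)].
have mE q : event X [set: 'I_n * 'I_n]%SET (E q).
  have [hq|hq] := pselect (box q `<=` [set B | e < sigma k.+1 B]); last first.
    have -> : E q = set0 by apply/seteqP; split => w // -[].
    exact: event0.
  have -> : E q = [set w | box q (M + random_matrix X w)].
    by apply/seteqP; split => w; [case|split].
  apply: event_forall_fin => -[i j]; apply: event_square; apply: cmeas_entry.
  by rewrite inE.
have -> : [set w | sigma k.+1 (M + random_matrix X w) <= e] = ~` [set w | exists q, E q w].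
  apply/seteqP; split => w /=.
    by move=> h [q [hq hb]]; have := hq _ hb; rewrite /= ltNge h.
  move=> h; rewrite leNgt; apply/negP => hs; apply: h.
  have [dl dl0 hdl] := sigma_gt_open kn e0 hs.
  (* Two matrices in one box are each within [2 * eta N] of its centre, entry by entry. *)
  have [N hN] : exists N, 4 * eta N <= dl.
    exists (Num.trunc (4 / dl)); rewrite /eta ler_pdivrMr ?ltr0n//.
    rewrite -ler_pdivrMl// mulrC; apply: ltW.
    by have := truncnS_gt (4 / dl).
  have eta0 : 0 < eta N by rewrite invr_gt0 ltr0n.
  have [q hq] := choice (fun ij : 'I_n * 'I_n => grid_near ((M + random_matrix X w) ij.1 ij.2) eta0).
  have hb : box (N, [ffun ij => q ij]) (M + random_matrix X w).
    by move=> ij /=; rewrite ffunE; exact: hq.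
  exists (N, [ffun ij => q ij]); split => // B hB.
  apply: hdl => i j.
  have /square_normc h1 := hb (i, j); have /square_normc h2 := hB (i, j).
  have -> : (M + random_matrix X w) i j - B i j =
    ((M + random_matrix X w) i j - grid (eta N) (q (i, j))) - (B i j - grid (eta N) (q (i, j))).
    ring.
  move: h1 h2; rewrite /= !ffunE => h1 h2.
  apply: le_trans (le_normcB _ _) _; apply: le_trans (lerD h1 h2) _.
  by apply: le_trans hN; lra.
by apply: eventC; exact: event_exists.
Qed.

Lemma measurable_norm_infty R :
  measurable [set w | R <= norm_infty (M + random_matrix X w)].
Proof.
have m i j : measurable_fun setT (fun w => normc ((M + random_matrix X w) i j)).
  have -> : (fun w => normc ((M + random_matrix X w) i j)) = (fun w => normc (M i j + X (i, j) w)).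
    by apply: funext => w; rewrite !mxE.
  have mRe := measurableT_comp (@measurable_Re F) (measurable_funPT (X (i, j))).
  have mIm := measurableT_comp (@measurable_Im F) (measurable_funPT (X (i, j))).
  have := measurableT_comp (continuous_measurable_fun (@sqrt_continuous F))
    (measurable_funD
      (measurable_funX 2 (measurable_funD (measurable_cst (complex.Re (M i j))) mRe))
      (measurable_funX 2 (measurable_funD (measurable_cst (complex.Im (M i j))) mIm))).
  by apply: eq_measurable_fun => w _ /=; case: (M i j) (X (i, j) w) => ? ? [].
have mi i : measurable_fun setT (fun w => \sum_(j < n) normc ((M + random_matrix X w) i j)).
  exact: measurable_sum.
have H (r : seq 'I_n) (f : 'I_n -> T -> F) : (forall i, measurable_fun setT (f i)) ->
    measurable_fun setT (fun w => \big[Num.max/0]_(i <- r) f i w).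
  move=> mf; elim: r => [|i r IH].
    have -> : (fun w => \big[Num.max/0]_(i <- [::]) f i w) = (fun=> 0).
      by apply: funext => w; rewrite big_nil.
    exact: measurable_cst.
  have -> : (fun w => \big[Num.max/0]_(j <- i :: r) f j w) =
      (fun w => Num.max (f i w) (\big[Num.max/0]_(j <- r) f j w)).
    by apply: funext => w; rewrite big_cons.
  exact: measurable_maxr.
have mn := H (index_enum 'I_n) _ mi.
have := mn measurableT _ (measurable_itv `[R, +oo[); rewrite setTI.
by congr (measurable _); apply/seteqP; split => w /=; rewrite in_itv/= andbT.
Qed.
End measurability.

(** * Small values on the rows hit by the Bernoulli variables *)

Section rows.
Context d (T : measurableType d) (F : realType) (P : probability T F) (n : nat)
  (X : 'I_n * 'I_n -> {RV P >-> F[i]}) (M : 'M[F[i]]_n) (rho : F).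
Hypothesis indep : mutually_independent X.
Hypothesis rho01 : 0 <= rho <= 1.
Hypothesis X0 : forall i, P (X i @^-1` [set 0%R]) = (1 - rho)%:E.
Hypothesis Xsq : forall i a h, 0 <= h ->
  (P (X i @^-1` (~` [set 0%R] `&` square a h)) <= (rho * (4 * h ^+ 2 / pi))%:E)%E.

Local Notation C := F[i].
Implicit Types (U Q : {set 'I_n}) (r : 'I_n) (z a : 'I_n -> C).

Let rho0 : 0 <= rho. Proof. by case/andP: rho01. Qed.
Let rho1 : rho <= 1. Proof. by case/andP: rho01. Qed.

(** The probability that [t] given entries of a row all vanish; [hitp] is that of the complement. *)
Definition miss (t : nat) : F := (1 - rho) ^+ t.
Definition hitp (t : nat) : F := 1 - miss t.

Lemma miss_ge0 t : 0 <= miss t.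
Proof. by rewrite exprn_ge0// subr_ge0. Qed.

Lemma miss_le1 t : miss t <= 1.
Proof. by rewrite exprn_ile1// ?subr_ge0// lerBlDr lerDl. Qed.

Lemma hitp_ge0 t : 0 <= hitp t.
Proof. by rewrite subr_ge0 miss_le1. Qed.

Definition row_block r U : {set 'I_n * 'I_n} := [set ij | (ij.1 == r) && (ij.2 \in U)]%SET.

Definition hit r U (w : T) : bool := [exists j in U, X (r, j) w != 0].

Definition entry (w : T) (i j : 'I_n) : C := (M + random_matrix X w) i j.

Lemma row_block_disjoint U r r' : r != r' -> [disjoint row_block r U & row_block r' U]%B.
Proof.
move=> rr; rewrite -finset.setI_eq0; apply/eqP/setP => -[i j]; rewrite !inE /=.
by apply/negbTE; apply: contra rr => /andP[/andP[/eqP <- _] /andP[/eqP <- _]].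
Qed.

Lemma big_row_block (V : nmodType) (r : 'I_n) U (f : 'I_n * 'I_n -> V) :
  \sum_(ij in row_block r U) f ij = \sum_(j in U) f (r, j).
Proof.
rewrite (reindex_onto (fun j => (r, j)) snd) /=.
  by apply: eq_bigl => j; rewrite !inE /= !eqxx /= andbT.
by move=> [i j]; rewrite !inE /= => /andP[/eqP -> _].
Qed.

Lemma card_row_block r U : #|row_block r U| = #|U|.
Proof. by rewrite -!sum1_card big_row_block. Qed.

Lemma row_blockP r U j : j \in U -> (r, j) \in row_block r U.
Proof. by move=> jU; rewrite inE eqxx. Qed.

Lemma ob_miss r U : ob X (row_block r U) [set w | ~~ hit r U w] (miss #|U|).
Proof.
have := ob_entries0 indep X0 (row_block r U); rewrite card_row_block.
apply: ob_sub => // w /existsPn /= h [i j]; rewrite inE /= => /andP[/eqP -> jU].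
by have := h j; rewrite jU /= negbK => /eqP.
Qed.

(** The deterministic matrix only shifts the centre of the disc. *)
Lemma ob_hit_small r U z (a : C) (tau h eta : F) :
  0 < tau -> (forall j, j \in U -> tau <= normc (z j)) -> 0 <= h -> 0 < eta ->
  ob X (row_block r U)
    [set w | hit r U w /\ normc (\sum_(j in U) entry w r j * z j - a) <= h]
    (hitp #|U| * (4 * ((h + eta) / tau) ^+ 2 / pi)).
Proof.
move=> t0 tz h0 e0.
have tz' : forall ij, ij \in row_block r U -> tau <= normc (z ij.2).
  by move=> [i j]; rewrite inE => /andP[_ /tz].
have := ob_sum_small indep rho01 X0 Xsq (J := row_block r U) (z := fun ij => z ij.2)
  (\sum_(j in U) M r j * z j - a) t0 tz' h0 e0.
rewrite card_row_block; apply: ob_sub => // w [/existsP[j /andP[jU Xn]] H]; split.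
  by exists (r, j); [exact: row_blockP|exact/eqP].
move: H; rewrite big_row_block; congr (normc _ <= h).
rewrite addrAC -big_split /=; congr (_ - _); apply: eq_bigr => k _.
by rewrite /entry !mxE mulrDl.
Qed.

Lemma ob_entry_neq0 ij : ob X [set ij] [set w | X ij w != 0] rho.
Proof.
exists (X ij @^-1` (~` [set 0])); split.
- by apply: (event_gen (X := X)); [rewrite inE|exact: measurableC (measurable_set0C F)].
- by move=> w /= /eqP.
- rewrite -preimage_setC probability_setC ?X0//; last first.
    by rewrite -[_ @^-1` _]setTI; apply: measurable_funPT => //; exact: measurable_set0C.
  by rewrite -EFinB lee_fin; lra.
Qed.

Lemma ob_hits (J : {set 'I_n * 'I_n}) :
  ob X J [set w | [exists ij in J, X ij w != 0]] (hitp #|J|).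
Proof.
have [k] := ubnP #|J|; elim: k J => // k IH J.
have [->|[i iJ]] := set_0Vmem J.
  move=> _; rewrite cards0 /hitp /miss expr0 subrr.
  by apply: ob_sub (ob_set0 X finset.set0) => // w /existsP [k0]; rewrite inE.
rewrite (cardsD1 i) iJ /= add1n ltnS => Jk.
set J' := (J :\ i)%SET in Jk *.
have dij : [disjoint [set i]%SET & J']%B by rewrite disjoints1 !inE eqxx.
have h2 := obI indep dij (ob_entry0 X0 i) (IH _ Jk).
have h1 : ob X ([set i] :|: J')%SET [set w | X i w != 0] rho.
  by apply: ob_sub (ob_entry_neq0 i) => //; exact: finset.subsetUl.
apply: ob_sub (obU h1 h2).
- by rewrite finset.setD1K.
- move=> w /existsP[j /andP[jJ Xj]].
  have [Xi|] := eqVneq (X i w) 0; [right; split => //=|by left].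
  apply/existsP; exists j; rewrite !inE jJ Xj !andbT.
  by apply: contraNneq Xj => ->; rewrite Xi.
- by rewrite /hitp /miss exprS le_eqVlt; apply/orP; left; apply/eqP; ring.
Qed.

Lemma ob_hit r U : ob X (row_block r U) [set w | hit r U w] (hitp #|U|).
Proof.
have := ob_hits (row_block r U); rewrite card_row_block; apply: ob_sub => //.
move=> w /existsP[j /andP[jU Xj]]; apply/existsP; exists (r, j).
by rewrite Xj row_blockP.
Qed.

(** Expands the product over the set [Q] of rows where [f] is taken. With c = theta^-m and [f]
    carrying a factor theta this is Chernoff's bound for few hits; with c = p^m it collects the
    small-ball factors of the hit rows. *)
Lemma sum_subsets_le (f g : 'I_n -> F) (Qp : pred {set 'I_n}) (c : F) (k : 'I_n -> {set 'I_n} -> F) :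
  (forall Q, Qp Q -> \prod_r k r Q <= c * \prod_r (if r \in Q then f r else g r)) ->
  (forall r, 0 <= f r) -> (forall r, 0 <= g r) -> 0 <= c ->
  \sum_(Q | Qp Q) \prod_r k r Q <= c * \prod_r (f r + g r).
Proof.
move=> h f0 g0 c0.
have e : \prod_r (f r + g r) = \sum_(Q : {set 'I_n}) \prod_r (if r \in Q then f r else g r).
  by rewrite bigA_distr.
apply: le_trans (ler_sum _ h) _; rewrite e -mulr_sumr ler_wpM2l//.
rewrite [leRHS](bigID Qp) /= lerDl sumr_ge0// => Q _; apply: prodr_ge0 => r _.
by case: ifP.
Qed.

(* Both tail bounds come from summing over the set [Q] of rows that are hit. *)
Lemma ob_few_hits U (m : nat) (theta : F) : 0 < theta <= 1 ->
  ob X [set: 'I_n * 'I_n]%SET [set w | (#|[set r | hit r U w]%SET| < m)%N]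
    ((theta ^+ m)^-1 * (theta * hitp #|U| + miss #|U|) ^+ n).
Proof.
move=> /andP[th0 th1].
pose b (Q : {set 'I_n}) r := if r \in Q then hitp #|U| else miss #|U|.
have h (Q : {set 'I_n}) : (#|Q| < m)%N ->
    ob X (\bigcup_(r in [set: 'I_n]) row_block r U)%SET
     [set w | forall r, r \in [set: 'I_n]%SET -> hit r U w = (r \in Q)]
     (\prod_(r in [set: 'I_n]%SET) b Q r).
  move=> _; apply: (ob_forall indep); first by move=> r r'; exact: row_block_disjoint.
  move=> r _; rewrite /b; case: ifP => rQ.
    by apply: ob_sub (ob_hit r U).
  by apply: ob_sub (ob_miss r U) => // w /= ->.
have := ob_exists h; apply: ob_sub => //.
  by move=> w /= hw; exists [set r | hit r U w]%SET => // r _; rewrite inE.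
rewrite (eq_bigr (fun Q => \prod_r b Q r)); last first.
  by move=> Q _; apply: eq_bigl => r; rewrite inE.
have -> : (theta * hitp #|U| + miss #|U|) ^+ n = \prod_(r < n) (theta * hitp #|U| + miss #|U|).
  by rewrite prodr_const card_ord.
apply: sum_subsets_le.
- move=> Q Qm.
  rewrite [leRHS](_ : _ = (theta ^+ m)^-1 * theta ^+ #|Q| * \prod_r b Q r); last first.
    rewrite -mulrA; congr (_ * _).
    rewrite -prodr_const (big_mkcond (mem Q)) -big_split /=; apply: eq_bigr => r _.
    by rewrite /b; case: ifP; rewrite ?mul1r.
  rewrite ler_peMl//.
    by apply: prodr_ge0 => r _; rewrite /b; case: ifP; rewrite ?hitp_ge0 ?miss_ge0.
  rewrite mulrC ler_pdivlMr ?exprn_gt0// mul1r.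
  by rewrite ler_wiXn2l ?(ltW th0) ?(ltnW Qm).
- by move=> r; rewrite mulr_ge0 ?hitp_ge0// ltW.
- by move=> r; exact: miss_ge0.
- by rewrite invr_ge0 exprn_ge0// ltW.
Qed.

(** No binomial coefficient is lost: the weights [hitp] and [miss] sum to one over all [Q], each hit
    row contributes [p], and p <= 1 lowers the exponent to [m]. *)
Lemma ob_rows U Q0 z a (m : nat) (tau h eta : F) :
  let p := 4 * ((h + eta) / tau) ^+ 2 / pi in
  p <= 1 ->
  0 < tau -> (forall j, j \in U -> tau <= normc (z j)) -> 0 <= h -> 0 < eta ->
  ob X (\bigcup_(r in Q0) row_block r U)%SET
   [set w | (forall r, r \in Q0 -> normc (\sum_(j in U) entry w r j * z j - a r) <= h) /\
            (m <= #|[set r in Q0 | hit r U w]%SET|)%N]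
   (p ^+ m).
Proof.
move=> p p1 t0 tz h0 e0.
have p0 : 0 <= p by rewrite /p divr_ge0 ?pi_ge0// mulr_ge0// sqr_ge0.
pose b (Q : {set 'I_n}) r := if r \in Q then hitp #|U| * p else miss #|U|.
have H (Q : {set 'I_n}) : (Q \subset Q0) && (m <= #|Q|)%N ->
    ob X (\bigcup_(r in Q0) row_block r U)%SET
     [set w | forall r, r \in Q0 -> hit r U w = (r \in Q) /\
         normc (\sum_(j in U) entry w r j * z j - a r) <= h]
     (\prod_(r in Q0) b Q r).
  move=> _; apply: (ob_forall indep); first by move=> r r'; exact: row_block_disjoint.
  move=> r _; rewrite /b; case: ifP => rQ.
    by apply: ob_sub (ob_hit_small r (a r) t0 tz h0 e0) => // w [/= -> ->].
  by apply: ob_sub (ob_miss r U) => // w /= [-> _].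
have := ob_exists H; apply: ob_sub => //.
  move=> w [/= hw hm]; exists [set r in Q0 | hit r U w]%SET.
    rewrite hm andbT; by apply/fintype.subsetP => r; rewrite inE => /andP[].
  by move=> r rQ; rewrite inE rQ; split => //; exact: hw.
pose k r (Q : {set 'I_n}) := if r \in Q0 then b Q r else 1.
rewrite (eq_bigr (fun Q => \prod_r k r Q)); last first.
  by move=> Q _; rewrite big_mkcond.
pose f r := if r \in Q0 then hitp #|U| else 0.
pose g r := if r \in Q0 then miss #|U| else 1.
rewrite [leRHS](_ : _ = p ^+ m * \prod_r (f r + g r)); last first.
  rewrite big1 ?mulr1// => r _; rewrite /f /g; case: ifP => _; last by rewrite add0r.
  by rewrite /hitp subrK.
apply: sum_subsets_le.
- move=> Q /andP[QQ0 Qm].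
  rewrite [leLHS](_ : _ = p ^+ #|Q| * \prod_r (if r \in Q then f r else g r)); last first.
    rewrite -prodr_const (big_mkcond (mem Q)) -big_split /=; apply: eq_bigr => r _.
    rewrite /k /b /f /g; case: (boolP (r \in Q)) => rQ.
      by rewrite (fintype.subsetP QQ0 _ rQ) mulrC.
    by rewrite mul1r.
  rewrite ler_wpM2r//; last by rewrite ler_wiXn2l.
  apply: prodr_ge0 => r _; rewrite /f /g.
  by do 2 case: ifP => _ //; rewrite ?hitp_ge0 ?miss_ge0.
- by move=> r; rewrite /f; case: ifP; rewrite ?hitp_ge0.
- by move=> r; rewrite /g; case: ifP; rewrite ?miss_ge0.
- by rewrite exprn_ge0.
Qed.

End rows.

Section normc_sums.
Variables (F : realType) (n : nat).
Local Notation C := F[i].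

Lemma normc_sum_le (A : {set 'I_n}) (x : 'I_n -> C) (N : nat) (B : F) : 0 <= B ->
  (#|A| <= N)%N -> (forall i, i \in A -> normc (x i) <= B) ->
  normc (\sum_(i in A) x i) <= N%:R * B.
Proof.
move=> B0 AN h; apply: le_trans (le_normc_sum _ _ _) _.
apply: (@le_trans _ _ (\sum_(i in A) B)); first exact: ler_sum.
by rewrite sumr_const -[leLHS]mulr_natl ler_wpM2r// ler_nat.
Qed.

Lemma norm_infty_row (A : 'M[C]_n) r : \sum_(j < n) normc (A r j) <= norm_infty A.
Proof. exact: (le_bigmax _ (fun r => \sum_(j < n) normc (A r j)) r). Qed.

Lemma norm_infty_entry (A : 'M[C]_n) r j : normc (A r j) <= norm_infty A.
Proof.
apply: le_trans (norm_infty_row A r); rewrite (bigD1 j)//= lerDl sumr_ge0// => k _.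
exact: normc_ge0.
Qed.

Lemma norm_infty_sum (A : 'M[C]_n) r (S : {set 'I_n}) (y : 'I_n -> C) (B : F) :
  0 <= B -> (forall j, j \in S -> normc (y j) <= B) ->
  normc (\sum_(j in S) A r j * y j) <= norm_infty A * B.
Proof.
move=> B0 h; apply: le_trans (le_normc_sum _ _ _) _.
apply: (@le_trans _ _ (\sum_(j in S) normc (A r j) * B)).
  by apply: ler_sum => j jS; rewrite normcM ler_wpM2l ?normc_ge0// h.
rewrite -mulr_suml ler_wpM2r//; apply: le_trans (norm_infty_row A r).
rewrite [leRHS](bigID (mem S)) /= lerDl sumr_ge0// => k _; exact: normc_ge0.
Qed.
End normc_sums.

(** * One step between scales, for fixed sets and fixed rounded values *)

Section step.
Context d (T : measurableType d) (F : realType) (P : probability T F) (n : nat)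
  (X : 'I_n * 'I_n -> {RV P >-> F[i]}) (M : 'M[F[i]]_n) (rho : F).
Hypothesis indep : mutually_independent X.
Hypothesis rho01 : 0 <= rho <= 1.
Hypothesis X0 : forall i, P (X i @^-1` [set 0%R]) = (1 - rho)%:E.
Hypothesis Xsq : forall i a h, 0 <= h ->
  (P (X i @^-1` (~` [set 0%R] `&` square a h)) <= (rho * (4 * h ^+ 2 / pi))%:E)%E.

Local Notation C := F[i].
Implicit Types (U V Q : {set 'I_n}) (r : 'I_n) (z a : 'I_n -> C).
Local Notation entry := (entry X M).
Local Notation A w := (M + random_matrix X w).

Definition cols U : {set 'I_n * 'I_n} := [set ij | ij.2 \in U]%SET.

Lemma event_prop (J : {set 'I_n * 'I_n}) (Q : Prop) : event X J [set w | Q].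
Proof.
have [q|q] := pselect Q.
  have -> : [set w : T | Q] = setT by apply/seteqP; split.
  exact: eventT.
have -> : [set w : T | Q] = set0 by apply/seteqP; split.
exact: event0.
Qed.

Lemma event_imp (J : {set 'I_n * 'I_n}) (b : bool) (E : set T) :
  (b -> event X J E) -> event X J [set w | b -> E w].
Proof.
case: b => h; last by have := @event_prop J True; congr (event X J _); apply/seteqP; split.
by have := h isT; congr (event X J _); apply/seteqP; split => w //= ; apply.
Qed.

Lemma cmeas_rowsum (J : {set 'I_n * 'I_n}) U z r : (forall j, j \in U -> (r, j) \in J) ->
  cmeas X J (fun w => \sum_(j in U) entry w r j * z j).
Proof.
move=> h; apply: cmeas_sum => j jU; apply: cmeasM; last exact: cmeas_cst.
by apply: cmeas_entry; exact: h.
Qed.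

(** Freezing the rows in [I0] by rounding turns the combinations into constants for the other rows,
    which are independent of them. At most [D] hit rows are lost, hence the exponent m - D. *)
Lemma ob_fixed_coefs U (I0 : {set 'I_n}) z (g : 'I_n -> 'I_n -> C) (m D : nat) (tau h : F) :
  let p := 4 * ((h * (2 * D%:R + 4)) / tau) ^+ 2 / pi in
  p <= 1 -> 0 < tau -> (forall j, j \in U -> tau <= normc (z j)) -> 0 < h ->
  (#|I0| <= D)%N -> (forall r i, normc (g r i) <= 2) ->
  ob X (cols U) [set w |
    (forall r, normc (\sum_(j in U) entry w r j * z j -
        \sum_(i in I0) g r i * \sum_(j in U) entry w i j * z j) <= h * (2 * D%:R + 2)) /\
    (m <= #|[set r | hit X r U w]%SET|)%N] (p ^+ (m - D)).
Proof.
move=> p p1 t0 tz h0 ID g2.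
pose b (w : T) r := \sum_(j in U) entry w r j * z j.
pose eta := h / (4 * n.+1%:R).
have eta0 : 0 < eta by rewrite divr_gt0// mulr_gt0.
pose J := (\bigcup_(i in I0) row_block i U)%SET.
pose J' := (\bigcup_(r in ~: I0) row_block r U)%SET.
have JJ' : [disjoint J & J']%B.
  rewrite /J' -big_enum; apply: disjoint_bigcup => r; rewrite mem_enum inE => rI.
  rewrite disjoint_sym /J -big_enum; apply: disjoint_bigcup => i; rewrite mem_enum => iI.
  by apply: row_block_disjoint; apply: contraNneq rI => ->.
pose Phi (q : {ffun 'I_n -> int * int}) : set T :=
  [set w | forall i, i \in I0 -> square (grid eta (q i)) eta (b w i)].
pose a (q : {ffun 'I_n -> int * int}) r := \sum_(i in I0) g r i * grid eta (q i).
pose B (q : {ffun 'I_n -> int * int}) : set T :=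
   [set w | (forall r, r \in ~: I0 -> normc (b w r - a q r) <= h * (2 * D%:R + 3)) /\
            (m - D <= #|[set r in ~: I0 | hit X r U w]%SET|)%N].
have mPhi q : event X J (Phi q).
  apply: event_forall_fin => i; apply: event_imp => iI; apply: event_square.
  apply: cmeas_rowsum => j jU; apply/finset.bigcupP; exists i => //.
  exact: row_blockP.
(* Of the two extra [h], one pays for rounding the row sums over [I0], the other is the margin [eta]
   of [ob_rows]. *)
have hp : p = 4 * ((h * (2 * D%:R + 3) + h) / tau) ^+ 2 / pi.
  by rewrite /p; congr (4 * (_ / tau) ^+ 2 / pi); ring.
have hh : 0 <= h * (2 * D%:R + 3) by rewrite mulr_ge0 ?addr_ge0 ?mulr_ge0// ltW.
have hB q : ob X J' (B q) (p ^+ (m - D)).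
  have := @ob_rows _ _ _ _ _ X M rho indep rho01 X0 Xsq U (~: I0)%SET z (a q)
    (m - D) tau (h * (2 * D%:R + 3)) h.
  by rewrite -hp; apply.
have p0 : 0 <= p ^+ (m - D).
  by rewrite exprn_ge0// /p divr_ge0 ?pi_ge0// mulr_ge0// sqr_ge0.
apply: ob_sub (ob_select indep p0 JJ' mPhi hB) => //.
  apply/fintype.subsetP => ij; rewrite !inE => /orP[] /finset.bigcupP[r _];
  by rewrite inE => /andP[].
move=> w [hw hits]; split.
  have [q hq] := choice (fun i => grid_near (b w i) eta0).
  by exists [ffun i => q i] => i _; rewrite ffunE; exact: hq.
move=> q hq; split.
  move=> r _.
  have -> : b w r - a q r = (b w r - \sum_(i in I0) g r i * b w i) +
      \sum_(i in I0) g r i * (b w i - grid eta (q i)).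
    rewrite /a -[X in _ = _ - X + _](@subrK _ (\sum_(i in I0) g r i * grid eta (q i))).
    rewrite -sumrB; under [X in _ - (X + _)]eq_bigr do rewrite -mulrBr.
    ring.
  apply: le_trans (le_normcD _ _) _.
  have -> : h * (2 * D%:R + 3) = h * (2 * D%:R + 2) + h by ring.
  apply: lerD; first exact: hw.
  apply: (@le_trans _ _ (n%:R * (2 * (2 * eta)))).
    apply: normc_sum_le; first by rewrite !mulr_ge0// ltW.
      by rewrite -[leqRHS]card_ord max_card.
    move=> i iI; rewrite normcM; apply: ler_pM; rewrite ?normc_ge0//.
    exact: square_normc (hq i iI).
  rewrite /eta; have -> : n%:R * (2 * (2 * (h / (4 * n.+1%:R)))) = h * (n%:R / n.+1%:R) :> F.
    by field; rewrite ?nat1r ?natr1 pnatr_eq0.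
  by rewrite ger_pMr// ler_pdivrMr ?ltr0n// mul1r ler_nat.
rewrite leq_subLR; apply: leq_trans hits _.
rewrite -(cardsID I0 [set r | hit X r U w]%SET) leq_add//.
  by apply: leq_trans ID; apply: subset_leq_card; exact: finset.subsetIr.
apply: subset_leq_card; apply/fintype.subsetP => r.
by rewrite !inE => /andP[-> ->].
Qed.

(** The columns in [V] are independent of those in [U], so rounded coefficients can be selected from
    them. Rounding destroys the exact relation; [Phi] asks for it only approximately, and [dif] is
    the residue that remains in front of the bounded unknown [y]. *)
Lemma ob_fixed U V (I0 : {set 'I_n}) z (m D : nat) (tau h R : F) :
  let p := 4 * ((h * (2 * D%:R + 4)) / tau) ^+ 2 / pi in
  p <= 1 -> 0 < tau -> (forall j, j \in U -> tau <= normc (z j)) -> 0 < h -> 0 < R ->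
  (#|I0| <= D)%N -> [disjoint U & V]%B ->
  ob X [set: 'I_n * 'I_n]%SET [set w |
    [/\ norm_infty (A w) < R,
     exists2 c : 'I_n -> 'I_n -> C, (forall r i, normc (c r i) <= 1) &
       forall r j, j \in V -> entry w r j = \sum_(i in I0) c r i * entry w i j,
     exists2 y : 'I_n -> C, (forall j, normc (y j) <= 1) &
       forall r, normc (\sum_(j in U) entry w r j * z j + \sum_(j in V) entry w r j * y j) <= h &
     (m <= #|[set r | hit X r U w]%SET|)%N]]
   (p ^+ (m - D)).
Proof.
move=> p p1 t0 tz h0 R0 ID UV.
pose eta1 := h / (2 * n.+1%:R).
have eta10 : 0 < eta1 by rewrite divr_gt0// mulr_gt0.
(* The bound 1/2 keeps the rounded coefficients below 2 in modulus; the other bound, with entries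
   below [R], makes the residue at most [eta1]. *)
pose eta2 := Num.min 2^-1 (eta1 / (2 * n.+1%:R * R)).
have eta20 : 0 < eta2 by rewrite lt_min invr_gt0 ltr0n divr_gt0// !mulr_gt0.
pose G (q : {ffun 'I_n * 'I_n -> int * int}) r i := grid eta2 (q (r, i)).
pose small q := forall r i, normc (G q r i) <= 2.
pose Phi q : set T := [set w | small q] `&`
  [set w | forall rj : 'I_n * 'I_n, rj.2 \in V ->
     square 0 eta1 (entry w rj.1 rj.2 - \sum_(i in I0) G q rj.1 i * entry w i rj.2)].
pose B q : set T := [set w | small q /\
   ((forall r, normc (\sum_(j in U) entry w r j * z j -
        \sum_(i in I0) G q r i * \sum_(j in U) entry w i j * z j) <= h * (2 * D%:R + 2)) /\
    (m <= #|[set r | hit X r U w]%SET|)%N)].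
have p0 : 0 <= p ^+ (m - D).
  by rewrite exprn_ge0// /p divr_ge0 ?pi_ge0// mulr_ge0// sqr_ge0.
have mPhi q : event X (cols V) (Phi q).
  apply: eventI; first exact: event_prop.
  apply: event_forall_fin => -[r j]; apply: event_imp => /= jV; apply: event_square.
  have mE i : cmeas X (cols V) (fun w => entry w i j).
    by apply: cmeas_entry; rewrite inE.
  have -> : (fun w => entry w r j - \sum_(i in I0) G q r i * entry w i j) =
     (fun w => entry w r j + (-1) * \sum_(i in I0) G q r i * entry w i j).
    by apply: funext => w; rewrite mulN1r.
  apply: cmeasD => //; apply: cmeasM; first exact: cmeas_cst.
  by apply: cmeas_sum => i _; apply: cmeasM => //; exact: cmeas_cst.
have hB q : ob X (cols U) (B q) (p ^+ (m - D)).
  have [sq|nsq] := pselect (small q).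
    have := ob_fixed_coefs (g := G q) m p1 t0 tz h0 ID sq.
    by apply: ob_sub => // w [].
  by apply: ob_sub (ob_set0 X (cols U)) => // w [].
have VU : [disjoint cols V & cols U]%B.
  rewrite disjoint_sym -finset.setI_eq0; apply/eqP/setP => -[i j]; rewrite !inE /=.
  by apply/negbTE/negP => /andP[jU]; rewrite (disjointFr UV jU).
apply: ob_sub (ob_select indep p0 VU mPhi hB) => //.
move=> w [nR [c c1 hc] [y y1 hy] hits]; split.
  have [q hq] := choice (fun ri : 'I_n * 'I_n => grid_near (c ri.1 ri.2) eta20).
  have hq' r i : normc (c r i - grid eta2 (q (r, i))) <= 2 * eta2.
    exact: square_normc (hq (r, i)).
  exists [ffun ri => q ri]; split.
    move=> r i; rewrite /G ffunE.
    apply: le_trans (ler_distnormc _ (c r i)) _; rewrite normcB.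
    have -> : 2 = 1 + 1 :> F by ring.
    apply: lerD => //; apply: le_trans (hq' r i) _.
    have : eta2 <= 2^-1 by rewrite ge_min lexx.
    lra.
  move=> [r j] /= jV; apply: normc_square; rewrite subr0 hc// -sumrB.
  apply: (@le_trans _ _ (n%:R * (2 * eta2 * R))).
    apply: normc_sum_le; first by rewrite !mulr_ge0// ltW.
      by rewrite -[leqRHS]card_ord max_card.
    move=> i iI; rewrite /G ffunE -mulrBl normcM; apply: ler_pM; rewrite ?normc_ge0//.
    by apply: le_trans (ltW nR); exact: norm_infty_entry.
  have : eta2 <= eta1 / (2 * n.+1%:R * R) by rewrite ge_min lexx orbT.
  rewrite ler_pdivlMr ?mulr_gt0// => h2; apply: le_trans h2.
  have -> : eta2 * (2 * n.+1%:R * R) = n.+1%:R * (2 * eta2 * R) by ring.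
  by apply: ler_wpM2r; [rewrite !mulr_ge0 ?(ltW R0) ?(ltW eta20)|rewrite ler_nat].
move=> q [sq hq]; split => //; split => // r.
pose e r := \sum_(j in U) entry w r j * z j + \sum_(j in V) entry w r j * y j.
pose dif r j := entry w r j - \sum_(i in I0) G q r i * entry w i j.
have -> : \sum_(j in U) entry w r j * z j -
     \sum_(i in I0) G q r i * \sum_(j in U) entry w i j * z j =
   e r - \sum_(i in I0) G q r i * e i - \sum_(j in V) dif r j * y j.
  have -> : \sum_(j in V) dif r j * y j = \sum_(j in V) entry w r j * y j -
      \sum_(i in I0) G q r i * \sum_(j in V) entry w i j * y j.
    under eq_bigr do rewrite /dif mulrBl.
    rewrite sumrB; congr (_ - _).
    under eq_bigr do rewrite mulr_suml.
    rewrite exchange_big /=; apply: eq_bigr => i _; rewrite mulr_sumr.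
    by apply: eq_bigr => j _; rewrite mulrA.
  have -> : \sum_(i in I0) G q r i * e i = \sum_(i in I0) G q r i * \sum_(j in U) entry w i j * z j +
      \sum_(i in I0) G q r i * \sum_(j in V) entry w i j * y j.
    by rewrite -big_split /=; apply: eq_bigr => i _; rewrite -mulrDr.
  rewrite /e; ring.
(* The three terms: row [r] itself, at most [D] rows with coefficients of modulus at most 2, and the
   residue on [V]. *)
have -> : h * (2 * D%:R + 2) = h + D%:R * (2 * h) + h by ring.
apply: le_trans (le_normcB _ _) _; apply: lerD.
  apply: le_trans (le_normcB _ _) _; apply: lerD; first exact: hy.
  apply: normc_sum_le => //; first by rewrite mulr_ge0// ltW.
  by move=> i _; rewrite normcM; apply: ler_pM; rewrite ?normc_ge0//; exact: hy.
apply: (@le_trans _ _ (n%:R * (2 * eta1 * 1))).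
  apply: normc_sum_le; first by rewrite !mulr_ge0// ltW.
    by rewrite -[leqRHS]card_ord max_card.
  move=> j jV; rewrite normcM; apply: ler_pM; rewrite ?normc_ge0//.
  by have := square_normc (hq (r, j) jV); rewrite subr0.
rewrite mulr1 /eta1; have -> : n%:R * (2 * (h / (2 * n.+1%:R))) = h * (n%:R / n.+1%:R) :> F.
  by field; rewrite ?nat1r ?natr1 pnatr_eq0.
by rewrite ger_pMr// ler_pdivrMr ?ltr0n// mul1r ler_nat.
Qed.

End step.

(** A square grid of mesh s/2 with 2m + 1 points per side, m <= 2/s + 1; the 7 comes from 4/s + 3 <=
    7/s. *)
Lemma complex_net (F : realType) (s : F) : 0 < s <= 1 ->
  exists (G : finType) (net : G -> F[i]), #|G|%:R <= (7 / s) ^+ 2 /\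
    forall x, normc x <= 1 -> exists g, normc (net g - x) <= s.
Proof.
move=> /andP[s0 s1]; pose m := (Num.trunc (2 / s)).+1.
have sm : 2 / s < m%:R := truncnS_gt (2 / s).
have ms : m%:R <= 2 / s + 1.
  by rewrite /m -natr1 lerD2r truncn_le// divr_ge0// ltW.
pose sh (k : 'I_(m.*2.+1)) : int := (k : nat)%:Z - m%:Z.
have s20 : 0 < s / 2 by rewrite divr_gt0.
have e (y : F) : `|y| <= 1 -> exists k, sh k = Num.floor (y / (s / 2)).
  move=> y1; set q := Num.floor _.
  have /andP[h1 h2] := floor_itv (y / (s / 2)); rewrite -/q in h1 h2.
  have /andP[y2 y3] : - (2 / s) <= y / (s / 2) <= 2 / s.
    have -> : y / (s / 2) = y * (2 / s) by field; exact: lt0r_neq0.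
    have s2 : 0 < 2 / s by rewrite divr_gt0.
    by move: y1; rewrite ler_norml => /andP[]; nra.
  have q1 : q <= m%:Z.
    rewrite -(ler_int F); apply: le_trans h1 _; apply: le_trans y3 _; exact: ltW.
  have q2 : - m%:Z <= q.
    rewrite -ltzD1 -(ltr_int F); apply: le_lt_trans h2; apply: le_trans y2.
    by rewrite rmorphN /= lerN2 ltW.
  have q3 : (`|(q + m%:Z)%R|%N < m.*2.+1)%N by lia.
  exists (Ordinal q3); rewrite /sh /=; lia.
exists ('I_(m.*2.+1) * 'I_(m.*2.+1))%type, (fun ab => grid (s / 2) (sh ab.1, sh ab.2)); split.
  rewrite card_prod card_ord natrM -expr2 lerXn2r ?nnegrE ?ler0n ?divr_ge0 ?(ltW s0)//.
  rewrite -natr1 -muln2 natrM ler_pdivlMr//.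
  move: ms; rewrite -(ler_pM2r s0) mulrDl divfK ?lt0r_neq0// mul1r; lra.
move=> x x1.
have hx : square 0 1 x by apply: normc_square; rewrite subr0.
case: hx; rewrite !subr0 => /e[k1 hk1] /e[k2 hk2].
exists (k1, k2).
have -> : s = 2 * (s / 2) by rewrite mulrC divfK.
rewrite normcB; apply: square_normc; rewrite /= hk1 hk2.
have H (y : F) : `|y - s / 2 * (Num.floor (y / (s / 2)))%:~R| <= s / 2.
  have /andP[h1 h2] := floor_itv (y / (s / 2)).
  have h1' : s / 2 * (Num.floor (y / (s / 2)))%:~R <= y by rewrite mulrC -ler_pdivlMr.
  rewrite ger0_norm ?subr_ge0// lerBlDl.
  move: h2; rewrite ltr_pdivrMr// intrD mulrDl mul1r mulrC; exact: ltW.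
have -> : 2 * (s / 2) / 2 = s / 2 by lra.
by split; exact: H.
Qed.

(** * Union bound for one step between scales *)

Section step.
Context d (T : measurableType d) (F : realType) (P : probability T F) (n : nat)
  (X : 'I_n * 'I_n -> {RV P >-> F[i]}) (M : 'M[F[i]]_n) (rho : F).
Hypothesis indep : mutually_independent X.
Hypothesis rho01 : 0 <= rho <= 1.
Hypothesis X0 : forall i, P (X i @^-1` [set 0%R]) = (1 - rho)%:E.
Hypothesis Xsq : forall i a h, 0 <= h ->
  (P (X i @^-1` (~` [set 0%R] `&` square a h)) <= (rho * (4 * h ^+ 2 / pi))%:E)%E.

Local Notation C := F[i].
Implicit Types (U V Q : {set 'I_n}) (r : 'I_n) (z a : 'I_n -> C).
Local Notation entry := (entry X M).
Local Notation A w := (M + random_matrix X w).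

(** The failure of one step. [U] has exactly [t] elements even if more coordinates exceed [tau], so
    that enumerating it costs only n^t. *)
Definition thin (t D : nat) (tau s h0 R : F) (w : T) : Prop :=
  norm_infty (A w) < R /\ exists (x : 'I_n -> C) (U : {set 'I_n}),
   [/\ forall j, normc (x j) <= 1,
       forall r, normc (\sum_j entry w r j * x j) <= h0,
       #|U| = t, forall j, j \in U -> tau <= normc (x j) &
       (#|[set j | (s <= normc (x j))%R]%SET| <= D)%N].

(** Sets of [t] coordinates are enumerated as images of functions from ['I_t], which bounds their
    number by n^t. *)
Definition img (K : finType) (f : {ffun K -> 'I_n}) : {set 'I_n} := [set f k | k in K]%SET.

Definition spread (K : finType) (f : {ffun K -> 'I_n}) (g : K -> C) (j : 'I_n) : C :=
  if [pick k | f k == j] is Some k then g k else 0.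

Lemma spreadP (K : finType) (f : {ffun K -> 'I_n}) (g : K -> C) (p : 'I_n -> C -> Prop) :
  (forall k, p (f k) (g k)) -> forall j, j \in img f -> p j (spread f g j).
Proof.
move=> h j /imsetP[k _ ->]; rewrite /spread; case: pickP => [k' /eqP <- //|].
by move=> /(_ k); rewrite eqxx.
Qed.

Lemma img_enum U : exists f : {ffun 'I_#|U| -> 'I_n}, img f = U.
Proof.
exists [ffun k => enum_val k]; apply/setP => j; apply/imsetP/idP.
  by move=> [k _ ->]; rewrite ffunE enum_valP.
by move=> jU; exists (enum_rank_in jU j) => //; rewrite ffunE enum_rankK_in.
Qed.

Lemma column_coefs (B : 'M[C]_n) V : exists (I0 : {set 'I_n}) (c : 'I_n -> 'I_n -> C),
  [/\ (#|I0| <= #|V|)%N, forall r i, normc (c r i) <= 1 &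
   forall r j, j \in V -> B r j = \sum_(i in I0) c r i * B i j].
Proof.
pose W : 'M[C]_(n, #|V|) := colsub enum_val B.
have [f [Co [injf eW fC C1]]] := bounded_row_coefs W.
pose ff := [ffun k => f k].
have iff : injective ff by move=> k k'; rewrite !ffunE; exact: injf.
exists (img ff), (fun r => spread ff (fun k => Co r k)); split.
- by rewrite card_imset// card_ord rank_leq_col.
- move=> r j; rewrite /spread; case: pickP => [k _|_]; first exact: C1.
  by rewrite normc0 ler01.
- move=> r j jV; rewrite big_imset /=; last by move=> k k' _ _; exact: iff.
  have := congr1 (fun Z : 'M[C]__ => Z r (enum_rank_in jV j)) eW.
  rewrite [LHS]mxE enum_rankK_in// => ->; rewrite mxE; apply: eq_bigr => k _.
  rewrite !mxE enum_rankK_in// ffunE; congr (_ * _).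
  rewrite /spread; case: pickP => [k' /eqP|/(_ k)]; last by rewrite ffunE eqxx.
  by rewrite ffunE => /injf ->.
Qed.

(** Either few rows are hit, a union over [U] only, or many are, a union over [U], the net values on
    it, [V] and the chosen rows. The values of x on [V] are never enumerated. Rounding by s <= tau /
    2 keeps the values on [U] above tau / 2. *)
Lemma ob_step (G : finType) (net : G -> C) (t D m N : nat) (tau s h0 R theta : F) :
  let p := 4 * ((3 * R * s * (2 * D%:R + 4)) / (tau / 2)) ^+ 2 / pi in
  p <= 1 -> 0 < s -> s <= tau / 2 -> 0 < R -> h0 <= R * s -> 0 < theta <= 1 ->
  (forall x, normc x <= 1 -> exists g, normc (net g - x) <= s) ->
  (#|[set V : {set 'I_n} | (#|V| <= D)%N]%SET| <= N)%N ->
  ob X [set: 'I_n * 'I_n]%SET [set w | thin t D tau s h0 R w]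
   (n%:R ^+ t * ((theta ^+ m)^-1 * (theta * hitp rho t + miss rho t) ^+ n) +
    n%:R ^+ t * #|G|%:R ^+ t * N%:R ^+ 2 * p ^+ (m - D)).
Proof.
move=> p p1 s0 st R0 h0R th net_near hN.
have p0 : 0 <= p ^+ (m - D).
  by rewrite exprn_ge0// /p divr_ge0 ?pi_ge0// mulr_ge0// sqr_ge0.
have th0 : 0 <= (theta ^+ m)^-1 * (theta * hitp rho t + miss rho t) ^+ n.
  have [th1 _] := andP th; rewrite mulr_ge0 ?invr_ge0 ?exprn_ge0 ?(ltW th1)//.
  by rewrite addr_ge0 ?mulr_ge0 ?(ltW th1) ?hitp_ge0 ?miss_ge0.
pose few (f : {ffun 'I_t -> 'I_n}) : set T := [set w | (#|[set r | hit X r (img f) w]%SET| < m)%N].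
have h1 : ob X [set: 'I_n * 'I_n]%SET [set w | exists2 f, #|img f| == t & few f w]
   (n%:R ^+ t * ((theta ^+ m)^-1 * (theta * hitp rho t + miss rho t) ^+ n)).
  have H f : #|img f| == t -> ob X [set: 'I_n * 'I_n]%SET (few f)
     ((theta ^+ m)^-1 * (theta * hitp rho t + miss rho t) ^+ n).
    move=> /eqP ft; have := @ob_few_hits _ _ _ _ _ X rho indep rho01 X0 (img f) m theta th.
    by rewrite ft.
  have := ob_exists H; apply: ob_sub => //.
  rewrite sumr_const -[leLHS]mulr_natl ler_wpM2r// -natrX ler_nat.
  by apply: leq_trans (max_card _) _; rewrite card_ffun !card_ord.
pose K := (({ffun 'I_t -> 'I_n} * {ffun 'I_t -> G}) * ({set 'I_n} * {set 'I_n}))%type.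
pose ok (k : K) := [&& #|img k.1.1| == t, [forall i, (tau / 2 <= normc (net (k.1.2 i)))%R],
   [disjoint img k.1.1 & k.2.1]%B, (#|k.2.1| <= D)%N & (#|k.2.2| <= D)%N].
pose z (k : K) := spread k.1.1 (fun i => net (k.1.2 i)).
pose E (k : K) : set T := [set w |
    [/\ norm_infty (A w) < R,
     exists2 c : 'I_n -> 'I_n -> C, (forall r i, normc (c r i) <= 1) &
       forall r j, j \in k.2.1 -> entry w r j = \sum_(i in k.2.2) c r i * entry w i j,
     exists2 y : 'I_n -> C, (forall j, normc (y j) <= 1) &
       forall r, normc (\sum_(j in img k.1.1) entry w r j * z k j +
           \sum_(j in k.2.1) entry w r j * y j) <= 3 * R * s &
     (m <= #|[set r | hit X r (img k.1.1) w]%SET|)%N]].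
have tau0 : 0 < tau / 2 by exact: lt_le_trans st.
have h2 : ob X [set: 'I_n * 'I_n]%SET [set w | exists2 k, ok k & E k w]
   (n%:R ^+ t * #|G|%:R ^+ t * N%:R ^+ 2 * p ^+ (m - D)).
  have H k : ok k -> ob X [set: 'I_n * 'I_n]%SET (E k) (p ^+ (m - D)).
    move=> /and5P[/eqP ft /forallP hg dis VD ID].
    apply: (ob_fixed M indep rho01 X0 Xsq m (z := z k) p1 tau0) => //.
    - move=> j; apply: (spreadP (p := fun _ y => is_true (tau / 2 <= normc y))) => i; exact: hg.
    - by rewrite !mulr_gt0.
  have := ob_exists H; apply: ob_sub => //.
  rewrite sumr_const -[leLHS]mulr_natl ler_wpM2r// -!natrX -!natrM ler_nat.
  pose S := [set V : {set 'I_n} | (#|V| <= D)%N]%SET.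
  apply: (@leq_trans #|finset.setX [set: {ffun 'I_t -> 'I_n} * {ffun 'I_t -> G}]%SET (finset.setX S S)|).
    apply: subset_leq_card; apply/fintype.subsetP => -[[f g] [V I0]].
    by rewrite !inE /= => /and5P[_ _ _ -> ->].
  rewrite !cardsX cardsT card_prod !card_ffun !card_ord leq_mul//.
  by rewrite -mulnn leq_mul.
apply: ob_sub (obU h1 h2) => // w [nR [x [U [x1 hx cU Ux xD]]]].
have [f fU] : exists f : {ffun 'I_t -> 'I_n}, img f = U.
  by rewrite -cU; exact: img_enum.
have [few_f|many] := ltnP #|[set r | hit X r (img f) w]%SET| m.
  by left; exists f => //; rewrite fU cU.
right.
have [gam hgam] := choice (fun j => net_near _ (x1 j)).
pose V := ([set j | (s <= normc (x j))%R] :\: U)%SET.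
have VD : (#|V| <= D)%N.
  by apply: leq_trans xD; apply: subset_leq_card; exact: finset.subsetDl.
have [I0 [c [IV c1 hc]]] := column_coefs (A w) V.
exists ((f, [ffun k => gam (f k)]), (V, I0)).
  apply/and5P; split => //=.
  - by rewrite fU cU.
  - apply/forallP => k; rewrite ffunE.
    have kU : f k \in U by rewrite -fU; apply/imsetP; exists k.
    have := Ux _ kU; have := hgam (f k).
    have := ler_distnormc (x (f k)) (net (gam (f k))).
    rewrite (normcB (x _)); lra.
  - rewrite fU -finset.setI_eq0; apply/eqP/setP => j; rewrite !inE.
    by case: (j \in U).
  - exact: leq_trans VD.
split => //=.
- by exists c.
- exists x => // r; rewrite fU.
  set zz := z _.
  have hz j : j \in U -> normc (zz j - x j) <= s.
    rewrite -fU; apply: (spreadP (p := fun j y => is_true (normc (y - x j) <= s))) => k.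
    by rewrite ffunE.
  have split3 : \sum_j entry w r j * x j = \sum_(j in U) entry w r j * x j +
      \sum_(j in V) entry w r j * x j + \sum_(j in ~: (U :|: V)%SET) entry w r j * x j.
    rewrite (bigID (mem U)) /= -addrA; congr (_ + _).
    rewrite (bigID (mem V)) /=; congr (_ + _); apply: eq_bigl => j; rewrite !inE.
      by case: (j \in U); rewrite ?andbF ?andbT.
    by case: (j \in U).
  have -> : \sum_(j in U) entry w r j * zz j + \sum_(j in V) entry w r j * x j =
      \sum_j entry w r j * x j + \sum_(j in U) entry w r j * (zz j - x j) -
      \sum_(j in ~: (U :|: V)%SET) entry w r j * x j.
    have -> : \sum_(j in U) entry w r j * (zz j - x j) =
       \sum_(j in U) entry w r j * zz j - \sum_(j in U) entry w r j * x j.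
      by rewrite -sumrB; apply: eq_bigr => j _; rewrite mulrBr.
    rewrite split3; ring.
  (* Three errors of size R s: A x itself, rounding on [U], and the coordinates below [s]. *)
  have -> : 3 * R * s = R * s + R * s + R * s by ring.
  have Rs : norm_infty (A w) * s <= R * s by rewrite ler_wpM2r// ltW.
  apply: le_trans (le_normcB _ _) _; apply: lerD; last first.
    apply: le_trans Rs; apply: norm_infty_sum; first exact: ltW.
    move=> j; rewrite !inE; case: (j \in U) => //=; rewrite -ltNge; exact: ltW.
  apply: le_trans (le_normcD _ _) _; apply: lerD; first exact: le_trans (hx r) h0R.
  by apply: le_trans Rs; apply: norm_infty_sum => //; exact: ltW.
Qed.

End step.

(** * From spread-out kernel vectors to the singular value *)

Section final.
Context d (T : measurableType d) (F : realType) (P : probability T F) (n : nat)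
  (X : 'I_n * 'I_n -> {RV P >-> F[i]}) (M : 'M[F[i]]_n) (rho : F).
Hypothesis indep : mutually_independent X.
Hypothesis rho01 : 0 <= rho <= 1.
Hypothesis X0 : forall i, P (X i @^-1` [set 0%R]) = (1 - rho)%:E.
Hypothesis Xsq : forall i a h, 0 <= h ->
  (P (X i @^-1` (~` [set 0%R] `&` square a h)) <= (rho * (4 * h ^+ 2 / pi))%:E)%E.

Local Notation C := F[i].
Implicit Types (U V Q : {set 'I_n}) (r : 'I_n) (z a : 'I_n -> C).
Local Notation entry := (entry X M).
Local Notation A w := (M + random_matrix X w).

Lemma miss_le k k' : (k <= k')%N -> miss rho k' <= miss rho k.
Proof.
case/andP: rho01 => r0 r1 kk; rewrite /miss ler_wiXn2l// ?subr_ge0//.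
by rewrite lerBlDr lerDl.
Qed.

(** Either the row vanishes on all large coordinates of [z], or, with the contribution of the small
    ones frozen, the small-ball estimate applies. *)
Lemma ob_row_flat r z (L : nat) (tau h eta : F) :
  0 < tau -> 0 <= h -> 0 < eta -> (L <= #|[set j | (tau <= normc (z j))%R]%SET|)%N ->
  ob X (row_block r [set: 'I_n]%SET) [set w | normc (\sum_j entry w r j * z j) <= h]
   (miss rho L + 4 * ((h + 2 * eta) / tau) ^+ 2 / pi).
Proof.
move=> t0 h0 e0; set U := [set j | _]%SET => LU.
have e20 : 0 < eta / 2 by rewrite divr_gt0.
set p := 4 * _ / _.
have p0 : 0 <= p by rewrite /p divr_ge0 ?pi_ge0// mulr_ge0// sqr_ge0.
pose S (w : T) := \sum_(j in ~: U) entry w r j * z j.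
have sumE w : \sum_j entry w r j * z j = \sum_(j in U) entry w r j * z j + S w.
  rewrite (bigID (mem U)) /=; congr (_ + _); apply: eq_bigl => j.
  by rewrite finset.in_setC.
pose Phi q : set T := [set w | square (grid (eta / 2) q) (eta / 2) (S w)].
pose B q : set T := [set w | hit X r U w /\
  normc (\sum_(j in U) entry w r j * z j - - grid (eta / 2) q) <= h + eta].
have mPhi q : event X (row_block r (~: U)) (Phi q).
  by apply: event_square; apply: cmeas_rowsum => j jU; exact: row_blockP.
have hB q : ob X (row_block r U) (B q) p.
  have tz j : j \in U -> tau <= normc (z j) by rewrite inE.
  have := ob_hit_small M indep rho01 X0 Xsq r (- grid (eta / 2) q) t0 tz (addr_ge0 h0 (ltW e0)) e0.
  apply: ob_sub => //.
  have -> : h + eta + eta = h + 2 * eta by ring.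
  by rewrite -/p ler_piMl// /hitp lerBlDr lerDl miss_ge0.
have dis : [disjoint row_block r (~: U) & row_block r U]%B.
  rewrite -finset.setI_eq0; apply/eqP/setP => -[i j]; rewrite !inE /=.
  by case: (tau <= _); rewrite ?andbF.
have h1 := ob_sub (J' := row_block r [set: 'I_n]%SET) _ (@subset_refl _ _) (lexx _)
   (ob_select indep p0 dis mPhi hB).
have s1 : row_block r (~: U) :|: row_block r U \subset row_block r [set: 'I_n]%SET.
  by apply/fintype.subsetP => -[i j]; rewrite !inE /= => /orP[] /andP[-> _].
have {}h1 := h1 s1.
have s2 : row_block r U \subset row_block r [set: 'I_n]%SET.
  by apply/fintype.subsetP => -[i j]; rewrite !inE /= => /andP[-> _].
have h2 := ob_sub s2 (@subset_refl _ _) (miss_le LU) (ob_miss indep X0 r U).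
apply: ob_sub (obU h2 h1) => // w hw.
have [hitw|] := boolP (hit X r U w); [right|by left].
split; first exact: grid_near.
move=> q /square_normc hq; split => //.
have -> : \sum_(j in U) entry w r j * z j - - grid (eta / 2) q =
    \sum_j entry w r j * z j - (S w - grid (eta / 2) q) by rewrite sumE; ring.
apply: le_trans (le_normcB _ _) _; apply: lerD => //.
by apply: le_trans hq _; rewrite mulrC divfK.
Qed.

(* The last clause says that the rows indexed by [f] of [A q] are controlled by the
   others; it is inherited by the rounded vectors used in [ob_tight]. *)
Definition tight (l : nat) (f : 'I_l -> 'I_n) (L : nat) (tau e R : F) (w : T) : Prop :=
  [/\ norm_infty (A w) < R,
   exists x : 'I_n -> C, [/\ forall j, normc (x j) <= 1,
      (L <= #|[set j | (tau <= normc (x j))%R]%SET|)%N &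
      forall r, r \notin codom f -> \sum_j entry w r j * x j = 0] &
   forall (q : 'I_n -> C) (b eta : F), 0 < b -> 0 <= eta -> (forall j, normc (q j) <= b) ->
      (forall r, r \notin codom f -> normc (\sum_j entry w r j * q j) <= eta) ->
      forall k, normc (\sum_j entry w (f k) j * q j) <= n%:R * (e * b + eta)].

(** The rounded kernel vector is selected using only rows outside [codom f], so the [l] rows in
    [codom f] are independent of it and of each other, and their probabilities multiply. *)
Lemma ob_tight (l : nat) (f : 'I_l -> 'I_n) (L : nat) (tau e R : F) :
  injective f -> 0 < tau <= 1 -> 0 < e -> 0 < R ->
  ob X [set: 'I_n * 'I_n]%SET [set w | tight f L tau e R w]
   ((miss rho L + 4 * n%:R ^+ 2 * e ^+ 2 / tau ^+ 2) ^+ l).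
Proof.
move=> injf /andP[t0 t1] e0 R0.
pose I0 : {set 'I_n} := [set r in codom f]%SET.
(* The rounding error 2 eps is at most tau/20, moving moduli to 19/20 tau and 21/20; R times it is
   at most e/40, the tolerance in [Phi]. *)
pose eps := Num.min (tau / 40) (e / (80 * R)).
have eps0 : 0 < eps by rewrite lt_min !divr_gt0// mulr_gt0.
have eps1 : eps <= tau / 40 by rewrite ge_min lexx.
have eps2 : 80 * R * eps <= e.
  have : eps <= e / (80 * R) by rewrite ge_min lexx orbT.
  by rewrite ler_pdivlMr ?mulr_gt0// mulrC.
pose z (q : {ffun 'I_n -> int * int}) j := grid eps (q j).
pose ok q := (forall j, normc (z q j) <= 21 / 20) /\
  (L <= #|[set j | (19 / 20 * tau <= normc (z q j))%R]%SET|)%N.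
pose Phi q : set T := [set w | ok q] `&`
  [set w | forall r, r \in ~: I0 -> square 0 (e / 40) (\sum_j entry w r j * z q j)].
pose B q : set T := [set w | ok q /\
   forall r, r \in I0 -> normc (\sum_j entry w r j * z q j) <= 11 / 10 * n%:R * e].
pose J := (\bigcup_(r in ~: I0) row_block r [set: 'I_n]%SET)%SET.
pose J' := (\bigcup_(r in I0) row_block r [set: 'I_n]%SET)%SET.
set c := miss rho L + _.
have [r0 r1] := andP rho01.
have c0 : 0 <= c.
  rewrite addr_ge0 ?miss_ge0// divr_ge0 ?exprn_ge0 ?(ltW t0)//.
  by rewrite mulr_ge0 ?exprn_ge0 ?(ltW e0)// mulr_ge0 ?exprn_ge0.
have mPhi q : event X J (Phi q).
  apply: eventI; first exact: event_prop.
  apply: event_forall_fin => r; apply: event_imp => rI; apply: event_square.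
  have -> : (fun w => \sum_j entry w r j * z q j) =
     (fun w => \sum_(j in [set: 'I_n]%SET) entry w r j * z q j).
    by apply: funext => w; apply: eq_bigl => j; rewrite inE.
  apply: cmeas_rowsum => j jU; apply/finset.bigcupP; exists r => //.
  exact: row_blockP.
have cardI : #|I0| = l.
  rewrite cardsE -[RHS]card_ord -(card_codom injf) //.
have hB q : ob X J' (B q) (c ^+ l).
  have [okq|nok] := pselect (ok q); last first.
    by apply: ob_sub (ob_set0 X J') => //; [move=> w []|rewrite exprn_ge0].
  case: (okq) => q1 q2.
  have [n0|n0] := posnP n.
    have l0 : l = 0%N.
      by move: (max_card (mem I0)); rewrite cardI card_ord n0; case: (l).
    by rewrite l0 expr0; exact: ob1.
  have n0' : (0 : F) < n%:R by rewrite ltr0n.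
  have H r : r \in I0 -> ob X (row_block r [set: 'I_n]%SET)
      [set w | normc (\sum_j entry w r j * z q j) <= 11 / 10 * n%:R * e] c.
    move=> _; have t0' : 0 < 19 / 20 * tau by rewrite mulr_gt0// divr_gt0.
    have h0 : 0 <= 11 / 10 * n%:R * e by rewrite !mulr_ge0// ?divr_ge0// ltW.
    have eta0 : 0 < n%:R * e / 40 by rewrite divr_gt0// mulr_gt0.
    apply: ob_sub (ob_row_flat r t0' h0 eta0 q2) => //.
    rewrite lerD2l.
    have -> : 11 / 10 * n%:R * e + 2 * (n%:R * e / 40) = 23 / 20 * (n%:R * e) by field.
    have -> : 23 / 20 * (n%:R * e) / (19 / 20 * tau) = 23 / 19 * (n%:R * e / tau).
      by field; exact: lt0r_neq0.
    rewrite ler_pdivrMr ?pi_gt0//.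
    have -> : 4 * n%:R ^+ 2 * e ^+ 2 / tau ^+ 2 * pi = 4 * pi * (n%:R * e / tau) ^+ 2.
      by field; exact: lt0r_neq0.
    rewrite exprMn mulrA ler_wpM2r ?sqr_ge0//.
    (* All rounding losses combine to (23/19)^2 < 2, which [pi] absorbs. *)
    have := pi_ge2 F; lra.
  have := ob_forall indep (A := I0) (fun k k' => @row_block_disjoint _ [set: 'I_n]%SET k k') H.
  by rewrite prodr_const cardI; apply: ob_sub => // w [].
have dis : [disjoint J & J']%B.
  rewrite /J' -big_enum; apply: disjoint_bigcup => r; rewrite mem_enum => rI.
  rewrite disjoint_sym /J -big_enum; apply: disjoint_bigcup => r'; rewrite mem_enum inE => rI'.
  by apply: row_block_disjoint; apply: contraNneq rI' => <-.
apply: ob_sub (ob_select indep (exprn_ge0 l c0) dis mPhi hB); [exact: finset.subsetT| |by []].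
move=> w [nR [x [x1 xL x0]] hq]; split.
  have [q hqx] := choice (fun j => grid_near (x j) eps0).
  have hqx' j : normc (x j - grid eps (q j)) <= 2 * eps by exact: square_normc.
  exists [ffun j => q j].
  have zE j : z [ffun j => q j] j = grid eps (q j) by rewrite /z ffunE.
  split; first split.
  - move=> j; rewrite zE; have := ler_distnormc (grid eps (q j)) (x j).
    rewrite normcB; have := hqx' j; have := x1 j; lra.
  - apply: leq_trans xL _; apply: subset_leq_card; apply/fintype.subsetP => j; rewrite !inE zE.
    have := ler_distnormc (x j) (grid eps (q j)); have := hqx' j; lra.
  - move=> r; rewrite !inE => rI; apply: normc_square; rewrite subr0.
    have -> : \sum_j entry w r j * z [ffun j => q j] j =
        - \sum_(j in [set: 'I_n]%SET) entry w r j * (x j - grid eps (q j)).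
      transitivity (\sum_j entry w r j * z [ffun j => q j] j - \sum_j entry w r j * x j).
        by rewrite x0// subr0.
      rewrite -sumrB -sumrN; apply: eq_big => j.
        by rewrite inE.
      by move=> _; rewrite zE; ring.
    rewrite normcN.
    apply: le_trans (norm_infty_sum (B := 2 * eps) _ _ _ _) _; first by rewrite mulr_ge0// ltW.
      by move=> j _; exact: hqx'.
    apply: (@le_trans _ _ (R * (2 * eps))).
      by rewrite ler_wpM2r ?mulr_ge0// ltW.
    lra.
move=> q [okq hr]; split => // r; rewrite inE => /codomP[k ->].
case: (okq) => q1 _.
have -> : 11 / 10 * n%:R * e = n%:R * (e * (21 / 20) + e / 20) by field.
have e20 : 0 <= e / 20 by rewrite divr_ge0// ltW.
have b0 : (0 : F) < 21 / 20 by rewrite divr_gt0.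
apply: (hq (z q) _ _ b0 e20 q1) => r' rI'.
have := square_normc (hr r' _); rewrite subr0 !inE => /(_ rI').
by move=> h; apply: le_trans h _; lra.
Qed.

End final.

(** * Deterministic reduction of a small singular value to the bad events *)

Section cover.
Context d (T : measurableType d) (F : realType) (P : probability T F) (n : nat)
  (X : 'I_n * 'I_n -> {RV P >-> F[i]}) (M : 'M[F[i]]_n) (rho : F).
Hypothesis indep : mutually_independent X.
Hypothesis rho01 : 0 <= rho <= 1.
Hypothesis X0 : forall i, P (X i @^-1` [set 0%R]) = (1 - rho)%:E.
Hypothesis Xsq : forall i a h, 0 <= h ->
  (P (X i @^-1` (~` [set 0%R] `&` square a h)) <= (rho * (4 * h ^+ 2 / pi))%:E)%E.

Local Notation C := F[i].
Local Notation entry := (entry X M).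
Local Notation A w := (M + random_matrix X w).

Lemma normalized_kernel (B : 'M[C]_n) r0 : (forall j, B r0 j = 0) ->
  exists x : 'I_n -> C, [/\ forall j, normc (x j) <= 1, exists j, x j = 1 &
    forall r, \sum_j B r j * x j = 0].
Proof.
move=> Br0.
have : \det B^T == 0.
  rewrite det_tr (expand_det_row _ r0) big1// => j _; by rewrite Br0 mul0r.
move=> /det0P[v v0 vB].
have [j0 _ j0max] : exists2 j0, true & forall j, normc (v 0 j) <= normc (v 0 j0).
  have [j vj] : exists j, v 0 j != 0.
    apply/existsP; apply: contra_neqT v0 => /existsPn h; apply/rowP => j.
    by rewrite mxE; apply/eqP; have := h j; rewrite negbK.
  case: (@arg_maxP _ _ _ j xpredT (fun j => normc (v 0 j)) isT) => j0 _ h.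
  by exists j0 => // j'; exact: h.
have vj0 : v 0 j0 != 0.
  apply: contra_neq v0 => e; apply/rowP => j; rewrite mxE; apply/eqP.
  by rewrite -normc_eq0 eq_le normc_ge0 andbT (le_trans (j0max j))// e normc0.
have nv : 0 < normc (v 0 j0) by rewrite lt_def normc_ge0 andbT normc_eq0.
exists (fun j => v 0 j / v 0 j0); split.
- by move=> j; rewrite normcM normcV ler_pdivrMr// mul1r.
- by exists j0; rewrite divff.
- move=> r; have := congr1 (fun Z : 'rV[C]__ => Z 0 r) vB; rewrite !mxE => h.
  transitivity ((\sum_j B r j * v 0 j) / v 0 j0).
    by rewrite mulr_suml; apply: eq_bigr => j _; rewrite mulrA.
  rewrite (_ : \sum_j B r j * v 0 j = 0) ?mul0r// -[RHS]h.
  by apply: eq_bigr => j _; rewrite !mxE mulrC.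
Qed.

Lemma subset_of_card (S : {set 'I_n}) k : (k <= #|S|)%N ->
  exists2 U : {set 'I_n}, U \subset S & #|U| = k.
Proof.
move=> /card_geqP[s [us ss sS]]; exists [set x in s]%SET.
  by apply/fintype.subsetP => x; rewrite inE => /sS.
by rewrite cardsE; move/card_uniqP: us => ->.
Qed.

(** The predecessor in [(t k.+1).-1] makes failure of [thin] mean at least [t k.+1] coordinates
    above the next scale. *)
Lemma thick_chain (w : T) (x : 'I_n -> C) (tau : nat -> F) (t : nat -> nat) (K : nat) (h0 R : F) :
  norm_infty (A w) < R -> (forall j, normc (x j) <= 1) ->
  (forall r, normc (\sum_j entry w r j * x j) <= h0) ->
  (t 0%N <= #|[set j | (tau 0%N <= normc (x j))%R]%SET|)%N ->
  (forall k, (k < K)%N -> ~ thin X M (t k) (t k.+1).-1 (tau k) (tau k.+1) h0 R w) ->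
  (t K <= #|[set j | (tau K <= normc (x j))%R]%SET|)%N.
Proof.
move=> nR x1 hx ht0; elim: K => [//|K IH] hthin.
have {}IH := IH (fun k kK => hthin k (ltnW kK)).
rewrite leqNgt; apply/negP => small.
have [U US cU] := subset_of_card IH.
apply: (hthin K (ltnSn K)); split => //; exists x, U; split => //.
  by move=> j /(fintype.subsetP US); rewrite inE.
by rewrite -ltnS; apply: leq_trans small _; exact: leqSpred.
Qed.

Lemma sigma_cover (m K : nat) (e R : F) (tau : nat -> F) (t : nat -> nat) (w : T) :
  (m < n)%N -> 0 < e -> tau 0%N = 1 -> t 0%N = 1%N ->
  norm_infty (A w) < R -> sigma (n - m) (A w) <= e ->
  (forall k, (k < K)%N -> ~ thin X M (t k) (t k.+1).-1 (tau k) (tau k.+1) (n%:R * e) R w) ->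
  exists2 f : 'I_m.+1 -> 'I_n, injective f & tight X M f (t K) (tau K) e R w.
Proof.
move=> mn e0 tau0 t0 nR sg hthin.
have [f [u [injf u1 uf uA]]] := small_sigma_rows mn e0 sg.
have control (q : 'I_n -> C) (b eta : F) : 0 < b -> 0 <= eta -> (forall j, normc (q j) <= b) ->
      (forall r, r \notin codom f -> normc (\sum_j entry w r j * q j) <= eta) ->
      forall k, normc (\sum_j entry w (f k) j * q j) <= n%:R * (e * b + eta).
  move=> b0 eta0 qb hq k.
  pose y r := \sum_j entry w r j * q j.
  pose qr : 'rV[C]_n := \row_j Num.conj (q j).
  (* This weight balances both terms of [norm2_inner] at n e b, since |u A|^2 <= n e^2 and |q|^2 <=
     n b^2. *)
  have s0 : 0 < e / b by rewrite divr_gt0.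
  have := norm2_inner (u k *m A w) qr s0.
  have -> : (u k *m A w *m (map_mx Num.conj qr^T)) 0 0 = \sum_r u k 0 r * y r.
    rewrite -mulmxA mxE; apply: eq_bigr => r _; congr (_ * _).
    rewrite mxE; apply: eq_bigr => j _; congr (_ * _); rewrite !mxE; exact: conjCK.
  have h1 : norm2 qr <= n%:R * b ^+ 2.
    by apply: norm2_le_max => j; rewrite mxE normc_conj.
  have -> : \sum_r u k 0 r * y r = y (f k) + \sum_(r in ~: [set r in codom f]%SET) u k 0 r * y r.
    rewrite (bigID (mem [set r in codom f]%SET)) /=; congr (_ + _); last first.
      by apply: eq_bigl => r; rewrite !inE.
    rewrite (bigD1 (f k)) /= ?inE ?codom_f//.
    rewrite uf eqxx mul1r big1 ?addr0// => r; rewrite inE => /andP[/codomP[k' ->] fk].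
    rewrite uf; case: eqP => [kk|_]; last by rewrite mul0r.
    by rewrite kk eqxx in fk.
  set S := \sum_(r in _) _ => h2.
  have hS : normc S <= n%:R * eta.
    apply: normc_sum_le => //; first by rewrite -[leqRHS]card_ord max_card.
    move=> r; rewrite !inE => rf; rewrite normcM -[leRHS]mul1r.
    by apply: ler_pM; rewrite ?normc_ge0//; exact: hq.
  have h3 : normc (y (f k) + S) <= n%:R * (e * b).
    apply: le_trans h2 _; rewrite ler_pdivrMr//.
    apply: (@le_trans _ _ ((e / b)^-1 * (n%:R * e ^+ 2) + (e / b) * (n%:R * b ^+ 2))).
      by apply: lerD; rewrite ler_wpM2l ?invr_ge0 ?(ltW s0).
    by rewrite le_eqVlt; apply/orP; left; apply/eqP; field; rewrite !lt0r_neq0.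
  have -> : \sum_j entry w (f k) j * q j = (y (f k) + S) - S by rewrite addrK.
  apply: le_trans (le_normcB _ _) _; rewrite mulrDr; exact: lerD.
(* Zeroing the rows in [codom f] forces a kernel vector; its largest coordinate, scaled to 1, is the
   one coordinate required at scale 0. *)
pose B : 'M[C]_n := \matrix_(r, j) if r \in codom f then 0 else entry w r j.
have [x [x1 [j1 xj1] xB]] : exists x : 'I_n -> C, [/\ forall j, normc (x j) <= 1, exists j, x j = 1 &
    forall r, \sum_j B r j * x j = 0].
  by apply: (@normalized_kernel B (f ord0)) => j; rewrite mxE codom_f.
have x0 r : r \notin codom f -> \sum_j entry w r j * x j = 0.
  move=> rf; rewrite -[RHS](xB r); apply: eq_bigr => j _; by rewrite mxE (negPf rf).
(* With eta = 0 the control also bounds the rows in [codom f], so the whole matrix nearly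
   annihilates [x], as the chain requires. *)
have xs r : normc (\sum_j entry w r j * x j) <= n%:R * e.
  have [/codomP[k ->]|rf] := boolP (r \in codom f).
    have := control x 1 0 ltr01 (lexx 0) x1; rewrite mulr1 addr0; apply => r' /x0 ->.
    by rewrite normc0.
  by rewrite x0// normc0 mulr_ge0// ltW.
exists f => //; split => //; exists x; split => //.
apply: thick_chain xs _ hthin => //.
rewrite t0; apply/card_gt0P; exists j1; by rewrite inE xj1 normc1 tau0.
Qed.

Lemma sigma_prob_le (m K : nat) (e R : F) (tau : nat -> F) (t : nat -> nat) (b : nat -> F) :
  (m < n)%N -> 0 < e -> 0 < R -> tau 0%N = 1 -> t 0%N = 1%N -> 0 < tau K <= 1 ->
  (forall k, (k < K)%N -> ob X [set: 'I_n * 'I_n]%SET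
     [set w | thin X M (t k) (t k.+1).-1 (tau k) (tau k.+1) (n%:R * e) R w] (b k)) ->
  (P [set w | (sigma (n - m) (A w) <= e)%R] <=
   (\sum_(k < K) b k + n%:R ^+ m.+1 *
      (miss rho (t K) + 4 * n%:R ^+ 2 * e ^+ 2 / tau K ^+ 2) ^+ m.+1)%:E +
   P [set w | (R <= norm_infty (A w))%R])%E.
Proof.
move=> mn e0 R0 tau0 t0 tauK hthin.
have nm : (n - m = (n - m).-1.+1)%N by rewrite prednK// subn_gt0.
have n0 : (0 < n)%N by exact: leq_ltn_trans mn.
have mS : measurable [set w | sigma (n - m) (A w) <= e].
  rewrite nm; apply: (@event_measurable _ _ _ _ _ _ _ X [set: 'I_n * 'I_n]%SET).
  by apply: event_sigma_le => //; rewrite -nm leq_subr.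
have mN := measurable_norm_infty X M R.
have h1 := ob_exists (p := xpredT) (fun (k : 'I_K) _ => hthin k (ltn_ord k)).
have h2 := ob_exists (p := [pred f : {ffun 'I_m.+1 -> 'I_n} | injectiveb f])
  (fun f injf => ob_tight M indep rho01 X0 Xsq (t K) (injectiveP _ injf) tauK e0 R0).
have [E [mE hE PE]] := obU h1 h2.
apply: (@le_trans _ _ (P (E `|` [set w | R <= norm_infty (A w)]))).
  apply: le_measure; rewrite ?inE//.
    by apply: measurableU => //; exact: event_measurable mE.
  move=> w /= sw; have [nR|nR] := leP R (norm_infty (A w)); [by right|left].
  apply: hE.
  have [[k hk]|nk] := pselect (exists k : 'I_K,
     thin X M (t k) (t k.+1).-1 (tau k) (tau k.+1) (n%:R * e) R w).
    by left; exists k.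
  right.
  have [|f injf hf] := sigma_cover mn e0 tau0 t0 nR sw (K := K).
    by move=> k kK hk; apply: nk; exists (Ordinal kK).
  exists [ffun k => f k]; first by apply/injectiveP => k k'; rewrite !ffunE => /injf.
  have -> : [ffun k => f k] = f :> ('I_m.+1 -> 'I_n) by apply: funext => k; rewrite ffunE.
  exact: hf.
apply: le_trans (measureU2 _ _ _) _ => //; first exact: event_measurable mE.
rewrite leeD2r//; apply: le_trans PE _; rewrite lee_fin lerD2l.
rewrite sumr_const -[leLHS]mulr_natl ler_wpM2r//.
  rewrite exprn_ge0// addr_ge0 ?miss_ge0// divr_ge0 ?exprn_ge0//; last by case/andP: tauK => /ltW.
  by rewrite mulr_ge0 ?exprn_ge0 ?(ltW e0)// mulr_ge0 ?exprn_ge0.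
rewrite -natrX ler_nat; apply: leq_trans (max_card _) _.
by rewrite card_ffun !card_ord.
Qed.
End cover.

Section counting.
Variable n : nat.

(** Such a set is a word of length [D] over [option 'I_n], padded with [None]. *)
Lemma card_small_sets D :
  (#|[set V : {set 'I_n} | (#|V| <= D)%N]%SET| <= n.+1 ^ D)%N.
Proof.
pose im (f : {ffun 'I_D -> option 'I_n}) : {set 'I_n} := [set j | Some j \in codom f]%SET.
apply: (@leq_trans #|[set im f | f in {ffun 'I_D -> option 'I_n}]%SET|).
  apply: subset_leq_card; apply/fintype.subsetP => V; rewrite inE => VD.
  apply/imsetP; exists [ffun k : 'I_D => nth None (map Some (enum V)) k] => //.
  apply/setP => j; rewrite inE; apply/idP/codomP => [jV|[k]].
    have jD : (index j (enum V) < D)%N.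
      by apply: leq_trans VD; rewrite cardE index_mem mem_enum.
    exists (Ordinal jD); rewrite ffunE /= (nth_map j) ?nth_index ?mem_enum//.
    by rewrite index_mem mem_enum.
  rewrite ffunE; have [kV|kV] := ltnP k (size (enum V)).
    by rewrite (nth_map j)// => -[->]; rewrite -mem_enum mem_nth.
  by rewrite nth_default// size_map.
by apply: leq_trans (leq_imset_card _ _) _; rewrite card_ffun card_option !card_ord.
Qed.

Lemma card_all_sets D : (#|[set V : {set 'I_n} | (#|V| <= D)%N]%SET| <= 2 ^ n)%N.
Proof.
apply: leq_trans (max_card _) _.
by rewrite -cardsT -powersetT card_powerset cardsT card_ord.
Qed.
End counting.

(** * Choice of the scales *)

Section numerics.
Variable F : realType.
Implicit Types (rho a b L l R s p x : F).

Lemma expR1_ge2 : 2 <= expR 1 :> F.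
Proof. by have := expR_ge1Dx (1 : F); lra. Qed.

Lemma expR_pow_le x y k : 0 <= x -> x <= expR y -> x ^+ k <= expR (k%:R * y).
Proof. by move=> x0 xy; rewrite expRM_natl lerXn2r ?nnegrE ?expR_ge0. Qed.

Lemma natr_expR n : (0 < n)%N -> n%:R = expR (ln n%:R) :> F.
Proof. by move=> n0; rewrite lnK// posrE ltr0n. Qed.

(** Each step adds two failure terms; the rate 76/100 leaves a/100 >= 1 to absorb the factor 2. *)
Lemma expR_half a : 100 <= a -> expR (- (76 / 100 * a)) <= expR (- (3 / 4 * a)) / 2.
Proof.
move=> a100; rewrite ler_pdivlMr//.
have -> : - (3 / 4 * a) = - (76 / 100 * a) + a / 100 by field.
rewrite expRD ler_wpM2l ?expR_ge0//; have := expR_ge1Dx (a / 100); lra.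
Qed.

Lemma missE rho t : 0 <= rho <= 1 -> miss rho t <= expR (- (t%:R * rho)).
Proof.
move=> /andP[r0 r1]; rewrite -mulrN; apply: expR_pow_le; first by rewrite subr_ge0.
exact: expR_ge1Dx.
Qed.

Lemma hitp_ge rho t : 0 <= rho <= 1 -> (0 < t)%N -> rho <= hitp rho t.
Proof.
move=> r01 t0; have := miss_le r01 t0; rewrite /hitp {2}/miss expr1; lra.
Qed.

(** 1 - exp(-x) >= x / (1 + x), and 1 + x <= 66. *)
Lemma hitp_ge_lin rho t : 0 <= rho <= 1 -> t%:R * rho <= 65 ->
  t%:R * rho / 66 <= hitp rho t.
Proof.
move=> r01 h; have m := missE t r01; set x := t%:R * rho in h m *.
have x0 : 0 <= x by rewrite mulr_ge0//; case/andP: r01.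
have e : miss rho t <= (1 + x)^-1.
  apply: le_trans m _; rewrite expRN lef_pV2 ?posrE ?expR_gt0 ?ltr_wpDr//.
  exact: expR_ge1Dx.
have : x / 66 <= 1 - (1 + x)^-1.
  have -> : 1 - (1 + x)^-1 = x / (1 + x) by field; rewrite lt0r_neq0// ltr_wpDr.
  by rewrite ler_wpM2l// lef_pV2 ?posrE; lra.
rewrite /hitp; lra.
Qed.

(** Chernoff with tilt 1/16, where 16 <= e^4. Writing h for [hitp rho t], the bound 4m <= n h / 8
    against 15/16 n h leaves 13/16 n h; choosing the set costs at most 66/2000 n h. More than 76/100
    n h remains, and h >= rho. *)
Lemma mid_first n t m rho L : 0 <= rho <= 1 -> (0 < n)%N -> (0 < t)%N -> L = ln n%:R ->
  t%:R * rho <= 65 -> 2000 * L <= n%:R * rho -> m%:R <= n%:R * hitp rho t / 32 ->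
  n%:R ^+ t * (((16^-1) ^+ m)^-1 * (16^-1 * hitp rho t + miss rho t) ^+ n)
    <= expR (- (76 / 100 * (n%:R * rho))).
Proof.
move=> r01 n0 t0 LE tr La hm; have [r0 r1] := andP r01.
set h := hitp rho t in hm *.
have h0 : 0 <= h by exact: hitp_ge0.
have h1 : n%:R * rho <= n%:R * h by rewrite ler_wpM2l// hitp_ge.
have h2 : n%:R * rho * t%:R / 66 <= n%:R * h.
  have -> : n%:R * rho * t%:R / 66 = n%:R * (t%:R * rho / 66) by field.
  by rewrite ler_wpM2l// hitp_ge_lin.
have e1 : n%:R ^+ t = expR (t%:R * L) by rewrite LE expRM_natl lnK// posrE ltr0n.
have e2 : ((16^-1) ^+ m)^-1 <= expR (m%:R * 4) :> F.
  rewrite exprVn invrK; apply: expR_pow_le => //.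
  have -> : 4 = 4%:R * 1 :> F by rewrite mulr1.
  have -> : 16 = 2 ^+ 4 :> F by ring.
  by rewrite expRM_natl lerXn2r ?nnegrE ?expR_ge0// expR1_ge2.
have e3 : (16^-1 * h + miss rho t) ^+ n <= expR (n%:R * - (15 / 16 * h)).
  have -> : 16^-1 * h + miss rho t = 1 + - (15 / 16 * h) by rewrite /h /hitp; field.
  apply: expR_pow_le; last exact: expR_ge1Dx.
  have : h <= 1 by rewrite /h /hitp; have := miss_ge0 r01 t; lra.
  lra.
rewrite e1.
apply: (@le_trans _ _ (expR (t%:R * L) * (expR (m%:R * 4) * expR (n%:R * - (15 / 16 * h))))).
  rewrite ler_wpM2l ?expR_ge0//; apply: ler_pM => //.
  by rewrite exprn_ge0// addr_ge0 ?mulr_ge0 ?miss_ge0.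
rewrite -!expRD ler_expR.
have h3 : 2000 * (t%:R * L) <= n%:R * rho * t%:R.
  have -> : 2000 * (t%:R * L) = 2000 * L * t%:R by ring.
  by rewrite ler_wpM2r.
have tL0 : 0 <= t%:R * L by rewrite mulr_ge0// LE ln_ge0// ler1n.
move: hm h1 h2 h3 tL0.
have -> : n%:R * - (15 / 16 * h) = - (15 / 16 * (n%:R * h)) by ring.
move: (n%:R * h) => Z.
move: (n%:R * rho * t%:R) => aT; move: (t%:R * L) (n%:R * rho) => tL a; lra.
Qed.

Lemma net_pow n (G K t : nat) R s L l : (0 < n)%N -> 0 < R -> 0 < s ->
  L = ln n%:R -> l = ln R -> (n%:R ^+ K * R ^+ K)^-1 <= s -> G%:R <= (7 / s) ^+ 2 ->
  n%:R ^+ t * G%:R ^+ t <= expR (t%:R * (L + 6 + 2 * K%:R * (L + l))).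
Proof.
move=> n0 R0 s0 LE lE hs hG.
have nE : n%:R = expR L by rewrite LE -natr_expR.
have RE : R = expR l by rewrite lE lnK.
rewrite -exprMn; apply: expR_pow_le; first by rewrite mulr_ge0.
rewrite nE -addrA expRD ler_wpM2l ?expR_ge0// expRD.
apply: (le_trans hG); rewrite exprMn; apply: ler_pM; rewrite ?exprn_ge0 ?invr_ge0 ?(ltW s0)//.
  have -> : 6 = 6%:R * 1 :> F by rewrite mulr1.
  rewrite expRM_natl; apply: (@le_trans _ _ (2 ^+ 6)); first by lra.
  by rewrite lerXn2r ?nnegrE ?expR_ge0// expR1_ge2.
have -> : 2 * K%:R * (L + l) = 2%:R * (K%:R * (L + l)) by ring.
rewrite expRM_natl lerXn2r ?nnegrE ?invr_ge0 ?expR_ge0 ?(ltW s0)//.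
rewrite -[leRHS]invrK lef_pV2 ?posrE ?invr_gt0 ?expR_gt0//.
by apply: le_trans hs; rewrite expRM_natl expRD -nE -RE exprMn.
Qed.

(** In units of n rho t, positions and net cost 1 and the two sets 4. The gain is 60000 / (66 * 128)
    > 7, because m - D is at least 1 / (66 * 128) of that unit. *)
Lemma mid_second n (t m D G K : nat) rho R s p L l : 0 <= rho <= 1 -> (2 <= n)%N -> (0 < t)%N ->
  0 < R -> 0 < s -> L = ln n%:R -> l = ln R ->
  (n%:R ^+ K * R ^+ K)^-1 <= s -> G%:R <= (7 / s) ^+ 2 ->
  L + 6 + 2 * K%:R * (L + l) <= n%:R * rho ->
  D%:R * L <= n%:R * rho * t%:R -> 66 * 64 <= L -> 66 * 128 <= n%:R * rho ->
  t%:R * rho <= 65 -> n%:R * hitp rho t / 32 <= m.+1%:R ->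
  0 <= p -> p <= expR (- (60 * 1000)) ->
  n%:R ^+ t * G%:R ^+ t * ((n.+1 ^ D)%N)%:R ^+ 2 * p ^+ (m - D)
    <= expR (- (76 / 100 * (n%:R * rho))).
Proof.
move=> r01 n2 t0 R0 s0 LE lE hs hG hW hD L1 a1 tr hm p0 hp; have [r0 r1] := andP r01.
have n0 : (0 < n)%N by exact: ltn_trans n2.
set a := n%:R * rho in hW hD a1 *.
have a0 : 0 < a by lra.
have t1 : (1 : F) <= t%:R by rewrite ler1n.
have at_ge : a <= a * t%:R by rewrite ler_peMr// ltW.
have h2 : a * t%:R / 66 <= n%:R * hitp rho t.
  have -> : a * t%:R / 66 = n%:R * (t%:R * rho / 66) by rewrite /a; field.
  by rewrite ler_wpM2l// hitp_ge_lin.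
have e1 := net_pow t n0 R0 s0 LE lE hs hG.
have e2 : ((n.+1 ^ D)%N)%:R ^+ 2 <= expR (4 * (D%:R * L)).
  have -> : 4 * (D%:R * L) = 2%:R * (D%:R * (2%:R * L)) by ring.
  rewrite expRM_natl lerXn2r ?nnegrE ?expR_ge0// natrX; apply: expR_pow_le => //.
  rewrite expRM_natl LE -natr_expR// -natrX ler_nat -mulnn.
  by apply: (@leq_trans (n + n)); [rewrite -addn1 leq_add2l|rewrite addnn -mul2n leq_mul2r n2 orbT].
have D1 : D%:R * (66 * 64) <= a * t%:R.
  by apply: le_trans hD; rewrite ler_wpM2l.
have mD : a * t%:R / (66 * 128) <= (m - D)%:R.
  have h3 : m%:R <= (m - D)%:R + D%:R :> F by rewrite -natrD ler_nat addnC -leq_subLR.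
  have h4 : m.+1%:R = m%:R + 1 :> F by rewrite natr1.
  move: hm h3 D1 h2 at_ge a1; rewrite h4.
  move: (a * t%:R) (n%:R * hitp rho t) (m%:R) ((m - D)%:R) (D%:R) => x1 x2 x3 x4 x5; lra.
have e3 : p ^+ (m - D) <= expR ((m - D)%:R * - (60 * 1000)) by exact: expR_pow_le.
apply: (@le_trans _ _ (expR (t%:R * (L + 6 + 2 * K%:R * (L + l))) * expR (4 * (D%:R * L)) *
   expR ((m - D)%:R * - (60 * 1000)))).
  apply: ler_pM; rewrite ?exprn_ge0 ?mulr_ge0 ?exprn_ge0//.
  by apply: ler_pM; rewrite ?exprn_ge0 ?mulr_ge0 ?exprn_ge0.
rewrite -!expRD ler_expR.
have h5 : t%:R * (L + 6 + 2 * K%:R * (L + l)) <= a * t%:R.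
  by rewrite mulrC ler_wpM2r.
move: h5 hD mD at_ge a0; move: (a * t%:R) (D%:R * L) ((m - D)%:R) (t%:R * _) => x1 x2 x3 x4; lra.
Qed.

(** For t rho >= 64 the tilted base is at most 2 exp(-64) <= exp(-63). Since 64 * 15/16 = 60, a rate
    of 3n remains, and choosing the set costs at most n/30. *)
Lemma last_first n t m rho L : 0 <= rho <= 1 -> (0 < n)%N -> L = ln n%:R ->
  64 <= t%:R * rho <= 65 -> 0 < rho -> 2000 * L <= n%:R * rho -> m%:R <= 15 / 16 * n%:R :> F ->
  n%:R ^+ t * (((expR (- 64) : F) ^+ m)^-1 * (expR (- 64) * hitp rho t + miss rho t) ^+ n)
    <= expR (- (76 / 100 * (n%:R * rho))).
Proof.
move=> r01 n0 LE /andP[tr1 tr2] rp La hm; have [r0 r1] := andP r01.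
set h := hitp rho t.
have h0 : 0 <= h by exact: hitp_ge0.
have h1 : h <= 1 by rewrite /h /hitp; have := miss_ge0 r01 t; lra.
have e1 : n%:R ^+ t = expR (t%:R * L) by rewrite LE expRM_natl lnK// posrE ltr0n.
have e2 : (expR (- 64) ^+ m)^-1 = expR (m%:R * 64) :> F.
  by rewrite -exprVn -expRN opprK expRM_natl.
have e3 : (expR (- 64) * h + miss rho t) ^+ n <= expR (n%:R * (1 + - 64)).
  apply: expR_pow_le; first by rewrite addr_ge0 ?mulr_ge0 ?expR_ge0 ?miss_ge0.
  have : expR (- 64) * h <= expR (- 64) by rewrite ler_piMr ?expR_ge0.
  have : miss rho t <= expR (- 64).
    by apply: le_trans (missE t r01) _; rewrite ler_expR lerN2.
  have : 2 * expR (- 64) <= expR 1 * expR (- 64) :> F.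
    by rewrite ler_wpM2r ?expR_ge0// expR1_ge2.
  rewrite expRD; lra.
rewrite e1 e2.
apply: (@le_trans _ _ (expR (t%:R * L) * (expR (m%:R * 64) * expR (n%:R * (1 + - 64))))).
  by rewrite ler_wpM2l ?expR_ge0// ler_wpM2l ?expR_ge0.
rewrite -!expRD ler_expR.
have tL : 30 * (t%:R * L) <= n%:R.
  have h3 : 2000 * L * (t%:R * rho) <= n%:R * rho * (t%:R * rho) by rewrite ler_wpM2r// mulr_ge0.
  have h4 : n%:R * rho * (t%:R * rho) <= n%:R * rho * 65 by rewrite ler_wpM2l// mulr_ge0.
  have h5 : rho * (2000 * (t%:R * L)) <= rho * (65 * n%:R).
    have -> : rho * (2000 * (t%:R * L)) = 2000 * L * (t%:R * rho) by ring.
    have -> : rho * (65 * n%:R) = n%:R * rho * 65 by ring.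
    exact: le_trans h4.
  move: h5 (ler0n F n); rewrite ler_pM2l//; move: (t%:R * L) (n%:R) => x1 x2; lra.
have nr : n%:R * rho <= n%:R by rewrite ler_piMr.
have n1 : 0 <= n%:R :> F by [].
move: tL nr hm n1; move: (t%:R * L) (n%:R * rho) (n%:R) (m%:R) => x1 x2 x3 x4; lra.
Qed.

(** Positions and net cost at most n, the two sets 2n. As m - D >= n/8, the gain is at least 48 n /
    8 = 6n. *)
Lemma last_second n (t m D G K : nat) rho R s p L l : 0 <= rho <= 1 -> 0 < rho -> (16 <= n)%N ->
  0 < R -> 0 < s -> L = ln n%:R -> l = ln R ->
  (n%:R ^+ K * R ^+ K)^-1 <= s -> G%:R <= (7 / s) ^+ 2 ->
  65 * (L + 6 + 2 * K%:R * (L + l)) <= n%:R * rho ->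
  D%:R <= 3 / 4 * n%:R :> F ->
  t%:R * rho <= 65 -> 15 / 16 * n%:R <= m.+1%:R :> F ->
  0 <= p -> p <= expR (- 48) ->
  n%:R ^+ t * G%:R ^+ t * ((2 ^ n)%N)%:R ^+ 2 * p ^+ (m - D)
    <= expR (- (76 / 100 * (n%:R * rho))).
Proof.
move=> r01 rp n16 R0 s0 LE lE hs hG hW hD tr hm p0 hp; have [r0 r1] := andP r01.
have n0 : (0 < n)%N by exact: leq_trans n16.
have n16' : 16 <= n%:R :> F by rewrite ler_nat.
have e1 := net_pow t n0 R0 s0 LE lE hs hG.
have e2 : ((2 ^ n)%N)%:R ^+ 2 <= expR (2 * n%:R) :> F.
  have -> : 2 * n%:R = 2%:R * (n%:R * 1) :> F by ring.
  rewrite expRM_natl lerXn2r ?nnegrE ?expR_ge0// natrX; apply: expR_pow_le => //.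
  exact: expR1_ge2.
have mD : n%:R / 8 <= (m - D)%:R :> F.
  have h3 : m%:R <= (m - D)%:R + D%:R :> F by rewrite -natrD ler_nat addnC -leq_subLR.
  have h4 : m.+1%:R = m%:R + 1 :> F by rewrite natr1.
  move: hm h3 hD n16'; rewrite h4.
  move: (n%:R) (m%:R) ((m - D)%:R) (D%:R) => x2 x3 x4 x5; lra.
have e3 : p ^+ (m - D) <= expR ((m - D)%:R * - 48) by exact: expR_pow_le.
set W := L + 6 + _ in hW e1.
apply: (@le_trans _ _ (expR (t%:R * W) * expR (2 * n%:R) * expR ((m - D)%:R * - 48))).
  apply: ler_pM; rewrite ?exprn_ge0 ?mulr_ge0 ?exprn_ge0//.
  by apply: ler_pM; rewrite ?exprn_ge0 ?mulr_ge0 ?exprn_ge0.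
rewrite -!expRD ler_expR.
have tW : t%:R * W <= n%:R.
  have h3 : 65 * W * (t%:R * rho) <= n%:R * rho * (t%:R * rho) by rewrite ler_wpM2r// mulr_ge0.
  have h4 : n%:R * rho * (t%:R * rho) <= n%:R * rho * 65 by rewrite ler_wpM2l// mulr_ge0.
  have h5 : rho * (65 * (t%:R * W)) <= rho * (65 * n%:R).
    have -> : rho * (65 * (t%:R * W)) = 65 * W * (t%:R * rho) by ring.
    have -> : rho * (65 * n%:R) = n%:R * rho * 65 by ring.
    exact: le_trans h4.
  move: h5; rewrite ler_pM2l//; move: (t%:R * W) (n%:R) => x1 x2; lra.
have nr : n%:R * rho <= n%:R by rewrite ler_piMr.
move: tW nr mD n16'; move: (t%:R * W) (n%:R * rho) (n%:R) ((m - D)%:R) => x1 x2 x3 x4; lra.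
Qed.

End numerics.

Lemma pred_facts K : (3 <= K)%N ->
  [/\ (K.-1 == 0%N) = false, (K.-1 == K) = false, (2 * K.-1 + 2 = 2 * K)%N,
      (1%N == K) = false & K.-1.+1 = K].
Proof. by move=> h; split; lia. Qed.

(** * Sizes and scales along the chain, and the final assembly *)

Section schedule.
Variables (F : realType) (n K : nat) (R rho : F).

(* On the last step, where [D] is of order [n], the scale has to drop by an
   additional constant factor [slack]; it is saved on the first step, so that
   [tau K] is exactly [(n R)^-K]. *)
Definition slack : F := 20 * expR 24.
(** The inverse of the small-ball probability needed at every step but the last. *)
Definition big : F := expR (60 * 1000).
Definition large : F := 40 * 40 * (slack * big) + 66 * 64.

Local Notation L := (ln (n%:R : F)).
Local Notation l := (ln R).
Local Notation a := (n%:R * rho).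
(** The cube root of n rho. Sizes grow by b^2 per step; the remaining factor, b >= log n log R, pays
    for naming sets of coordinates. *)
Let b : F := expR (ln a / 3).

Hypothesis Llarge : large <= L.
Hypothesis R4 : 4 <= R.
Hypothesis rho_bounds : ln R ^+ 3 * ln n%:R ^+ 3 / n%:R <= rho <= Num.sqrt n%:R / n%:R.
Hypothesis KE : K%:Z = Num.ceil (3 * ln n%:R / (2 * ln (n%:R * rho))).
Lemma slack_ge1 : 1 <= slack.
Proof. by rewrite /slack; have := expR_ge1Dx (24 : F); lra. Qed.

Lemma big_ge1 : 1 <= big.
Proof. by rewrite -[leLHS]expR0 ler_expR mulr_ge0 ?ler0n. Qed.

Lemma L_ge : 66 * 64 <= L /\ 40 * 40 * (slack * big) <= L.
Proof.
have h : 0 <= slack * big by rewrite mulr_ge0 ?expR_ge0//; have := slack_ge1; lra.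
move: Llarge; rewrite /large; move: (slack * big) h => y; lra.
Qed.

Lemma n_gt0 : (0 < n)%N.
Proof.
rewrite -(ltr0n F) ltNge; apply/negP => h; have [+ _] := L_ge.
by rewrite (ln0 h) leNgt mulr_gt0.
Qed.

Let n0F : (0 : F) < n%:R. Proof. by rewrite ltr0n n_gt0. Qed.

Lemma L_le_n : L <= n%:R.
Proof. by apply: ltW; exact: ln_sublinear. Qed.

Lemma expR1_le4 : expR 1 <= 4 :> F.
Proof.
have h : expR 2^-1 <= 2 :> F.
  rewrite -[leRHS]invrK -[leLHS]invrK -expRN lef_pV2 ?posrE ?expR_gt0 ?invr_gt0//.
  by have := expR_ge1Dx (- 2^-1 : F); lra.
have -> : expR 1 = expR 2^-1 ^+ 2 :> F by rewrite -expRM_natl divff.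
have -> : 4 = 2 ^+ 2 :> F by ring.
by rewrite lerXn2r ?nnegrE ?expR_ge0.
Qed.

Lemma l_ge1 : 1 <= l.
Proof.
have R0 : 0 < R by have := R4; lra.
rewrite -ler_expR lnK ?posrE//.
apply: le_trans R4.
exact: expR1_le4.
Qed.

Lemma a_ge : l ^+ 3 * L ^+ 3 <= a.
Proof. by case/andP: rho_bounds => h _; move: h; rewrite ler_pdivrMr// [rho * _]mulrC. Qed.

Lemma a_le_sqrt : a <= Num.sqrt n%:R.
Proof. by case/andP: rho_bounds => _ h; move: h; rewrite ler_pdivlMr// [rho * _]mulrC. Qed.

Let L4 : 66 * 64 <= L. Proof. by have [] := L_ge. Qed.
Let L1 : 1 <= L. Proof. by have := L4; lra. Qed.

Lemma n_ge16 : (16 <= n)%N.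
Proof. by rewrite -(ler_nat F); have := L_le_n; have := L4; lra. Qed.

Lemma a_ge_L : 4000 * L <= a /\ L <= a.
Proof.
have h : L ^+ 3 <= a.
  apply: le_trans a_ge; rewrite ler_peMl ?exprn_ge0//; last by rewrite exprn_ege1// l_ge1.
  by have := L1; lra.
have h2 : 4000 * L <= L ^+ 3.
  have -> : L ^+ 3 = L ^+ 2 * L by ring.
  rewrite ler_wpM2r//; first by have := L1; lra.
  rewrite expr2; apply: (@le_trans _ _ (L * 1)); first by have := L4; lra.
  by rewrite ler_wpM2l//; have := L1; lra.
split; [exact: le_trans h|]; have := L1; move: h h2; move: (L ^+ 3) L (a) => x y z; lra.
Qed.

Let a_gt0 : 0 < a. Proof. by have [_] := a_ge_L; have := L1; lra. Qed.

Lemma rho_gt0 : 0 < rho.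
Proof. by rewrite -(pmulr_rgt0 _ n0F). Qed.

Lemma rho_in01 : 0 <= rho <= 1.
Proof.
rewrite (ltW rho_gt0) /= -(ler_pM2l n0F) mulr1; apply: le_trans a_le_sqrt _.
have n1 : 1 <= n%:R :> F by rewrite ler1n n_gt0.
rewrite -[leRHS]ger0_norm// -sqrtr_sqr ler_wsqrtr// expr2 ler_peMl//.
Qed.

Lemma b_cube : b ^+ 3 = a.
Proof.
rewrite /b -expRM_natl; have -> : 3%:R * (ln a / 3) = ln a by rewrite mulrC divfK.
by rewrite lnK.
Qed.

Lemma b_ge : l * L <= b.
Proof.
rewrite -(@ler_pXn2r _ 3)// ?nnegrE ?expR_ge0//.
  by rewrite exprMn b_cube a_ge.
by rewrite mulr_ge0//; [have := l_ge1|have := L1]; lra.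
Qed.

Let bL : L <= b.
Proof.
apply: le_trans b_ge; rewrite ler_peMl ?l_ge1//; have := L1; lra.
Qed.

Lemma ln_a_ge3 : 3 <= ln a.
Proof.
rewrite -ler_expR lnK//.
have -> : 3 = 3%:R * 1 :> F by rewrite mulr1.
rewrite expRM_natl -b_cube lerXn2r ?nnegrE ?expR_ge0//.
by have := expR1_le4; have := bL; have := L4; lra.
Qed.

Lemma ln_a_le : 2 * ln a <= L.
Proof.
have -> : 2 * ln a = ln (a ^+ 2) by rewrite lnXn// mulr_natl.
rewrite ler_ln ?posrE ?exprn_gt0//.
rewrite -[leRHS]sqr_sqrtr// lerXn2r ?nnegrE ?sqrtr_ge0 ?(ltW a_gt0)//.
exact: a_le_sqrt.
Qed.

(** The upper bound on [rho] means 2 ln a <= L, whence K >= 3, so first and last step are separated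
    by a middle one. The last clause says b^(2K) >= n. *)
Lemma K_bounds : [/\ (3 <= K)%N, K%:R <= L & L <= 2 * K%:R / 3 * ln a].
Proof.
pose x := 3 * L / (2 * ln a).
have KE' : K%:Z = Num.ceil x := KE.
have la3 := ln_a_ge3.
have la0 : 0 < 2 * ln a by rewrite mulr_gt0//; lra.
have /andP[h1 h2] := real_ceil_itv (num_real x); rewrite -KE' in h1 h2.
have x3 : 3 <= x by rewrite ler_pdivlMr// ler_wpM2l// ln_a_le.
have xL : x <= L / 2.
  rewrite ler_pdivrMr//.
  have -> : L / 2 * (2 * ln a) = L * ln a by field.
  by rewrite mulrC ler_wpM2l//; have := L1; lra.
split.
- by rewrite -(ler_nat F); exact: le_trans h2.
- by move: h1; rewrite intrB mulr1z; have := L4; move: xL; rewrite -pmulrn; lra.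
- have : x * (2 * ln a) <= K%:R * (2 * ln a) by rewrite ler_wpM2r// ltW.
  rewrite /x divfK ?lt0r_neq0//; lra.
Qed.

Lemma b_pow_ge : n%:R <= b ^+ (2 * K).
Proof.
rewrite /b -expRM_natl -[leLHS]lnK ?posrE// ler_expR.
have [_ _ h] := K_bounds.
have -> : (2 * K)%:R * (ln a / 3) = 2 * K%:R / 3 * ln a by rewrite natrM; field.
exact: h.
Qed.

(** As K <= L, the entropy is O(L^2 l), while n rho >= l^3 L^3 has a spare factor [L]. The 65 is the
    bound on t rho at the last step. *)
Lemma W_le : 65 * (L + 6 + 2 * K%:R * (L + l)) <= a.
Proof.
have [_ KL _] := K_bounds; have l1 := l_ge1.
have h : L ^+ 2 * l * L <= a.
  apply: le_trans a_ge.
  have -> : L ^+ 2 * l * L = l * L ^+ 3 by ring.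
  rewrite ler_wpM2r ?exprn_ge0//; first by have := L1; lra.
  by rewrite -[leLHS]mulr1 exprS ler_wpM2l ?exprn_ege1//; lra.
set Y := L ^+ 2 * l in h.
have LY : L <= Y.
  rewrite /Y expr2 -mulrA ler_peMr//; first by have := L1; lra.
  by rewrite mulr_ege1 ?L1.
have lY : L * l <= Y.
  by rewrite /Y expr2 -mulrA ler_peMl ?L1// mulr_ge0//; have := L1; lra.
have L2Y : L * L <= Y by rewrite /Y expr2 ler_peMr// mulr_ge0//; have := L1; lra.
have h2 : 2 * K%:R * (L + l) <= 4 * Y.
  apply: (@le_trans _ _ (2 * L * (L + l))).
    by rewrite ler_wpM2r ?ler_wpM2l// addr_ge0//; have := L1; lra.
  have -> : 2 * L * (L + l) = 2 * (L * L) + 2 * (L * l) by ring.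
  move: lY L2Y; move: (L * l) (L * L) (Y) => y1 y2 y3; lra.
have h3 : 66 * 64 * Y <= a.
  apply: le_trans h; rewrite mulrC ler_wpM2l//; have := L1; lra.
move: h2 h3 LY L1; move: (2 * K%:R * (L + l)) (Y) => y1 y2; lra.
Qed.

(** About 64/rho coordinates: a row misses them with probability at most exp(-64). Sizes are capped
    here until the last step, which jumps directly beyond 3n/4. *)
Definition tstar : nat := (Num.trunc (64 / rho)).+1.

Definition tsize (k : nat) : nat :=
  if k == 0%N then 1%N else if k == K then (3 * n %/ 4).+1
  else minn (Num.trunc (b ^+ (2 * k))).+1 tstar.

Lemma tstar_bounds : 64 <= tstar%:R * rho <= 65 /\ tstar.-1%:R * rho <= 64.
Proof.
have r0 := rho_gt0; have /andP[_ r1] := rho_in01.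
have h0 : 0 <= 64 / rho by rewrite divr_ge0// ltW.
have /andP[h1 h2] := truncn_itv h0.
have h3 : tstar.-1%:R * rho <= 64 by rewrite -ler_pdivlMr.
split => //; apply/andP; split; first by rewrite -ler_pdivrMr// ltW.
have -> : tstar%:R * rho = tstar.-1%:R * rho + rho by rewrite /tstar -natr1 mulrDl mul1r.
lra.
Qed.

Lemma tsize_le k : (k < K)%N -> (tsize k <= tstar)%N.
Proof.
move=> kK; rewrite /tsize; case: eqP => // _; rewrite (ltn_eqF kK).
exact: geq_minr.
Qed.

Lemma tsize_gt0 k : (0 < tsize k)%N.
Proof. by rewrite /tsize; case: ifP => // _; case: ifP => // _; rewrite leq_min. Qed.

(** Of b^3 = n rho, b^2 covers the growth and b covers [L]. The predecessor undoes the successor of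
    the truncation, which matters at k = 0, where D <= b^2 is needed with size 1. *)
Lemma tsize_step k : (k.+1 < K)%N ->
  (tsize k.+1).-1%:R * L <= a * (tsize k)%:R /\ (tsize k.+1).-1%:R * rho <= 64.
Proof.
move=> kK; have b1 : 1 <= b by have := bL; have := L1; lra.
have [tb1 tb2] := tstar_bounds.
have tk1 : tsize k.+1 = minn (Num.trunc (b ^+ (2 * k.+1))).+1 tstar.
  by rewrite /tsize /= (ltn_eqF kK).
have D1 : (tsize k.+1).-1%:R <= b ^+ (2 * k.+1).
  apply: (@le_trans _ _ (Num.trunc (b ^+ (2 * k.+1)))%:R).
    by rewrite ler_nat tk1 -subn1 leq_subLR add1n geq_minl.
  by rewrite truncn_le exprn_ge0// expR_ge0.
have D2 : (tsize k.+1).-1%:R <= tstar.-1%:R :> F.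
  by rewrite ler_nat tk1 -!subn1 leq_sub2r// geq_minr.
split; last by apply: le_trans tb2; rewrite ler_wpM2r// ltW// rho_gt0.
rewrite -b_cube.
have -> : b ^+ 3 * (tsize k)%:R = (b ^+ 2 * (tsize k)%:R) * b by ring.
apply: ler_pM => //; first by have := L1; lra.
have [k0|k0] := eqVneq k 0%N.
  by move: D1; rewrite k0 /tsize /= muln1 mulr1.
have -> : tsize k = minn (Num.trunc (b ^+ (2 * k))).+1 tstar.
  by rewrite /tsize (negPf k0) (ltn_eqF (ltnW kK)).
have [h|h] := leqP (Num.trunc (b ^+ (2 * k))).+1 tstar.
  apply: le_trans D1 _; rewrite mulnS exprD ler_wpM2l ?exprn_ge0 ?expR_ge0//.
  by apply: ltW; exact: truncnS_gt.
apply: le_trans D2 _; apply: (@le_trans _ _ tstar%:R); first by rewrite ler_nat leq_pred.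
by rewrite ler_peMl// exprn_ege1.
Qed.

(** The cap is reached in time: b^(2K) >= n and n rho = b^3 >= 64 b^2 give b^(2(K-1)) >= 64/rho. *)
Lemma tsize_last : tsize K.-1 = tstar.
Proof.
have [K3 _ _] := K_bounds; have [e1 e2 e3 _ _] := pred_facts K3.
have -> : tsize K.-1 = minn (Num.trunc (b ^+ (2 * K.-1))).+1 tstar.
  by rewrite /tsize e1 e2.
apply/minn_idPr; rewrite ltnS; apply: le_truncn.
rewrite ler_pdivrMr ?rho_gt0//.
have b0 : 0 < b by exact: expR_gt0.
rewrite -(ler_pM2r (exprn_gt0 2 b0)).
have -> : b ^+ (2 * K.-1) * rho * b ^+ 2 = b ^+ (2 * K) * rho.
  by rewrite mulrAC -exprD e3.
apply: (@le_trans _ _ (n%:R * rho)); last by rewrite ler_wpM2r ?b_pow_ge// ltW// rho_gt0.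
rewrite -b_cube [leRHS]exprS ler_wpM2r ?exprn_ge0 ?(ltW b0)//.
by have := bL; have := L4; lra.
Qed.

Definition scale (k : nat) : F := (n%:R ^+ k * R ^+ k)^-1.

Definition tau (k : nat) : F :=
  if k == 0%N then 1 else if k == K then scale k else slack * scale k.

Definition ratio (k : nat) : F :=
  if k == 0%N then slack else if k.+1 == K then slack^-1 else 1.

Let R0 : 0 < R. Proof. have := R4; lra. Qed.
Let slack0 : 0 < slack. Proof. by have := slack_ge1; lra. Qed.
Let nR0 : 0 < n%:R * R. Proof. by rewrite mulr_gt0. Qed.

Lemma scale_gt0 k : 0 < scale k.
Proof. by rewrite invr_gt0 mulr_gt0// exprn_gt0. Qed.

Lemma scaleS k : scale k.+1 = scale k / (n%:R * R).
Proof. by rewrite /scale -!exprMn exprSr invfM. Qed.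

Lemma tau_gt0 k : 0 < tau k.
Proof. by rewrite /tau; case: ifP => // _; case: ifP => _; rewrite ?mulr_gt0 ?scale_gt0. Qed.

Lemma tau_step k : (k < K)%N -> tau k.+1 = tau k * (ratio k / (n%:R * R)).
Proof.
have [K3 _ _] := K_bounds.
move=> kK; rewrite /tau /ratio /= (ltn_eqF kK).
have [->|k0] := eqVneq k 0%N.
  have [_ _ _ -> _] := pred_facts K3.
  by rewrite scaleS /scale !expr0 !mulr1 invr1 !mul1r.
case: ifP => _; rewrite scaleS; last by rewrite !mul1r mulrA.
by field; rewrite !lt0r_neq0.
Qed.

Lemma ratio_gt0 k : 0 < ratio k.
Proof. by rewrite /ratio; case: ifP => // _; case: ifP => _; rewrite ?invr_gt0. Qed.

Lemma ratio_le k : ratio k <= slack.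
Proof.
rewrite /ratio; case: ifP => // _; have c1 := slack_ge1; case: ifP => // _.
by apply: le_trans c1; rewrite invf_le1 ?slack_ge1.
Qed.

Lemma slack_small : 40 * 40 * (slack * big) <= a /\ 2 * slack <= n%:R * R.
Proof.
have [_ h] := L_ge; have [_ h2] := a_ge_L; have h3 := L_le_n.
split; first exact: le_trans h2.
apply: (@le_trans _ _ n%:R); last by rewrite ler_peMr//; have := R4; lra.
apply: le_trans h3; apply: le_trans h.
have h4 : slack * 1 <= slack * big by rewrite ler_wpM2l ?big_ge1// ltW.
have := slack0; move: h4; rewrite mulr1; move: (slack * big) => E; lra.
Qed.

Lemma tau_half k : (k < K)%N -> tau k.+1 <= tau k / 2.
Proof.
move=> kK; rewrite tau_step// ler_wpM2l ?(ltW (tau_gt0 k))//.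
rewrite ler_pdivrMr//; have [_ h] := slack_small; have := ratio_le k; lra.
Qed.

Lemma tau_le1 k : (k <= K)%N -> tau k <= 1.
Proof.
elim: k => [_|k IH kK]; first by rewrite /tau.
apply: le_trans (tau_half kK) _; have := IH (ltnW kK); have := tau_gt0 k; lra.
Qed.

Lemma tau_ge k : (k <= K)%N -> scale K <= tau k.
Proof.
have mono j : (j <= K)%N -> scale K <= scale j.
  move=> jK; rewrite /scale -!exprMn lef_pV2 ?posrE ?exprn_gt0//.
  apply: ler_weXn2l => //; have [_ h] := slack_small; have := slack_ge1; lra.
move=> kK; rewrite /tau; case: eqP => [_|_].
  by have := mono 0%N isT; rewrite {2}/scale !expr0 mulr1 invr1.
case: eqP => [->//|_]; apply: le_trans (mono k kK) _.
by rewrite ler_peMl ?slack_ge1// ltW// scale_gt0.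
Qed.

(** [R] cancels against the drop n R between scales; 4/pi <= 2. *)
Lemma step_p k (D : F) : (k < K)%N -> 0 <= D ->
  4 * ((3 * R * tau k.+1 * (2 * D + 4)) / (tau k / 2)) ^+ 2 / pi <=
    2 * (12 * ratio k * (D + 2) / n%:R) ^+ 2.
Proof.
move=> kK D0; have -> : (3 * R * tau k.+1 * (2 * D + 4)) / (tau k / 2) =
    12 * ratio k * (D + 2) / n%:R.
  by rewrite tau_step//; field; rewrite !lt0r_neq0// tau_gt0.
set y := _ ^+ 2; have y0 : 0 <= y by exact: sqr_ge0.
rewrite ler_pdivrMr ?pi_gt0//.
have : 2 * y * 2 <= 2 * y * pi.
  by apply: ler_wpM2l; [rewrite mulr_ge0|exact: pi_ge2].
lra.
Qed.

Lemma double_half (x y : F) : x <= y / 2 -> x + x <= y.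
Proof. lra. Qed.

Lemma two_sqr_le (y c : F) : 0 <= y -> 2 * y <= c -> c <= 1 -> 2 * y ^+ 2 <= c.
Proof. by move=> y0 yc c1; rewrite expr2; nra. Qed.

(** Here D rho <= 64, so (D + 2)/n <= 66/(n rho). The 40 * 40 in [large] dominates 2 * 12 * 66 =
    1584. *)
Lemma mid_p k : (k.+1 < K)%N ->
  4 * ((3 * R * tau k.+1 * (2 * (tsize k.+1).-1%:R + 4)) / (tau k / 2)) ^+ 2 / pi <=
    expR (- (60 * 1000)).
Proof.
move=> kK; have [_ hD] := tsize_step kK.
apply: le_trans (step_p (ltnW kK) (ler0n _ _)) _.
set D := (tsize k.+1).-1%:R in hD *; have D0 : 0 <= D by exact: ler0n.
have [hc _] := slack_small; have rc := ratio_le k; have r0 := ratio_gt0 k.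
rewrite expRN -/big; have bg := big_ge1; have bg0 : 0 < big by lra.
apply: two_sqr_le.
- by rewrite divr_ge0// mulr_ge0 ?addr_ge0// mulr_ge0// ltW.
- rewrite -[leRHS]mul1r ler_pdivlMr// mulrA mulrAC ler_pdivrMr// mul1r.
  have h1 : (D + 2) * rho <= 66 by have /andP[_ r1] := rho_in01; lra.
  have rp := rho_gt0.
  rewrite -(ler_pM2r rp); apply: le_trans hc.
  have -> : 2 * (12 * ratio k * (D + 2)) * big * rho = 24 * ((ratio k * big) * ((D + 2) * rho)) by ring.
  have h2 : (ratio k * big) * ((D + 2) * rho) <= (slack * big) * 66.
    apply: ler_pM => //.
    - by rewrite mulr_ge0 ?(ltW r0) ?(ltW bg0).
    - by rewrite mulr_ge0 ?addr_ge0 ?(ltW rp).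
    - by rewrite ler_wpM2r ?(ltW bg0).
  have h3 : 0 <= slack * big by rewrite mulr_ge0// ltW.
  move: h2 h3; move: (slack * big) (ratio k * big * _) => y z; lra.
- by rewrite invf_le1.
Qed.

Lemma three_quarters : ((3 * n %/ 4)%N)%:R <= 3 / 4 * n%:R :> F.
Proof.
have : ((3 * n %/ 4 * 4)%N)%:R <= (3 * n)%:R :> F by rewrite ler_nat leq_trunc_div.
rewrite !natrM; lra.
Qed.

(** D/n is no longer small, so the whole gain is the factor [slack]: 2 * (12/20)^2 = 18/25 < 1. *)
Lemma last_p : 4 * ((3 * R * tau K * (2 * (tsize K).-1%:R + 4)) / (tau K.-1 / 2)) ^+ 2 / pi <=
    expR (- 48).
Proof.
have [K3 _ _] := K_bounds; have [e1 e2 _ _ e5] := pred_facts K3.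
have kK : (K.-1 < K)%N by rewrite -{2}e5.
have := step_p kK (ler0n _ (tsize K).-1); rewrite e5; move/le_trans; apply.
have -> : (tsize K).-1 = (3 * n %/ 4)%N.
  by rewrite /tsize eqxx; case: eqP => // K0; rewrite K0 in K3.
have -> : ratio K.-1 = slack^-1 by rewrite /ratio e1 e5 eqxx.
have n16 : 16 <= n%:R :> F by have := L_le_n; have := L4; lra.
have hD := three_quarters.
set D := (3 * n %/ 4)%:R in hD *; have D0 : 0 <= D by exact: ler0n.
have h : 12 * slack^-1 * (D + 2) / n%:R <= 12 / slack.
  rewrite ler_pdivrMr// ler_wpM2l ?mulr_ge0 ?invr_ge0 ?(ltW slack0)//; lra.
apply: (@le_trans _ _ (2 * (12 / slack) ^+ 2)).
  rewrite ler_wpM2l// lerXn2r ?nnegrE ?divr_ge0 ?mulr_ge0 ?invr_ge0 ?addr_ge0 ?(ltW slack0)//.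
have e24 : 0 < expR 24 :> F by exact: expR_gt0.
have -> : expR (- 48) = (expR 24)^-1 ^+ 2 :> F.
  by rewrite -expRN -expRM_natl; congr expR; ring.
rewrite /slack; have -> : 2 * (12 / (20 * expR 24)) ^+ 2 = 18 / 25 * (expR 24)^-1 ^+ 2 :> F.
  by field; exact: lt0r_neq0.
by rewrite ler_piMl ?sqr_ge0// ler_pdivrMr ?ltr0n// mul1r ler_nat.
Qed.

Section prob.
Context d (T : measurableType d) (P : probability T F)
  (X : 'I_n * 'I_n -> {RV P >-> F[i]}) (M : 'M[F[i]]_n) (e : F).
Hypothesis indep : mutually_independent X.
Hypothesis X0 : forall i, P (X i @^-1` [set 0%R]) = (1 - rho)%:E.
Hypothesis Xsq : forall i a h, 0 <= h ->
  (P (X i @^-1` (~` [set 0%R] `&` square a h)) <= (rho * (4 * h ^+ 2 / pi))%:E)%E.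
Hypothesis e_small : n%:R * e <= scale K.

Lemma ob_schedule k : (k < K)%N ->
  ob X [set: 'I_n * 'I_n]%SET
    [set w | thin X M (tsize k) (tsize k.+1).-1 (tau k) (tau k.+1) (n%:R * e) R w]
    (expR (- (3 / 4 * a))).
Proof.
move=> kK; have [K3 KL _] := K_bounds; have [e1 e2 _ _ e5] := pred_facts K3.
have rho01 := rho_in01.
have s0 := tau_gt0 k.+1; have sh := tau_half kK.
have s1 : 0 < tau k.+1 <= 1 by rewrite s0 tau_le1.
have h0 : n%:R * e <= R * tau k.+1.
  apply: (le_trans e_small); apply: le_trans (tau_ge kK) _.
  by rewrite ler_peMl ?(ltW s0)//; have := R4; lra.
have [G [net [cG hnet]]] := complex_net s1.
have [La1 La2] := a_ge_L.
have a100 : 100 <= a by have := L4; lra.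
have La : 2000 * L <= a by have := L1; lra.
have tb := tstar_bounds; case: tb => tb _.
have Wle := W_le.
have W0 : 0 <= L + 6 + 2 * K%:R * (L + l).
  have L0 : 0 <= L := le_trans ler01 L1.
  have l0 : 0 <= l := le_trans ler01 l_ge1.
  by rewrite addr_ge0 ?mulr_ge0 ?addr_ge0.
have n16 := n_ge16; have n2 : (2 <= n)%N := leq_trans (isT : (2 <= 16)%N) n16.
have half := expR_half a100.
have [kK1|kK1] := ltnP k.+1 K.
  have [hD _] := tsize_step kK1.
  have hp := mid_p kK1.
  set D := (tsize k.+1).-1 in hD hp *; set t := tsize k in hD *.
  have t0 : (0 < t)%N by exact: tsize_gt0.
  have tr : t%:R * rho <= 65.
    case/andP: tb => _; apply: le_trans; rewrite ler_wpM2r ?(ltW rho_gt0)// ler_nat.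
    exact: tsize_le.
  have x0 : 0 <= n%:R * hitp rho t / 32.
    by rewrite divr_ge0// mulr_ge0// hitp_ge0.
  (* One 32nd of the expected number of hit rows. *)
  pose m := Num.trunc (n%:R * hitp rho t / 32).
  have m1 : m%:R <= n%:R * hitp rho t / 32 by rewrite truncn_le.
  have m2 : n%:R * hitp rho t / 32 <= m.+1%:R by apply: ltW; exact: truncnS_gt.
  have e60 : expR (- (60 * 1000)) <= 1 :> F.
    rewrite expRN; rewrite invf_le1 ?expR_gt0//; exact: big_ge1.
  have th : 0 < (16^-1 : F) <= 1 by rewrite invr_gt0 ltr0n /= invf_le1 ?ltr0n// ler1n.
  have := @ob_step _ _ _ _ _ X M rho indep rho01 X0 Xsq G net t D m (n.+1 ^ D)%N
    (tau k) (tau k.+1) (n%:R * e) R 16^-1 (le_trans hp e60) s0 sh R0 h0 th hnet (card_small_sets n D).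
  apply: ob_sub => //.
  have f1 := mid_first rho01 n_gt0 t0 erefl tr La m1.
  set p := 4 * _ / pi in hp *.
  have p0 : 0 <= p by rewrite /p divr_ge0 ?pi_ge0// mulr_ge0// sqr_ge0.
  have a128 : 66 * 128 <= a.
    apply: le_trans La1; apply: ler_pM; rewrite ?ler0n ?ler_nat//.
    by apply: le_trans L4; rewrite -natrM ler_nat.
  have W1 : L + 6 + 2 * K%:R * (L + l) <= a.
    by apply: le_trans Wle; rewrite ler_peMl// ler1n.
  have f2 := mid_second rho01 n2 t0 R0 s0 erefl erefl (tau_ge kK) cG W1 hD L4 a128 tr m2 p0 hp.
  exact: le_trans (lerD f1 f2) (double_half half).
have Kk : K = k.+1 by apply/eqP; rewrite eqn_leq kK1 kK.
have kE : k = K.-1 by rewrite Kk.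
have hp := last_p; have tl := tsize_last.
rewrite -kE Kk in hp; rewrite -kE in tl; rewrite tl.
have DE : (tsize k.+1).-1 = (3 * n %/ 4)%N.
  by rewrite /tsize -Kk eqxx; case: eqP => // K0; rewrite K0 in K3.
have hD : ((tsize k.+1).-1)%:R <= 3 / 4 * n%:R :> F by rewrite DE; exact: three_quarters.
set D := (tsize k.+1).-1 in hD hp *.
pose m := Num.trunc (15 / 16 * n%:R : F).
have x0 : 0 <= 15 / 16 * n%:R :> F by rewrite mulr_ge0// divr_ge0.
have m1 : m%:R <= 15 / 16 * n%:R :> F by rewrite truncn_le.
have m2 : 15 / 16 * n%:R <= m.+1%:R :> F by apply: ltW; exact: truncnS_gt.
have e48 : expR (- 48) <= 1 :> F by rewrite expR_le1 oppr_le0 ler0n.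
have th : 0 < (expR (- 64) : F) <= 1 by rewrite expR_gt0 expR_le1 oppr_le0 ler0n.
have := @ob_step _ _ _ _ _ X M rho indep rho01 X0 Xsq G net (tstar) D m (2 ^ n)%N
    (tau k) (tau k.+1) (n%:R * e) R (expR (- 64)) (le_trans hp e48) s0 sh R0 h0 th hnet (card_all_sets n D).
apply: ob_sub => //.
have f1 := last_first rho01 n_gt0 erefl tb rho_gt0 La m1.
set p := 4 * _ / pi in hp *.
have p0 : 0 <= p by rewrite /p divr_ge0 ?pi_ge0// mulr_ge0// sqr_ge0.
have [_ tb2] := andP tb.
have f2 := last_second rho01 rho_gt0 n16 R0 s0 erefl erefl (tau_ge kK) cG Wle hD tb2 m2 p0 hp.
exact: le_trans (lerD f1 f2) (double_half half).
Qed.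

Lemma main_bound (mm : nat) : (mm < n)%N -> 0 < e ->
  (P [set w | (sigma (n - mm) (M + random_matrix X w) <= e)%R] <=
   ((8 * n%:R ^+ (2 * K + 3) * R ^+ (2 * K) * e ^+ 2) ^+ (mm + 1)
    + n%:R ^+ 2 * expR (- (3 / 4 * rho * n%:R)))%:E
   + P [set w | (R <= norm_infty (M + random_matrix X w))%R])%E.
Proof.
move=> mn e0; have [K3 KL _] := K_bounds; have rho01 := rho_in01.
have aE : 3 / 4 * rho * n%:R = 3 / 4 * a by ring.
rewrite aE; set x := expR _.
set q := 8 * _ * _ * _.
have x0 : 0 <= x by exact: expR_ge0.
have q0 : 0 <= q.
  by rewrite /q !mulr_ge0// ?exprn_ge0// ltW.
have n16 : 16 <= n%:R :> F by have := L_le_n; have := L4; lra.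
(* If 2 n x >= 1 the right-hand side already exceeds 1. Otherwise powers of 2 n x are at most 2 n
   x. *)
have [big_x|small_x] := leP 1 (2 * n%:R * x).
  apply: (@le_trans _ _ 1%E).
    apply: probability_le1; rewrite (_ : (n - mm)%N = (n - mm).-1.+1); last first.
      by rewrite prednK// subn_gt0.
    apply: (@event_measurable _ _ _ _ _ _ _ X [set: 'I_n * 'I_n]%SET).
    apply: event_sigma_le => //; rewrite prednK ?leq_subr// subn_gt0//.
  rewrite -[leLHS]adde0; apply: leeD; last exact: measure_ge0.
  rewrite lee_fin; apply: (@le_trans _ _ (n%:R ^+ 2 * x)); last first.
    by rewrite lerDr exprn_ge0.
  apply: (le_trans big_x); rewrite ler_wpM2r// expr2; nra.
have tauK : 0 < tau K <= 1 by rewrite tau_gt0 tau_le1.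
have t0 : tsize 0 = 1%N by [].
have tau0 : tau 0 = 1 by [].
have := sigma_prob_le (M := M) indep rho01 X0 Xsq mn e0 R0 tau0 t0 tauK (b := fun=> x)
  (fun k kK => ob_schedule kK).
move/le_trans; apply; rewrite leeD2r// lee_fin addn1.
rewrite sumr_const card_ord -[x *+ K]mulr_natl.
have mx : miss rho (tsize K) <= x.
  apply: le_trans (missE _ rho01) _; rewrite ler_expR lerN2.
  have -> : tsize K = (3 * n %/ 4).+1.
    by rewrite /tsize eqxx; case: eqP => // K0; rewrite K0 in K3.
  have h : 3 / 4 * n%:R <= ((3 * n %/ 4).+1)%:R :> F.
    have : (3 * n)%:R <= (((3 * n %/ 4).+1 * 4)%N)%:R :> F.
      by rewrite ler_nat ltnW// ltn_ceil.
    rewrite !natrM; lra.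
  have -> : 3 / 4 * a = (3 / 4 * n%:R) * rho by ring.
  by rewrite ler_wpM2r// ltW// rho_gt0.
set y := 4 * n%:R ^+ 2 * e ^+ 2 / tau K ^+ 2.
have y0 : 0 <= y.
  by rewrite divr_ge0 ?exprn_ge0 ?(ltW (tau_gt0 K))// mulr_ge0 ?exprn_ge0 ?(ltW e0)// mulr_ge0 ?exprn_ge0.
have ny : 2 * (n%:R * y) = q.
  rewrite /y /q /tau; have -> : (K == 0%N) = false by apply/eqP => K0; rewrite K0 in K3.
  rewrite eqxx /scale.
  have -> : n%:R ^+ (2 * K + 3) = (n%:R ^+ K) ^+ 2 * n%:R ^+ 3 :> F.
    by rewrite exprD mulnC exprM.
  have -> : R ^+ (2 * K) = (R ^+ K) ^+ 2 by rewrite mulnC exprM.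
  by field; rewrite !lt0r_neq0 ?exprn_gt0.
(* Bounding the sum by twice the larger term, n times it is at most 2 n x or 2 n y; the latter is
   [q], whence 8 = 2 * 4 and the exponent 2K + 3. *)
have key : n%:R ^+ mm.+1 * (miss rho (tsize K) + y) ^+ mm.+1 <= (2 * n%:R * x) ^+ mm.+1 + q ^+ mm.+1.
  rewrite -exprMn.
  have m0 := miss_ge0 rho01 (tsize K).
  have [xy|xy] := leP x y.
    apply: (@le_trans _ _ (q ^+ mm.+1)).
      have nq : n%:R * (miss rho (tsize K) + y) <= q.
        by rewrite -ny mulrCA ler_wpM2l//; lra.
      by rewrite lerXn2r ?nnegrE// mulr_ge0 ?addr_ge0.
    by rewrite lerDr exprn_ge0// !mulr_ge0.
  apply: (@le_trans _ _ ((2 * n%:R * x) ^+ mm.+1)).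
    have nq : n%:R * (miss rho (tsize K) + y) <= 2 * n%:R * x.
      by rewrite -mulrA mulrCA ler_wpM2l//; lra.
    by rewrite lerXn2r ?nnegrE ?mulr_ge0 ?addr_ge0.
  by rewrite lerDl exprn_ge0.
have key2 : (2 * n%:R * x) ^+ mm.+1 <= 2 * n%:R * x.
  by rewrite exprS ler_piMr ?mulr_ge0// exprn_ile1 ?mulr_ge0// ltW.
(* The [K] steps cost [x] each; K + 2n <= n^2 yields the factor in front of the exponential. *)
have key3 : K%:R * x + 2 * n%:R * x <= n%:R ^+ 2 * x.
  rewrite -mulrDl ler_wpM2r// expr2.
  have := L_le_n; have h := KL; nra.
lra.
Qed.
End prob.

End schedule.

Theorem proposition4p6 (F : realType) :
  exists n0 : nat, forall n : nat, (n0 <= n)%N ->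
  forall (M : 'M[F[i]]_n) (m : nat), (m < n)%N ->
  forall (R rho eps : F) (K : nat),
  4 <= R ->
  ln R ^+ 3 * ln n%:R ^+ 3 / n%:R <= rho <= Num.sqrt n%:R / n%:R ->
  K%:Z = Num.ceil (3 * ln n%:R / (2 * ln (n%:R * rho))) ->
  1 / (n%:R ^+ (10 * (K + 1)) * R ^+ (10 * (K + 1))) <= eps
    <= 1 / (4 * n%:R ^+ (K + 1) * R ^+ K) ->
  forall (d d' : measure_display) (T : measurableType d)
    (T' : measurableType d') (P : probability T F) (P' : probability T' F)
    (X : 'I_n * 'I_n -> {RV P >-> F[i]})
    (delta : {RV P' >-> bool}) (g : {RV P' >-> F[i]}),
  iid_copies_sparse_gaussian rho X delta g ->
  (P [set w | (sigma (n - m) (M + random_matrix X w) <= eps)%R] <=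
   ((8 * n%:R ^+ (2 * K + 3) * R ^+ (2 * K) * eps ^+ 2) ^+ (m + 1)
    + n%:R ^+ 2 * expR (- (3 / 4 * rho * n%:R)))%:E
   + P [set w | (R <= norm_infty (M + random_matrix X w))%R])%E.
Proof.
exists (Num.trunc (expR (large F))).+1 => n nlarge M m mn R rho eps K R4 hrho hK.
move=> /andP[eps1 eps2] d d' T T' P P' X delta g iid.
have n0 : (0 < n)%N by exact: leq_trans nlarge.
have n0F : (0 : F) < n%:R by rewrite ltr0n.
have R0 : 0 < R by lra.
have Ll : large F <= ln n%:R.
  rewrite -ler_expR lnK ?posrE//; apply: ltW; apply: lt_le_trans (truncnS_gt _) _.
  by rewrite ler_nat.
have [_ _ _ indep _] := iid.
have rho01 := rho_in01 Ll R4 hrho.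
have eps0 : 0 < eps.
  by apply: lt_le_trans eps1; rewrite divr_gt0// mulr_gt0// exprn_gt0.
(* The upper bound on [eps] places the residual n eps of the kernel vector below the last scale (n
   R)^-K. *)
have small : n%:R * eps <= scale n R K.
  apply: (@le_trans _ _ (n%:R * (1 / (4 * n%:R ^+ (K + 1) * R ^+ K)))).
    by rewrite ler_wpM2l// ltW.
  have -> : n%:R * (1 / (4 * n%:R ^+ (K + 1) * R ^+ K)) = 4^-1 * scale n R K.
    by rewrite /scale exprD expr1; field; rewrite !lt0r_neq0 ?exprn_gt0.
  by rewrite ler_piMl ?invf_le1 ?ler1n// ltW// scale_gt0.
exact: (main_bound Ll R4 hrho hK M indep (entry_eq0 rho01 iid)
  (fun ij a h => entry_square rho01 iid ij a (h := h)) small mn eps0).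
Qed.
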